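(* Let $E$ be a Polish space, $d$ a lower semi-continuous metric on $E$, $1\le p\le2$, $1/p+1/q=1$, $C>0$, and $P$ a probability measure on $E$. For $\alpha\in M^+(E)$ and $f\in\mathcal C_b$ put $f_{\alpha,d}(y)=\inf_{x\in E}\{\alpha(y)d(x,y)+f(x)\}$. Then: (1) $P$ satisfies $\tilde T_{p,d}(C)$ if and only if $$\sup_{\lambda>0}\ \sup_{\alpha\in M^+(E)}\ \sup_{f\in\mathcal C_b}\ P\Big[\exp\Big(\lambda(f_{\alpha,d}-P[f])-C\lambda^2\Big(\frac{\alpha^q-1}{q}+\frac12\Big)\Big)\Big]\le1.$$ (2) $P$ satisfies $\tilde T^{(i)}_{p,d}(C)$ if and only if $$\sup_{\lambda>0}\ \sup_{\alpha\in M^+(E)}\ \sup_{f\in\mathcal C_b}\ P\Big[\exp\Big(\lambda(P[f_{\alpha,d}]-f)-C\lambda^2\Big(\frac{P[\alpha^q]-1}{q}+\frac12\Big)\Big)\Big]\le1.$$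
   Context: Notation: $P[h]=\int h\,dP$; $\mathcal C_b$ is the set of bounded continuous functions $E\to\mathbb R$; $M^+(E)$ is the set of non-negative lower semi-continuous functions on $E$; $\mathcal K(Q|P)=Q[\log(dQ/dP)]$ is the relative entropy. Convention: $+\infty/+\infty=0/0=0$. $$\tilde W_{p,d}(P,Q)=\sup_{\alpha\in M^+(E)}\ \inf_{\pi}\ \frac{\pi[\alpha(Y)d(X,Y)]}{Q[\alpha^q]^{1/q}},$$ the infimum being over all couplings $\pi$ of $(X,Y)$ with $X\sim P$, $Y\sim Q$; for $q=\infty$, $Q[\alpha^q]^{1/q}$ is the $Q$-essential supremum of $\alpha$. $P$ satisfies $\tilde T_{p,d}(C)$ if $\tilde W_{p,d}(P,Q)\le\sqrt{2C\mathcal K(Q|P)}$ for all probability measures $Q$ on $E$; it satisfies $\tilde T^{(i)}_{p,d}(C)$ if $\tilde W_{p,d}(Q,P)\le\sqrt{2C\mathcal K(Q|P)}$ for all $Q$. When $p=1$ ($q=\infty$) the two dual expressions are understood as limits $q\to\infty$: they depend on $\alpha$ only through the constraint $\alpha\le1$, the bracket $\frac{\alpha^q-1}{q}+\frac12$ (resp. with $P[\alpha^q]$) being then equal to $\frac12$. *)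

(* Defs.v *)
From HB Require Import structures.
From mathcomp Require Import all_boot all_order all_algebra.
From mathcomp Require Import all_classical all_reals all_analysis.

Set Implicit Arguments.
Unset Strict Implicit.
Unset Printing Implicit Defensive.

Import Order.TTheory GRing.Theory Num.Theory.
Import numFieldNormedType.Exports.

Local Open Scope classical_set_scope.
Local Open Scope ring_scope.
Local Open Scope charge_scope.

(* Measurable types are pointed in the library, hence [ptopologicalType]; this
   costs no generality, as a space carrying a probability is nonempty. *)
Notation borel E := (g_sigma_algebraType (@open E)).

Section metric.
Context {R : realType}.

Definition is_metric (T : Type) (d : T -> T -> R) : Prop :=
  [/\ forall x y, 0 <= d x y,
      forall x y, d x y = 0 <-> x = y,
      forall x y, d x y = d y x
    & forall x y z, d x z <= d x y + d y z].

Definition metrizes (E : topologicalType) (rho : E -> E -> R) : Prop :=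
  forall (x : E) (A : set E),
    nbhs x A <-> exists2 e, 0 < e & [set y | rho x y < e] `<=` A.

Definition complete_metric (T : Type) (rho : T -> T -> R) : Prop :=
  forall u : nat -> T,
    (forall e, 0 < e -> exists N, forall m n, (N <= m)%N -> (N <= n)%N ->
       rho (u m) (u n) < e) ->
    exists l, forall e, 0 < e -> exists N, forall n, (N <= n)%N ->
       rho (u n) l < e.

Definition polish (E : topologicalType) : Prop :=
  (exists A : set E, countable A /\ dense A) /\
  exists rho : E -> E -> R,
    [/\ is_metric rho, metrizes rho & complete_metric rho].

End metric.
Arguments polish R E : clear implicits.

Section function_classes.
Context {R : realType} {E : ptopologicalType}.

(* The class $M^+(E)$. *)
Definition nonneg_lsc : set (E -> R) :=
  [set alpha | (forall y, 0 <= alpha y) /\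
               lower_semicontinuous (EFin \o alpha)].

Definition bounded_continuous : set (E -> R) :=
  [set f | continuous f /\ bounded_fun f].

End function_classes.

Section transport.
Context {R : realType}.
Local Open Scope ereal_scope.

Definition couplings d1 d2 (T1 : measurableType d1) (T2 : measurableType d2)
    (P : probability T1 R) (Q : probability T2 R) :
    set (probability (T1 * T2)%type R) :=
  [set pi | (forall A, measurable A -> pushforward pi fst A = P A) /\
            (forall B, measurable B -> pushforward pi snd B = Q B)].

Definition relative_entropy d (T : measurableType d) (Q P : probability T R) :
    \bar R :=
  if pselect (Q `<< P)
  then \int[Q]_x lne (('d (charge_of_finite_measure Q) '/d P) x)
  else +oo.

Context {E : ptopologicalType}.
Implicit Types (P Q : probability (borel E) R) (dist : E -> E -> R).

(* $\tilde W_{p,d}(P,Q)$, which depends on $p$ only through its conjugate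
   exponent [q]. The Lnorm with [q = +oo] is the essential supremum, and
   extended-real division already satisfies +oo / +oo = 0 / 0 = 0. *)
Definition weak_transport (q : \bar R) dist P Q : \bar R :=
  ereal_sup [set ereal_inf
    [set (\int[pi]_z (alpha z.2 * dist z.1 z.2)%:E) /
         'N[Q]_q[EFin \o alpha] | pi in couplings P Q]
    | alpha in @nonneg_lsc R E].

(* $\tilde T_{p,d}(C)$ *)
Definition weak_transport_ineq (q : \bar R) dist (C : R) P : Prop :=
  forall Q, weak_transport q dist P Q
            <= sqrte ((2 * C)%:E * relative_entropy Q P).

(* $\tilde T^{(i)}_{p,d}(C)$ *)
Definition inverted_weak_transport_ineq (q : \bar R) dist (C : R) P : Prop :=
  forall Q, weak_transport q dist Q P
            <= sqrte ((2 * C)%:E * relative_entropy Q P).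

(* $f_{\alpha,d}$. For [f] in $C_b$ the set is nonempty and bounded below, so
   the real infimum is the genuine one. The function need not be Borel, but for
   lower semicontinuous data its strict sublevel sets are projections of
   F-sigma sets, hence universally measurable. The library's integral, built
   from suprema over simple minorants, therefore agrees on it with the integral
   against the completed measure. *)
Definition inf_conv (alpha : E -> R) dist (f : E -> R) (y : E) : R :=
  inf [set (alpha y * dist x y + f x)%R | x in [set: E]].

(* The weights of the dual formulas: in the limit case [q = +oo] the penalty
   becomes the constraint [alpha <= 1]. *)
Definition dual_weights (q : \bar R) : set (E -> R) :=
  [set alpha | nonneg_lsc alpha /\
               (q = +oo -> forall y, (alpha y <= 1)%R)].

(* $(m(q) - 1)/q + 1/2$, which is $1/2$ in the limit case [q = +oo]. *)
Definition bracket (q : \bar R) (m : R -> \bar R) : \bar R :=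
  match q with
  | r%:E => (m r - 1) / r%:E + (2^-1)%:E
  | _ => (2^-1)%:E
  end.

End transport.

(* Main.v *)
(** By the Gibbs variational principle, an exponential bound P[exp phi] <= 1
    means Q[phi] <= K(Q|P) for every Q. Applied to the exponents of the dual
    formulas, and optimised in lambda and in the size of alpha (Young's
    inequality and m^2/2 <= (m^q - 1)/q + 1/2 for q >= 2), it turns the
    transport-entropy inequality into a bound on Q[f_alpha] - P[f], which by
    Kantorovich duality for the lower semicontinuous cost alpha(y) d(x,y) is a
    bound on the transport cost.

    Kantorovich duality is proved without weak compactness. The dual problem
    defines a sublinear functional on bounded functions of (x,y); a countable
    Hahn-Banach argument makes it linear on the algebra generated by countably
    many cylinders over small balls, where it is a finitely additive
    probability. Its values on cylinders are realised by Bernoulli-type bits on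
    [0,1), and completeness of E decodes these bits into a pair of E-valued
    random variables, whose law is the coupling.

    The function f_alpha is only universally measurable: its sublevel sets are
    projections of F-sigma sets, which Choquet's capacitability argument
    sandwiches between Borel sets of equal P-measure. *)
Require Import Defs.
From HB Require Import structures.
From mathcomp Require Import all_boot all_order all_algebra.
From mathcomp Require Import all_classical all_reals all_analysis.
From mathcomp Require Import measurable_realfun ess_sup_inf hoelder ring lra.

Set Implicit Arguments.
Unset Strict Implicit.
Unset Printing Implicit Defensive.

Import Order.TTheory GRing.Theory Num.Theory.
Import numFieldNormedType.Exports.

Local Open Scope classical_set_scope.
Local Open Scope ring_scope.

(** * Sublinear functionals *)

(** A finitely additive law is harmless on bit sequences: it assigns consistent masses to finite
    words, and nested intervals of these lengths realise them. What could fail is that mass escapes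
    from E, all bits of some level being false. The countably additive marginals exclude this, since
    they hedge that event by functions of arbitrarily small mean. Cells are open, while a limit of
    their centres is only located in closed balls, so the decoded laws are compared with the
    marginals through Lipschitz functions and not cell by cell. The bound p <= 2 enters as q >= 2.
    The inequality m^2/2 <= (m^q - 1)/q + 1/2 is an equality at m = 1, so weights of norm 1 recover
    the exact constant from the dual formulas; other norms matter when the dual formulas are
    derived. Universal measurability of f_alpha serves part (2), where P[f_alpha] integrates a
    signed function. In part (1) f_alpha occurs inside a nonnegative integrand, whose integral is a
    supremum over simple minorants, and one such minorant carries the argument. *)

Section sublinear.
Context {R : realType} {V : lmodType R}.
Implicit Types (S : set V) (p q : V -> R).

Definition submodule S :=
  (forall x y, S x -> S y -> S (x + y)) /\ (forall a x, S x -> S (a *: x)).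

Definition sublinear_on S p :=
  (forall x y, S x -> S y -> p (x + y) <= p x + p y) /\
  (forall a x, 0 < a -> S x -> p (a *: x) <= a * p x).

(** Homogeneity is assumed as an inequality for positive factors; the factors 2 and 1/2 give the two
    signs. *)
Lemma sublinear_on0 S p : submodule S -> sublinear_on S p -> S 0 -> p 0 = 0.
Proof.
move=> _ [_ pZ] S0; have := pZ 2 0 (ltr0n _ 2) S0; have := pZ 2^-1 0 _ S0.
by rewrite !scaler0 => /(_ ltac:(lra)) ? ?; lra.
Qed.

Lemma sublinear_onN S p x : submodule S -> sublinear_on S p -> S x ->
  - p (- x) <= p x.
Proof.
move=> sS sp Sx; have [SD SZ] := sS; have [pD _] := sp.
have SNx : S (- x) by rewrite -scaleN1r; exact: SZ.
have S0 : S 0 by rewrite -(scale0r x); exact: SZ.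
by have := pD _ _ Sx SNx; rewrite subrr (sublinear_on0 sS sp S0); lra.
Qed.

Definition linear_along p v := p (- v) = - p v.

Section line.
Variables (S : set V) (p : V -> R) (v : V).
Hypotheses (sS : submodule S) (sp : sublinear_on S p) (Sv : S v).

(** The decrease used to show that minimal sublinear functionals are linear. Taking [t = 1] at [- v]
    brings the value there down to [- p v], which forces linearity along [v]. *)
Definition along_line x := inf [set p (x + t *: v) - t * p v | t in [set t | 0 <= t]].

Let SD x y : S x -> S y -> S (x + y). Proof. exact: sS.1. Qed.
Let SZ a x : S x -> S (a *: x). Proof. exact: sS.2. Qed.
Let SN x : S x -> S (- x). Proof. by rewrite -scaleN1r; exact: SZ. Qed.

Let pZ t x : 0 <= t -> S x -> p (t *: x) <= t * p x.
Proof.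
rewrite le_eqVlt => /predU1P[<-|t0] Sx; last exact: sp.2.
by rewrite scale0r (sublinear_on0 sS sp) ?mul0r// -(scale0r x); exact: SZ.
Qed.

(** The infimum is finite because t p(v) <= p(t v) <= p(x + t v) + p(-x). *)
Let along_line_lb x : S x ->
  lbound [set p (x + t *: v) - t * p v | t in [set t | 0 <= t]] (- p (- x)).
Proof.
move=> Sx _ /= [t t0 <-].
have Stv : S (t *: v) by exact: SZ.
have := sublinear_onN sS sp Stv.
have := pZ t0 Sv.
have : p (t *: v) <= p (x + t *: v) + p (- x).
  by rewrite -{1}[t *: v](addrK x) [t *: v + x]addrC; apply: sp.1;
    [exact: SD|exact: SN].
have : t * p v <= p (t *: v).
  move: t0; rewrite le_eqVlt => /predU1P[<-|t0].
    by rewrite scale0r (sublinear_on0 sS sp) ?mul0r// -(scale0r x); exact: SZ.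
  rewrite -ler_pdivlMl//.
  by apply: (le_trans _ (sp.2 _ _ _ Stv)); rewrite ?invr_gt0// scalerA mulVf ?scale1r//
    gt_eqF.
lra.
Qed.

Lemma along_line_le x t : S x -> 0 <= t -> along_line x <= p (x + t *: v) - t * p v.
Proof.
move=> Sx t0; apply: ge_inf; last by exists t.
by exists (- p (- x)); exact: along_line_lb.
Qed.

Lemma le_along_line x a : (forall t, 0 <= t -> a <= p (x + t *: v) - t * p v) ->
  a <= along_line x.
Proof.
move=> H; apply: lb_le_inf; first by exists (p (x + 0 *: v) - 0 * p v); exists 0 => /=.
by move=> _ /= [t t0 <-]; exact: H.
Qed.

Lemma sublinear_along_line : sublinear_on S along_line.
Proof.
split=> [x y Sx Sy|a x a0 Sx].
- suff H : forall t, 0 <= t -> along_line (x + y) - along_line y <= p (x + t *: v) - t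
  * p v.
    by have := le_along_line H; lra.
  move=> t t0.
  suff H : forall s, 0 <= s -> along_line (x + y) - (p (x + t *: v) - t * p v)
      <= p (y + s *: v) - s * p v.
    by have := le_along_line H; lra.
  (* Witnesses [t] for [x] and [s] for [y] combine into the witness [t + s] for [x + y]. *)
  move=> s s0; have := along_line_le (SD Sx Sy) (addr_ge0 t0 s0).
  have := sp.1 _ _ (SD Sx (SZ t Sv)) (SD Sy (SZ s Sv)).
  by rewrite scalerDl addrACA; lra.
- rewrite -ler_pdivrMl//; apply: le_along_line => t t0.
  rewrite ler_pdivrMl//.
  apply: (le_trans (along_line_le (SZ a Sx) (mulr_ge0 (ltW a0) t0))).
  rewrite -scalerA -scalerDr mulrBr mulrA lerB//.
  by apply: sp.2 => //; exact: SD Sx (SZ _ Sv).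
Qed.

Lemma along_line_le_id x : S x -> along_line x <= p x.
Proof. by move=> Sx; have := along_line_le Sx (lexx 0);
  rewrite scale0r mul0r addr0 subr0. Qed.

Lemma along_lineN : along_line (- v) <= - p v.
Proof.
have := along_line_le (SN Sv) ler01; rewrite scale1r addNr mul1r (sublinear_on0 sS sp)
  ?sub0r//.
by rewrite -(scale0r v); exact: SZ.
Qed.

End line.

(* A countable Hahn-Banach theorem: instead of extending a linear form, the
   sublinear functional is decreased until it is linear along each [v n]. *)
Lemma sublinear_linearize S p (v : nat -> V) :
    submodule S -> sublinear_on S p -> (forall n, S (v n)) ->
  exists q, [/\ sublinear_on S q, forall x, S x -> q x <= p x
    & forall n, linear_along q (v n)].
Proof.
move=> sS sp Sv.
have [SD SZ] := sS.
have SN x : S x -> S (- x) by rewrite -scaleN1r; exact: SZ.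
pose P := fix P n := if n is m.+1 then along_line (P m) (v m) else p.
have sP n : sublinear_on S (P n).
  by elim: n => [//|n ih]; exact: sublinear_along_line.
have Pdec n m x : S x -> (n <= m)%N -> P m x <= P n x.
  move=> Sx; elim: m => [|m ih]; first by rewrite leqn0 => /eqP ->.
  rewrite leq_eqVlt => /predU1P[->//|]; rewrite ltnS => /ih.
  by apply: le_trans; exact: (along_line_le_id sS (sP m) (Sv m) Sx).
have Plb n x : S x -> - p (- x) <= P n x.
  move=> Sx; apply: le_trans (sublinear_onN sS (sP n) Sx).
  by rewrite lerN2; apply: (Pdec 0%N) => //; exact: SN.
pose q x := inf [set P n x | n in [set: nat]].
have qP n x : S x -> q x <= P n x.
  move=> Sx; apply: ge_inf; last by exists n.
  by exists (- p (- x)) => _ [m _ <-]; exact: Plb.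
have le_q a x : (forall n, a <= P n x) -> a <= q x.
  move=> H; apply: lb_le_inf; first by exists (P 0%N x); exists 0%N.
  by move=> _ [n _ <-]; exact: H.
have sq : sublinear_on S q.
  split=> [x y Sx Sy|a x a0 Sx].
  - suff H n : q (x + y) - q y <= P n x by have := le_q _ _ H; lra.
    suff H m : q (x + y) - P n x <= P m y by have := le_q _ _ H; lra.
    (* The functionals [P n] decrease, so a common later index serves both [x] and [y]. *)
    have := qP (maxn n m) _ (SD _ _ Sx Sy).
    have := (sP (maxn n m)).1 _ _ Sx Sy.
    by have := Pdec _ _ _ Sx (leq_maxl n m); have := Pdec _ _ _ Sy (leq_maxr n m); lra.
  - rewrite -ler_pdivrMl//; apply: le_q => n; rewrite ler_pdivrMl//.
    exact: le_trans (qP n _ (SZ _ _ Sx)) ((sP n).2 _ _ a0 Sx).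
exists q; split => //; first by move=> x; exact: (qP 0%N).
move=> n; rewrite /linear_along.
(* Linearity gained at stage n.+1 survives every later decrease: q(-v) <= P_{n+1}(-v) <= - P_n(v) <=
   - q(v), and sublinearity gives the converse. *)
have := sublinear_onN sS sq (SN _ (Sv n)); rewrite opprK.
have := qP n.+1 _ (SN _ (Sv n)).
have := along_lineN sS (sP n) (Sv n).
have := sublinear_onN sS sq (Sv n).
have := qP n _ (Sv n) => /=.
lra.
Qed.

(** If [p] is linear along x and y, the value at x + y is squeezed: p(x + y) >= - p(- x - y) >= -
    p(-x) - p(-y) = p(x) + p(y). The induction therefore carries linearity along the partial sum
    together with its value. *)
Lemma linear_along_sum S p (I : eqType) (s : seq I) (a : I -> R) (v : I -> V) :
    submodule S -> sublinear_on S p -> S 0 ->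
    (forall i, i \in s -> S (v i)) -> (forall i, i \in s -> linear_along p (v i)) ->
  p (\sum_(i <- s) a i *: v i) = \sum_(i <- s) a i * p (v i).
Proof.
move=> sS sp S0 Sv lv; have [SD SZ] := sS.
have SN x : S x -> S (- x) by rewrite -scaleN1r; exact: SZ.
have pZ b x : 0 < b -> S x -> p (b *: x) = b * p x.
  move=> b0 Sx; apply/eqP; rewrite eq_le sp.2//= -ler_pdivlMl//.
  by apply: (le_trans _ (sp.2 _ _ _ (SZ _ _ Sx)));
    rewrite ?invr_gt0// scalerA mulVf ?scale1r// gt_eqF.
have p0 := sublinear_on0 sS sp S0.
have lZ b x : S x -> linear_along p x -> p (b *: x) = b * p x /\ linear_along p (b *:
  x).
  move=> Sx lx; rewrite /linear_along; have [b0|b0|->] := ltgtP b 0.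
  - have SNx := SN _ Sx; have nb : 0 < - b by rewrite oppr_gt0.
    have -> : p (b *: x) = b * p x.
      rewrite (_ : b *: x = (- b) *: (- x)); last by rewrite scalerN scaleNr opprK.
      by rewrite pZ// lx mulrNN.
    by rewrite -scaleNr pZ// mulNr.
  - by rewrite -scalerN !pZ ?lx ?mulrN//; exact: SN.
  - by rewrite scale0r mul0r oppr0 p0 oppr0.
suff : [/\ S (\sum_(i <- s) a i *: v i), linear_along p (\sum_(i <- s) a i *: v i) &
  p (\sum_(i <- s) a i *: v i) = \sum_(i <- s) a i * p (v i)] by case.
elim: s Sv lv => [|i s ih] Sv lv; first by rewrite /linear_along !big_nil oppr0 p0
  oppr0.
have [Ss ls es] : [/\ S (\sum_(i <- s) a i *: v i), linear_along p (\sum_(i <- s) a i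
  *: v i) &
  p (\sum_(i <- s) a i *: v i) = \sum_(i <- s) a i * p (v i)].
  by apply: ih => j js; [apply: Sv|apply: lv]; rewrite inE js orbT.
have Si : S (v i) by apply: Sv; rewrite inE eqxx.
have [ei li] := lZ (a i) _ Si (lv _ (mem_head _ _)).
have Sai := SZ (a i) _ Si.
rewrite !big_cons; move: Ss ls es; set x := a i *: v i in ei li Sai *.
set y := \sum_(j <- s) a j *: v j => Sy ly es.
have H := sublinear_onN sS sp (SD _ _ Sai Sy).
have H1 := sp.1 _ _ Sai Sy.
have H2 := sp.1 _ _ (SN _ Sai) (SN _ Sy).
rewrite -opprD in H2.
move: li ly; rewrite /linear_along => li ly.
rewrite -es -ei; split; first exact: SD; lra.
Qed.

End sublinear.

(** * Random bits with prescribed law *)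

(* The latest bit comes first. *)
Fixpoint code (b : nat -> bool) n : seq bool := if n is k.+1 then b k :: code b k else
  [::].

Section bits.
Context {R : realType}.
Variable m : seq bool -> R.
Hypotheses (m0 : forall s, 0 <= m s) (m1 : m [::] = 1).
Hypothesis mS : forall s, m s = m (false :: s) + m (true :: s).

(* The code [s] is read on the interval [left_end s, left_end s + m s). *)
Local Fixpoint left_end s : R :=
  if s is b :: s' then left_end s' + (if b then m (false :: s') else 0) else 0.

(** The bits of the point [w]: the interval of a word splits into its [false] part on the left and
    its [true] part on the right, and the new bit tells which part contains [w]. *)
Local Fixpoint prefix_code (w : R) n : seq bool :=
  if n is k.+1 then
    let s := prefix_code w k in (left_end s + m (false :: s) <= w) :: s
  else [::].

Let bit n (w : R) := let s := prefix_code w n in left_end s + m (false :: s) <= w.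

Let code_bit w n : code (bit^~ w) n = prefix_code w n.
Proof. by elim: n => //= n ->. Qed.

Let prefix_codeP w s : 0 <= w < 1 ->
  (prefix_code w (size s) == s) = (left_end s <= w < left_end s + m s).
Proof.
move=> w01; elim: s => [|b s ih] /=; first by rewrite eqxx m1 add0r w01.
rewrite eqseq_cons; have [e|ne] := eqVneq (prefix_code w (size s)) s.
  move: ih; rewrite e eqxx => /esym/andP[h1 h2]; rewrite andbT.
  have := m0 (false :: s); have := m0 (true :: s); have := mS s.
  by case: b; case: (lerP (left_end s + m (false :: s)) w) => h e1 e2 e3 /=;
    apply/esym; rewrite ?eqxx ?addr0;
    first [by [] | by apply: (introT idP); lra | by apply/negbTE/negP => /andP[? ?]; lra
          | by apply: (introT idP); apply/andP; split; lra].
rewrite andbF; apply/esym/negbTE; apply: contra ne => /andP[h1 h2].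
rewrite ih; have := m0 (false :: s); have := m0 (true :: s); have := mS s.
by case: b h1 h2 => /= h1 h2; lra.
Qed.

Let left_end_bound s : 0 <= left_end s /\ left_end s + m s <= 1.
Proof.
elim: s => [|b s [h1 h2]] /=; first by rewrite m1; lra.
have := m0 (false :: s); have := m0 (true :: s); have := mS s.
by case: b; lra.
Qed.

Let measurable_prefix_code s :
  measurable [set w : measurableTypeR R | prefix_code w (size s) = s].
Proof.
elim: s => [|b s ih] /=; first by rewrite (_ : [set _ | _] = setT)//; apply/seteqP;
  split.
rewrite (_ : [set _ | _] = [set w | prefix_code w (size s) = s] `&`
   [set w | b = (left_end s + m (false :: s) <= w)]).
  apply: measurableI => //; case: b.
    rewrite (_ : [set _ | _] = `[left_end s + m (false :: s), +oo[%classic);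
      first exact: measurable_itv.
    by apply/seteqP; split => w /=; rewrite in_itv/= andbT; case: (_ <= _).
  rewrite (_ : [set _ | _] = `]-oo, left_end s + m (false :: s)[%classic);
    first exact: measurable_itv.
  by apply/seteqP; split => w /=; rewrite in_itv/= ltNge; case: (_ <= _).
by apply/seteqP; split => w /= => [[e e']|[e ->]]; rewrite ?e' in e *; rewrite ?e.
Qed.

(** Lebesgue measure on [0,1) already exists, so consistent word masses need no extension theorem:
    the points whose code is [s] form an interval of length [m s]. *)
Lemma coin_flips : exists (mu : probability (measurableTypeR R) R) (bit : nat -> R ->
  bool),
  forall s, measurable [set w : measurableTypeR R | code (bit^~ w) (size s) = s] /\
    mu [set w : measurableTypeR R | code (bit^~ w) (size s) = s] = (m s)%:E.
Proof.
pose nu := mrestr (@lebesgue_measure R) (measurable_itv `[(0:R), 1[).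
have nu1 : nu setT = 1%E.
  by rewrite /nu /mrestr setTI lebesgue_measure_itv/= lte_fin ltr01 oppr0 adde0.
pose mu : probability (measurableTypeR R) R :=
  HB.pack nu (Measure_isProbability.Build _ _ _ nu nu1).
exists mu, bit => s; split.
  by under eq_fun do rewrite code_bit; exact: measurable_prefix_code.
rewrite /mu/= /nu /mrestr (_ : _ `&` _ = `[left_end s, left_end s + m s[%classic).
  rewrite lebesgue_measure_itv/= lte_fin ltrDl.
  have := m0 s; rewrite le_eqVlt => /predU1P[<-|h]; first by rewrite ltxx.
  by rewrite h -EFinB addrC addKr.
have [h1 h2] := left_end_bound s.
apply/seteqP; split => w /=; rewrite !in_itv/= code_bit.
  by move=> [/eqP + w01]; rewrite prefix_codeP.
move=> h; have w01 : 0 <= w < 1 by lra.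
by split => //; apply/eqP; rewrite prefix_codeP.
Qed.

End bits.

(** * Cells of a separable metric space *)

Definition rad {R : realType} (k : nat) : R := k.+1%:R^-1.

Lemma rad_gt0 {R : realType} k : 0 < rad k :> R. Proof. by rewrite invr_gt0. Qed.

Lemma rad_small {R : realType} (e : R) : 0 < e ->
  exists N, forall k, (N <= k)%N -> rad k < e.
Proof.
move=> e0; have [N _ h] := near_infty_natSinv_lt (PosNum e0).
by exists N => k; exact: h.
Qed.

Section metric_topology.
Context {R : realType} {E : ptopologicalType}.
Variables (rho : E -> E -> R) (x : nat -> E).
Hypotheses (rho_metric : is_metric rho) (rhoE : metrizes rho).
Hypothesis x_dense : forall y e, 0 < e -> exists j, rho (x j) y < e.

Let rhoC y z : rho y z = rho z y. Proof. by have [_ _ h _] := rho_metric. Qed.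
Let rho_tri y z t : rho y t <= rho y z + rho z t.
Proof. by have [_ _ _ h] := rho_metric. Qed.
Let rho_ge0 y z : 0 <= rho y z. Proof. by have [h _ _ _] := rho_metric. Qed.

Definition cell (n : nat * nat) : set E := [set y | rho (x n.2) y < rad n.1].

Lemma open_metricP (U : set E) :
  open U <-> forall y, U y -> exists2 e, 0 < e & [set z | rho y z < e] `<=` U.
Proof.
rewrite openE; split => [h y /h|h y /h]; first by move=> /rhoE.
by move=> ?; apply/rhoE.
Qed.

Lemma open_rho_ball y e : open [set z | rho y z < e].
Proof.
apply/open_metricP => z /= h; exists (e - rho y z); first by rewrite subr_gt0.
by move=> t /= ht; have := rho_tri y z t; lra.
Qed.

Lemma open_cell n : open (cell n). Proof. exact: open_rho_ball. Qed.

Lemma cell_cover k y : exists j, cell (k, j) y.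
Proof. by have [j h] := @x_dense y (rad k) (rad_gt0 k); exists j. Qed.

Lemma cell_basis (U : set E) y : open U -> U y -> exists2 n, cell n y & cell n `<=` U.
Proof.
move=> /open_metricP h /h[e e0 hU].
have [N /(_ N (leqnn N)) hN] := rad_small (ltac:(lra) : 0 < e / 2).
have [j hj] := cell_cover N y.
exists (N, j) => // z; move: hj; rewrite /cell/= => hj hz; apply: hU => /=.
by have := rho_tri y (x j) z; rewrite [rho y (x j)]rhoC; lra.
Qed.

Lemma open_prod_basis (O : set (E * E)) z : open O -> O z ->
  exists n, [/\ cell n.1 z.1, cell n.2 z.2 & cell n.1 `*` cell n.2 `<=` O].
Proof.
rewrite openE => h /h; rewrite /interior => -[[/= A B] [nA nB] AB].
have oA := open_interior A; have oB := open_interior B.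
have [n nz nA'] := cell_basis oA nA; have [m mz mB] := cell_basis oB nB.
exists (n, m); split => // t [/= /nA' t1 /mB t2]; apply: AB; split => /=;
  exact: interior_subset.
Qed.

(** Separability makes an open set of the product a countable union of products of cells, so the
    product of the Borel sigma-algebras contains it. This makes lower semicontinuous costs
    measurable for couplings. *)
Lemma measurable_open_prod (O : set (E * E)) : open O ->
  measurable (O : set (borel E * borel E)).
Proof.
move=> oO.
rewrite (_ : O = \bigcup_n (if `[< cell n.1 `*` cell n.2 `<=` O >]
  then cell n.1 `*` cell n.2 else set0)); last first.
  apply/seteqP; split => [z /(open_prod_basis oO)[n [n1 n2 nO]]|z [n _]].
    by exists n => //; case: asboolP.
  by case: asboolP => // h /h.
apply: countable_bigcupT_measurable; first exact: countableP.
move=> n; case: asboolP => // _.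
by apply: measurableX; apply: sub_sigma_algebra; exact: open_cell.
Qed.

Lemma lsc_prod_measurable (h : E * E -> \bar R) : lower_semicontinuous h ->
  measurable_fun [set: (borel E * borel E)%type] h.
Proof.
move=> hl; apply: (measurability _ (ErealGenOInfty.measurableE R)).
move=> /= _ [_ [a ->]] <-; rewrite setTI; apply: measurable_open_prod.
by rewrite preimage_itvoy; move/lower_semicontinuousP : hl; exact.
Qed.

Lemma lipschitz_continuous (f : E -> R) M :
  (forall y z, `|f y - f z| <= M * rho y z) -> continuous f.
Proof.
move=> fM y; apply/cvgrPdist_lt => e e0.
(* The constant [M] may be zero or negative, hence the denominator. *)
apply/rhoE; exists (e / (`|M| + 1)); first by rewrite divr_gt0// ltr_wpDl.
move=> z /= h; apply: le_lt_trans (fM _ _) _.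
have : rho y z * (`|M| + 1) < e by rewrite -ltr_pdivlMr// ltr_wpDl.
apply: le_lt_trans; rewrite mulrC ler_wpM2l//.
by rewrite (le_trans (ler_norm _))// lerDl.
Qed.

End metric_topology.

Lemma lsc_measurable {R : realType} {E : ptopologicalType} (f : E -> \bar R) :
  lower_semicontinuous f -> measurable_fun [set: borel E] f.
Proof.
move=> hl; apply: (measurability _ (ErealGenOInfty.measurableE R)).
move=> /= _ [_ [a ->]] <-; rewrite setTI; apply: sub_sigma_algebra.
by rewrite preimage_itvoy; move/lower_semicontinuousP : hl; exact.
Qed.

Lemma continuous_borel_measurable {R : realType} {E : ptopologicalType} (f : E -> R) :
  continuous f -> measurable_fun [set: borel E] f.
Proof.
move=> cf; apply/measurable_EFinP; apply: lsc_measurable.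
apply/lower_semicontinuousP => a.
rewrite (_ : [set _ | _] = f @^-1` [set t | a < t]); last first.
  by apply/seteqP; split => t /=; rewrite lte_fin.
by apply: open_comp => [? _|]; [exact: cf|exact: open_gt].
Qed.

Lemma polish_dense_sequence {R : realType} (E : ptopologicalType) : polish R E ->
  exists (rho : E -> E -> R) (x : nat -> E), [/\ is_metric rho, metrizes rho,
    complete_metric rho & forall y e, 0 < e -> exists j, rho (x j) y < e].
Proof.
move=> [[A [cA dA]] [rho [hm hz hc]]].
have [g gA] : exists g : nat -> E, set_surj [set: nat] A g.
  by apply/pcard_surjP; exact: cA.
exists rho, g; split => // y e e0.
have [] := dA [set z | rho y z < e].
- by exists y => /=; have [_ h _ _] := hm; rewrite (h y y).2.
- exact: open_rho_ball.
move=> z [/= yz Az]; have [j _ jz] := gA z Az.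
by exists j; rewrite jz; have [_ _ -> _] := hm.
Qed.

(** * Projections of closed sets *)

Section capacitability.
Local Open Scope ereal_scope.

Section measurable_hull.
Context d (T : measurableType d) {R : realType} (P : probability T R).

(** The intersection of a minimising sequence of measurable supersets attains the infimum. The
    sigma-type provides a chosen hull, whose measure is the outer measure. *)
Lemma measurable_hull (A : set T) :
  {H | [/\ measurable H, A `<=` H & forall B, measurable B -> A `<=` B -> P H <= P B]}.
Proof.
apply: cid.
pose S := [set P B | B in [set B | measurable B /\ A `<=` B]].
have S0 y : S y -> 0 <= y by move=> [B _ <-].
have ST : S 1 by exists setT; [split|exact: probability_setT].
have Sfin : ereal_inf S \is a fin_num.
  rewrite ge0_fin_numE; last by apply/ereal_infP => y /S0.
  by apply: le_lt_trans (ltry 1); exact: ereal_inf_lbound.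
have ex n : exists B, [/\ measurable B, A `<=` B & P B < ereal_inf S + (rad n)%:E].
  by have [_ [B [mB AB] <-] h] := lb_ereal_inf_adherent (@rad_gt0 R n) Sfin; exists B.
have [B hB] := choice ex.
have mB : measurable (\bigcap_n B n) by apply: bigcapT_measurable => n; have [] := hB n.
exists (\bigcap_n B n); split => //.
  by move=> y Ay n _; have [_ h _] := hB n; exact: h.
move=> K mK AK; apply: (@le_trans _ _ (ereal_inf S)); last first.
  by apply: ereal_inf_lbound; exists K.
apply/lee_addgt0Pr => e /rad_small[n /(_ n (leqnn _))/ltW ne].
have [mBn _ /ltW h] := hB n.
apply: (@le_trans _ _ (P (B n))); first by apply: le_measure; rewrite ?inE//;
  exact: bigcap_inf.
by apply: (le_trans h); rewrite leeD2l// lee_fin.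
Qed.

Definition outer (A : set T) : \bar R := P (sval (measurable_hull A)).

Lemma outer_le (A B : set T) : measurable B -> A `<=` B -> outer A <= P B.
Proof. by rewrite /outer; case: measurable_hull => H [mH AH /= h] ? ?; exact: h. Qed.

Lemma le_outer (A B : set T) : A `<=` B -> outer A <= outer B.
Proof.
move=> AB; have [mH BH _] := svalP (measurable_hull B).
by apply: outer_le => //; exact: subset_trans BH.
Qed.

(** Outer measure is continuous along increasing sets, measurable or not. Hulls of the [A n] need
    not increase, but the intersections [K n] of all hulls from [n] on do, and they still contain
    [A n]. *)
Lemma outer_bigcup (A : nat -> set T) (c : \bar R) : nondecreasing_seq A ->
  c < outer (\bigcup_n A n) -> exists n, c < outer (A n).
Proof.
move=> ndA; apply: contraPP => /forallNP h; apply/negP; rewrite -leNgt.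
pose H n := sval (measurable_hull (A n)).
have mH n : measurable (H n) by rewrite /H; case: measurable_hull => ? [].
have AH n : A n `<=` H n by rewrite /H; case: measurable_hull => ? [].
pose K n := \bigcap_(m in [set m | (n <= m)%N]) H m.
have mK n : measurable (K n) by apply: bigcap_measurableType => m _.
have ndK : nondecreasing_seq K.
  move=> n m nm; apply/subsetPset => y Ky k /= mk; apply: Ky => /=.
  exact: leq_trans nm mk.
have mUK : measurable (\bigcup_n K n) by apply: bigcupT_measurable.
apply: (@le_trans _ _ (P (\bigcup_n K n))).
  apply: outer_le => // y [n _ Any]; exists n => // m /= nm; apply: AH.
  by move/subsetPset : (ndA _ _ nm); exact.
have cvK := nondecreasing_cvg_mu (mu := P) mK mUK ndK.
rewrite -(cvg_lim _ cvK)//; apply: lime_le; first by apply/cvg_ex; eexists; exact: cvK.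
apply: nearW => n /=; apply: (@le_trans _ _ (P (H n))).
  by apply: le_measure; rewrite ?inE//; by move=> y; apply => /=.
by have /negP := h n; rewrite -leNgt.
Qed.

End measurable_hull.

(** A pigeonhole principle: it lets an ultrafilter settle in one of the finitely many cells kept at
    each level. *)
Lemma ultra_bigcup {T : Type} (G : set_system T) (F : nat -> set T) n :
  UltraFilter G -> G (\bigcup_(j in [set j | (j < n)%N]) F j) ->
  exists2 j, (j < n)%N & G (F j).
Proof.
move=> GU; elim: n => [|n ih].
  by rewrite (_ : \bigcup_(_ in _) _ = set0) -?subset0 => [/filter_ex[]//|y []].
move=> h; have [GFn|GFn] := in_ultra_setVsetC (F n) GU; first by exists n.
have [|j jn Gj] := ih; last by exists j => //; exact: ltnW.
apply: filterS (filterI h GFn) => y [[j /= jn Fj] nF]; exists j => //=.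
by move: jn; rewrite ltnS leq_eqVlt => /predU1P[jn|//]; rewrite jn in Fj.
Qed.

Section projection.
Context {R : realType} {E : ptopologicalType}.
Variables (rho : E -> E -> R) (x : nat -> E).
Hypotheses (rho_metric : is_metric rho) (rhoE : metrizes rho)
  (rho_complete : complete_metric rho).
Hypothesis x_dense : forall y e, (0 < e)%R -> exists j, (rho (x j) y < e)%R.
Variable P : probability (borel E) R.

Let rhoC y z : rho y z = rho z y. Proof. by have [_ _ h _] := rho_metric. Qed.
Let rho_tri y z t : (rho y t <= rho y z + rho z t)%R.
Proof. by have [_ _ _ h] := rho_metric. Qed.

Definition projection (C : set (E * E)) (S : set E) : set E :=
  [set y | exists2 z, S z & C (z, y)].

Let finite_cells k n : set E := \bigcup_(j in [set j | (j < n)%N]) cell rho x (k, j).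

Let shrink (C : set (E * E)) (c : \bar R) S k : c < outer P (projection C S) ->
  exists n, c < outer P (projection C (S `&` finite_cells k n)).
Proof.
move=> h; apply: (@outer_bigcup _ _ _ P (fun n => projection C (S `&` finite_cells k
  n))).
  move=> n m nm; apply/subsetPset => y [z [Sz [j /= jn jz]] Cz].
  by exists z => //; split => //; exists j => //=; exact: leq_trans jn nm.
apply: (lt_le_trans h); apply: le_outer => y [z Sz Cz].
have [j jz] := cell_cover x_dense k z.
by exists j.+1 => //; exists z => //; split => //; exists j => //=.
Qed.

(** Choose pairs (z_k, t_k) of [C] with z_k in [S k] and t_k close to [y]. Along an ultrafilter
    finer than [\oo] the z_k settle in one cell of each level. The centres of these cells form a
    Cauchy sequence with a limit [l], and since [C] is closed it contains (l, y). *)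
Let compact_selection (C : set (E * E)) (S : nat -> set E) (n : nat -> nat) y : closed
  C ->
  (forall k, S k.+1 = S k `&` finite_cells k (n k)) ->
  (forall k, closure (projection C (S k)) y) -> projection C setT y.
Proof.
move=> cC SS cly.
have ex k : exists zt, [/\ S k zt.1, C zt & rho y zt.2 < rad k]%R.
  have [|t [[z Sz Cz] yt]] := cly k [set t | rho y t < rad k]%R.
    by apply/rhoE; exists (rad k) => //; exact: rad_gt0.
  by exists (z, t).
have [w hw] := choice ex.
have [G [GU ooG]] := ultraFilterLemma (_ : ProperFilter (\oo : set_system nat)).
have SI i k : (i < k)%N -> S k `<=` finite_cells i (n i).
  elim: k => // k ih; rewrite ltnS leq_eqVlt => /predU1P[->|ik].
    by rewrite SS; exact: subIsetr.
  by rewrite SS; apply: subset_trans (ih ik); exact: subIsetl.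
have exj i : exists j, G [set k | cell rho x (i, j) (w k).1].
  have [|j _ h] := @ultra_bigcup _ G (fun j => [set k | cell rho x (i, j) (w k).1]) (n
    i) GU.
  - apply: filterS (ooG _ (nbhs_infty_gt i)) => k /= ik.
    by have [Sk _ _] := hw k; have [j] := SI _ _ ik _ Sk; exists j.
  - by exists j.
have [j hj] := choice exj.
have near2 i i' : (rho (x (j i)) (x (j i')) < rad i + rad i')%R.
  have [k [h1 h2]] := filter_ex (filterI (hj i) (hj i')).
  move: h1 h2; rewrite /cell/= => h1 h2.
  by have := rho_tri (x (j i)) (w k).1 (x (j i')); rewrite [rho (w k).1 _]rhoC; lra.
have [l hl] : exists l, forall e, (0 < e)%R -> exists N, forall n, (N <= n)%N ->
    (rho (x (j n)) l < e)%R.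
  apply: (rho_complete (u := fun i => x (j i))) => e e0.
  have [N hN] := rad_small (ltac:(lra) : (0 < e / 2)%R).
  exists N => i i' /hN h /hN h'; have := near2 i i'; lra.
exists l => //; apply: contrapT => nC.
have oC : open (~` C) by exact: closed_openC.
have : (~` C) (l, y) by [].
move: (oC); rewrite openE => h /h; rewrite /interior => -[[/= A B] [/rhoE[e e0 eA]
  /rhoE[e' e0' eB]] AB].
have [N hN] := hl _ (ltac:(lra) : (0 < e / 2)%R).
have [N1 hN1] := rad_small (ltac:(lra) : (0 < e / 2)%R).
have [N2 hN2] := rad_small e0'.
pose i := maxn N N1.
have [k [h1 h2]] := filter_ex (filterI (hj i) (ooG _ (nbhs_infty_ge N2))).
have [_ Cw yw] := hw k.
have : (~` C) (w k); last exact.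
apply: AB; split => /=.
  apply: eA => /=; move: h1; rewrite /cell/= => h1.
  have := rho_tri l (x (j i)) (w k).1; rewrite [rho l (x _)]rhoC.
  have := hN i (leq_maxl _ _); have := hN1 i (leq_maxr _ _); lra.
by apply: eB => /=; apply: lt_trans yw (hN2 _ h2).
Qed.

(* Choquet's capacitability argument: the projection is exhausted by
   projections of totally bounded pieces, whose nested closures stay in it. *)
Lemma closed_projection_inner (C : set (E * E)) (c : \bar R) : closed C ->
  c < outer P (projection C setT) ->
  exists B, [/\ measurable (B : set (borel E)), B `<=` projection C setT & c <= P B].
Proof.
move=> cC c0.
pose ST := {S | c < outer P (projection C S)}.
(* The recursion carries its invariant in the type: the projection over the remaining piece still
   has outer measure above [c]. *)
pose next k (s : ST) : ST :=
  exist _ (sval s `&` finite_cells k (projT1 (cid (shrink k (svalP s)))))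
    (projT2 (cid (shrink k (svalP s)))).
pose s := fix s k : ST := if k is k'.+1 then next k' (s k') else exist _ setT c0.
pose S k := sval (s k).
pose n k := projT1 (cid (shrink k (svalP (s k)))).
have SS k : S k.+1 = S k `&` finite_cells k (n k) by [].
pose F k := closure (projection C (S k)).
have mF k : measurable (F k : set (borel E)).
  rewrite -[F k]setCK; apply: measurableC; apply: sub_sigma_algebra.
  exact/closed_openC/closed_closure.
have mcap : measurable (\bigcap_k F k : set (borel E)) by exact: bigcapT_measurable.
exists (\bigcap_k F k); split => //.
  move=> y Fy; apply: (@compact_selection C S n y cC SS) => k; exact: Fy.
(* Each [F k] contains a projection of outer measure above [c], so [P (F k)] is at least [c];
   continuity from above passes this bound to the intersection. *)
have niF : {homo F : n m / (n <= m)%N >-> (m <= n)%O}.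
  apply/nonincreasing_seqP => k; apply/subsetPset; apply: closure_subset => y [z Sz Cz].
  by exists z => //; move: Sz; rewrite SS => -[].
have cvF := nonincreasing_cvg_mu (mu := P) (le_lt_trans (probability_le1 P (mF 0%N))
  (ltry 1)) mF mcap niF.
rewrite -(cvg_lim _ cvF)//; apply: lime_ge; first by apply/cvg_ex; eexists; exact: cvF.
apply: nearW => k /=; apply: (le_trans (ltW (svalP (s k)))).
by apply: outer_le => //; exact: subset_closure.
Qed.

End projection.

End capacitability.

(** * Measurability of infima up to null sets *)

Lemma ae_mono {d} {T : measurableType d} {R : realType} (mu : {measure set T -> \bar R})
    (A B : T -> Prop) :
  (forall x, A x -> B x) -> (\forall x \ae mu, A x) -> \forall x \ae mu, B x.
Proof. by move=> AB; apply: negligibleS => x /= nB /AB. Qed.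

Section rational_inf.
Context d (T : measurableType d) {R : realType}.
Variables (B : rat -> set T) (M : R).
Hypotheses (mB : forall q, measurable (B q))
  (B0 : forall q, ratr q <= - M -> B q = set0)
  (BT : forall q, M < ratr q -> B q = setT).

(** Rebuilds a function from candidate sublevel sets at rational levels. Its strict sublevel sets
    are countable unions of the [B q], hence measurable; [B0] and [BT] keep the infimum finite. *)
Definition rational_inf (y : T) : R := inf [set (ratr q : R) | q in [set q | B q y]].

Let lb y : lbound [set (ratr q : R) | q in [set q | B q y]] (- M).
Proof. by move=> _ /= [q Bq <-]; rewrite leNgt; apply/negP => /ltW/B0 h;
  rewrite h in Bq. Qed.

Let nonempty y : [set (ratr q : R) | q in [set q | B q y]] !=set0.
Proof.
have [q] := @rat_in_itvoo R M (M + 1) ltac:(lra).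
by rewrite in_itv/= => /andP[h _]; exists (ratr q : R), q => //=; rewrite BT.
Qed.

Lemma rational_inf_lt y s : rational_inf y < s <-> exists2 q, B q y & ratr q < s.
Proof.
split => [h|[q Bq qs]].
  have [_ [q Bq <-] qs] := inf_adherent (ltac:(lra) : 0 < s - rational_inf y)
    (conj (nonempty y) (ex_intro _ _ (@lb y))).
  exists q => //; apply: (lt_le_trans qs); rewrite -/(rational_inf y); lra.
by apply: le_lt_trans qs; apply: ge_inf; [exists (- M); exact: lb|exists q].
Qed.

Lemma rational_inf_bound y : - M <= rational_inf y <= M + 1.
Proof.
apply/andP; split; first exact: lb_le_inf (nonempty y) (@lb y).
have [q] := @rat_in_itvoo R M (M + 1) ltac:(lra).
rewrite in_itv/= => /andP[h h'].
by apply: (le_trans _ (ltW h')); apply: ge_inf; [exists (- M);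
  exact: lb|exists q => //=; rewrite BT].
Qed.

Lemma measurable_rational_inf : measurable_fun setT rational_inf.
Proof.
apply: (measurability _ (RGenInftyO.measurableE R)) => _ [_ [s ->] <-].
rewrite setTI (_ : _ @^-1` _ = \bigcup_q (if (ratr q : R) < s then B q else set0)).
  apply: countable_bigcupT_measurable; first exact: countableP.
  by move=> q; case: ifP.
apply/seteqP; split => y /=; rewrite in_itv/=.
  by move=> /rational_inf_lt[q Bq qs]; exists q; rewrite ?qs.
by move=> [q _]; case: ifP => // qs Bq; apply/rational_inf_lt; exists q.
Qed.

End rational_inf.

Section infimum.
Context {R : realType} {E : ptopologicalType}.
Variables (rho : E -> E -> R) (x : nat -> E).
Hypotheses (rho_metric : is_metric rho) (rhoE : metrizes rho)
  (rho_complete : complete_metric rho).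
Hypothesis x_dense : forall y e, 0 < e -> exists j, rho (x j) y < e.
Variable P : probability (borel E) R.
Local Open Scope ereal_scope.

(** The outer set is a hull of the union. By continuity of the outer measure some single projection
    already comes within [rad n] of the measure of the hull, and capacitability places a Borel set
    of almost that measure inside it; the inner set is the union of these. *)
Lemma projection_sandwich (C : nat -> set (E * E)) : (forall n, closed (C n)) ->
    nondecreasing_seq C ->
  exists B B', [/\ measurable (B : set (borel E)), measurable (B' : set (borel E)),
    B `<=` \bigcup_n projection (C n) setT,
    \bigcup_n projection (C n) setT `<=` B' & P (B' `\` B) = 0].
Proof.
move=> cC ndC; set A := \bigcup_n _.
have [mB' AB' _] := svalP (measurable_hull P A); set B' := sval _ in mB' AB'.
have ndp : nondecreasing_seq (fun n => projection (C n) setT).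
  move=> n m /ndC/subsetPset nm; apply/subsetPset => y [z Sz Cz].
  by exists z => //; exact: nm.
have ex n : exists B, [/\ measurable (B : set (borel E)), B `<=` A & P B' - (rad n)%:E
  <= P B].
  have [|k hk] := @outer_bigcup _ _ _ P _ (P B' - (rad n)%:E) ndp.
    rewrite -/A /outer -/B' lteBlDr// lteDl ?fin_num_measure//.
    by rewrite lte_fin rad_gt0.
  have [B [mB BA cB]] := closed_projection_inner rho_metric rhoE rho_complete x_dense
    (cC k) hk.
  by exists B; split => // y /BA h; exists k.
have [B hB] := choice ex.
have mB : measurable (\bigcup_n (B n : set (borel E))).
  by apply: bigcupT_measurable => n; have [] := hB n.
have BA : \bigcup_n B n `<=` A by move=> y [n _ By]; have [_ h _] := hB n; exact: h.
exists (\bigcup_n B n), B'; split => //.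
have fin D : measurable (D : set (borel E)) -> P D \is a fin_num by exact:
  fin_num_measure.
apply/eqP; rewrite eq_le measure_ge0 andbT; apply/lee_addgt0Pr => e /rad_small[n /(_ n
  (leqnn _))/ltW ne].
rewrite add0e; have [mBn BnA h] := hB n.
apply: (@le_trans _ _ (P (B' `\` B n))).
  apply: le_measure; rewrite ?inE; [exact: measurableD|exact: measurableD|].
  by apply: setDS; exact: bigcup_sup.
rewrite measureD//; last by rewrite (le_lt_trans (probability_le1 P mB')) ?ltry.
rewrite setIidr; last exact: subset_trans BnA AB'.
rewrite leeBlDr ?fin//; apply: (@le_trans _ _ ((rad n)%:E + P (B n))).
  by rewrite addeC -leeBlDr.
by rewrite leeD2r// lee_fin.
Qed.

Lemma infimum_sandwich (h : E * E -> R) (F : E -> R) (M : R) :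
    lower_semicontinuous (EFin \o h) ->
    (forall y t, (F y < t)%R <-> exists z, (h (z, y) < t)%R) ->
    (forall y, (- M <= F y <= M)%R) ->
  exists g1 g2 : E -> R, [/\
    measurable_fun [set: borel E] g1, measurable_fun [set: borel E] g2,
    forall y, (- M <= g1 y <= F y)%R, forall y, (F y <= g2 y <= M + 1)%R
    & \forall y \ae P, g1 y = g2 y].
Proof.
move=> lh Fh FM.
(* The strict sublevel set of [h] is the increasing union of these closed sets, and projection
   commutes with unions. *)
pose C (q : rat) n : set (E * E) := [set z | (h z <= ratr q - rad n)%R].
have projE q : \bigcup_n projection (C q n) setT = [set y | (F y < ratr q)%R].
  apply/seteqP; split => [y [n _ [z _ hz]]|y /= /Fh[z hz]].
    by apply/Fh; exists z; move: hz; have := @rad_gt0 R n; rewrite /C/=; lra.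
  have [n /(_ n (leqnn _)) hn] := rad_small (ltac:(lra) : (0 < ratr q - h (z, y))%R).
  by exists n => //; exists z => //; rewrite /C/=; lra.
have ex q : exists BB : set E * set E, [/\ measurable (BB.1 : set (borel E)),
    measurable (BB.2 : set (borel E)),
    BB.1 `<=` [set y | (F y < ratr q)%R], [set y | (F y < ratr q)%R] `<=` BB.2
    & P (BB.2 `\` BB.1) = 0].
  have [||B [B' H]] := @projection_sandwich (C q).
  - move=> n; rewrite -[C q n]setCK; apply: open_closedC.
    have /lower_semicontinuousP/(_ (ratr q - rad n)%R) := lh.
    rewrite (_ : [set _ | _] = ~` C q n)//; apply/seteqP; split => z /=;
      by rewrite lte_fin ltNge => /negP.
  - move=> n m nm; apply/subsetPset => z /=; rewrite /C/= => /le_trans; apply.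
    by rewrite lerB// lef_pV2 ?posrE// ler_nat.
  - by exists (B, B'); rewrite -projE.
have [BB hBB] := choice ex.
(* At levels outside (-M, M] the sublevel sets of [F] are empty or everything, so overwriting the
   approximations there keeps them correct and bounds the rebuilt functions. *)
pose cut (B : rat -> set E) q := if (ratr q <= - M)%R then set0
  else if (M < ratr q)%R then setT else B q.
pose B := cut (fun q => (BB q).1); pose B' := cut (fun q => (BB q).2).
have cut0 D q : (ratr q <= - M)%R -> cut D q = set0 by rewrite /cut => ->.
have M0 : (- M <= M)%R by have := FM point; lra.
have cutT D q : (M < ratr q)%R -> cut D q = setT.
  by rewrite /cut => h1; rewrite h1; case: ifP => // h2; exfalso; lra.
have mcut D q : (forall q, measurable (D q : set (borel E))) -> measurable (cut D q :
  set (borel E)).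
  by rewrite /cut; case: ifP => // _; case: ifP.
have mB q : measurable (B q : set (borel E)) by apply: mcut => r; have [] := hBB r.
have mB' q : measurable (B' q : set (borel E)) by apply: mcut => r; have [] := hBB r.
(* Larger sublevel sets give a smaller function: the outer sets yield the minorant, the inner sets
   the majorant. *)
exists (rational_inf (T := borel E) B'), (rational_inf (T := borel E) B); split.
- exact: (measurable_rational_inf (T := borel E) mB' (cut0 _) (cutT _)).
- exact: (measurable_rational_inf (T := borel E) mB (cut0 _) (cutT _)).
- move=> y; have /andP[-> _]/= := rational_inf_bound (T := borel E) (cut0 (fun q => (BB
  q).2)) (cutT _) y.
  rewrite leNgt; apply/negP => hlt.
  have [q] := rat_in_itvoo hlt; rewrite in_itv/= => /andP[h1 h2].
  suff : (rational_inf (T := borel E) B' y < (ratr q : R))%R by move=> h3;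
    have := lt_trans h3 h2; rewrite ltxx.

  have [q'] := rat_in_itvoo h1; rewrite in_itv/= => /andP[h3 h4].
  apply/(rational_inf_lt (T := borel E) (cut0 _) (cutT _)); exists q' => //.
  rewrite /B' /cut; case: ifP => h5; first by have := FM y; lra.
  by case: ifP => // _; have [_ _ _ + _] := hBB q'; apply.
- move=> y; have /andP[_ ->]/= := rational_inf_bound (T := borel E) (cut0 (fun q => (BB
  q).1)) (cutT _) y.
  rewrite andbT leNgt; apply/negP => /(rational_inf_lt (T := borel E) (cut0 _) (cutT
    _))[q].
  rewrite /cut; case: ifP => // h5; case: ifP => [h6 _|_].
    by have := FM y; lra.
  by have [_ _ + _ _] := hBB q => /[apply] /= h7 h8; have := lt_trans h7 h8;
    rewrite ltxx.
(* Off the countably many null differences both infima run over the same rationals. *)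
- have : \forall y \ae P, forall q, ~ (B' q `\` B q) y.
    pose BN n := (B' (odflt 0%R (unpickle n)) `\` B (odflt 0%R (unpickle n))).
    have : \forall y \ae P, forall n, ~ BN n y.
      apply: ae_foralln => n; exists (BN n); split; first exact: measurableD.
        rewrite /BN; move: (odflt _ _) => q; rewrite /B /B' /cut; case: ifP => _;
          first by rewrite setDv measure0.
        by case: ifP => _; [rewrite setDv measure0|have [] := hBB q].
      by move=> y /contrapT.
    by apply: ae_mono => y H q; have := H (pickle q); rewrite /BN pickleK.
  apply: ae_mono => y H; rewrite /rational_inf; congr inf; congr image.
  apply/seteqP; split => q /= Bq; first by apply: contrapT => nB; exact: (H q).
  move: Bq; rewrite /B /B' /cut; case: ifP => // _; case: ifP => // _ Bq.
  by have [_ _ h1 h2 _] := hBB q; apply: h2; exact: h1.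
Qed.

End infimum.

(** Valid for arbitrary functions, because the integrals of the positive and negative parts are
    suprema over simple minorants. Integrands built from [inf_conv] are compared in this way. *)
Lemma integral_mono {d} {T : measurableType d} {R : realType}
    (mu : {measure set T -> \bar R}) (f g : T -> \bar R) :
  (forall x, f x <= g x)%E -> (\int[mu]_x f x <= \int[mu]_x g x)%E.
Proof.
have mono (u v : T -> \bar R) : (forall x, 0 <= u x)%E -> (forall x, u x <= v x)%E ->
    (\int[mu]_x u x <= \int[mu]_x v x)%E.
  move=> u0 uv; rewrite !ge0_integralTE//; last by move=> x;
    exact: le_trans (u0 x) (uv x).
  apply: ereal_sup_le => _ [k hk <-]; exists k => // x.
  exact: le_trans (hk x) (uv x).
move=> fg; rewrite integralE [leRHS]integralE; apply: leeB; apply: mono => // x.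
  by rewrite !funeposE; exact: le_max2 (fg x) (lexx _).
by rewrite !funenegE; apply: le_max2 => //; rewrite leeN2.
Qed.

(** * Lipschitz test functions *)

Lemma bounded_integrable {d} {T : measurableType d} {R : realType} (m : probability T R)
    (f : T -> R) M : measurable_fun setT f -> (forall x, `|f x| <= M) ->
  m.-integrable setT (EFin \o f).
Proof.
move=> mf fM; apply: measurable_bounded_integrable => //.
  by rewrite (le_lt_trans (probability_le1 m measurableT)) ?ltry.
by exists M; split => [|x Mx y _]; [exact: num_real|exact: le_trans (fM y) (ltW Mx)].
Qed.

Lemma EFin_Rintegral {d} {T : measurableType d} {R : realType} (m : probability T R)
    (f : T -> R) M : measurable_fun setT f -> (forall x, `|f x| <= M) ->
  (\int[m]_x f x)%:E = (\int[m]_x (f x)%:E)%E.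
Proof.
move=> mf fM; rewrite /Rintegral fineK//.
exact: integrable_fin_num (bounded_integrable m mf fM).
Qed.

Section metric_measures.
Context {R : realType} {E : ptopologicalType}.
Variables (rho : E -> E -> R) (x : nat -> E).
Hypotheses (rho_metric : is_metric rho) (rhoE : metrizes rho).
Hypothesis x_dense : forall y e, 0 < e -> exists j, rho (x j) y < e.

Let rho0 y : rho y y = 0. Proof. by have [_ h _ _] := rho_metric; apply/h. Qed.
Let rhoC y z : rho y z = rho z y. Proof. by have [_ _ h _] := rho_metric. Qed.
Let rho_tri y z t : rho y t <= rho y z + rho z t.
Proof. by have [_ _ _ h] := rho_metric. Qed.
Let rho_ge0 y z : 0 <= rho y z. Proof. by have [h _ _ _] := rho_metric. Qed.

Definition lipschitz (M : R) (f : E -> R) := forall y z, `|f y - f z| <= M * rho y z.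

Lemma lipschitz_min M K f g : lipschitz M f -> lipschitz K g ->
  lipschitz (Num.max M K) (fun y => Num.min (f y) (g y)).
Proof.
move=> hf hg y z; have := hf y z; have := hg y z; have := rho_ge0 y z.
rewrite !ler_norml => r0 /andP[g1 g2] /andP[f1 f2].
have h1 : M * rho y z <= Num.max M K * rho y z by rewrite ler_wpM2r// le_max lexx.
have h2 : K * rho y z <= Num.max M K * rho y z by rewrite ler_wpM2r// le_max lexx orbT.
by rewrite /Order.min; case: ifPn; case: ifPn; rewrite -?leNgt => h3 h4; lra.
Qed.

Lemma lipschitzZ M f a : 0 <= a -> lipschitz M f -> lipschitz (a * M) (fun y => a * f
  y).
Proof. by move=> a0 hf y z; rewrite -mulrBr normrM ger0_norm// -mulrA ler_wpM2l. Qed.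

Lemma lipschitz_cst M a : 0 <= M -> lipschitz M (fun=> a).
Proof. by move=> M0 y z; rewrite subrr normr0 mulr_ge0. Qed.

Lemma lipschitz_rho y : lipschitz 1 (rho y).
Proof.
move=> z t; rewrite mul1r ler_norml; have := rho_tri y z t; have := rho_tri y t z.
by rewrite (rhoC t z); lra.
Qed.

Lemma lipschitz_measurable M f : lipschitz M f -> measurable_fun [set: borel E] f.
Proof. by move=> /(lipschitz_continuous rho_metric rhoE)/continuous_borel_measurable.
  Qed.

(** The distance to the complement of [U], truncated at 1. As a supremum of radii it stays
    meaningful when the complement is empty. *)
Definition inner_radius (U : set E) y : R :=
  sup [set e | 0 <= e <= 1 /\ [set z | rho y z < e] `<=` U].

Section inner_radius.
Variable U : set E.

Let has_sup_radius y : has_sup [set e | 0 <= e <= 1 /\ [set z | rho y z < e] `<=` U].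
Proof.
split; last by exists 1 => e [/andP[]].
by exists 0; split; [rewrite lexx ler01|move=> z /=; have := rho_ge0 y z; lra].
Qed.

Let inner_radius_ge y e : 0 <= e <= 1 -> [set z | rho y z < e] `<=` U ->
  e <= inner_radius U y.
Proof. by move=> e01 eU; apply: ub_le_sup; [exact: (has_sup_radius y).2|]. Qed.

Lemma inner_radius_bound y : 0 <= inner_radius U y <= 1.
Proof.
rewrite inner_radius_ge ?lexx ?ler01//=; last by move=> z /=; have := rho_ge0 y z; lra.
by apply: ge_sup; [exact: (has_sup_radius y).1|move=> e [/andP[]]].
Qed.

Lemma inner_radius_gt0 y : open U -> U y -> 0 < inner_radius U y.
Proof.
move=> /(open_metricP rhoE) h /h[e e0 eU].
apply: (@lt_le_trans _ _ (Num.min e 1)); first by rewrite lt_min e0 ltr01.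
apply: inner_radius_ge; first by rewrite ge_min lexx orbT andbT le_min ler01 (ltW e0).
by apply: subset_trans eU => z /= ; rewrite lt_min => /andP[].
Qed.

Lemma inner_radius0 y : ~ U y -> inner_radius U y = 0.
Proof.
move=> nU; apply/eqP; rewrite eq_le; have /andP[-> _] := inner_radius_bound y.
rewrite andbT; apply: ge_sup; first exact: (has_sup_radius y).1.
move=> e [_ eU]; rewrite leNgt; apply/negP => e0; apply: nU; apply: eU => /=.
by rewrite rho0.
Qed.

Lemma inner_radius_lipschitz : lipschitz 1 (inner_radius U).
Proof.
have H y z : inner_radius U y - rho y z <= inner_radius U z.
  rewrite lerBlDr; apply: ge_sup; first exact: (has_sup_radius y).1.
  move=> e [/andP[e0 e1] eU]; have := rho_ge0 y z => r0; rewrite -lerBlDr.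
  have [h|/ltW h] := leP 0 (e - rho y z); last first.
    by apply: (le_trans h); have /andP[] := inner_radius_bound z.
  apply: inner_radius_ge; first by rewrite h/=; lra.
  by move=> t /= ht; apply: eU => /=; have := rho_tri y z t; lra.
move=> y z; rewrite mul1r ler_norml.
by have := H y z; have := H z y; rewrite (rhoC z y); lra.
Qed.

End inner_radius.

(** One-sided bounds suffice, since applying them to [1 - f] reverses them; decoding will supply
    only upper bounds. The functions min(1, n r), with r the inner radius of an open set, increase
    to its indicator, and open sets form a generating class stable under intersection. *)
Lemma lipschitz_measure_unique (m1 m2 : probability (borel E) R) :
  (forall M f, lipschitz M f -> (forall y, 0 <= f y <= 1) ->
    (\int[m1]_y (f y)%:E <= \int[m2]_y (f y)%:E)%E) ->
  forall A, measurable (A : set (borel E)) -> m1 A = m2 A.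
Proof.
move=> le12.
have b01 (f : E -> R) : (forall y, 0 <= f y <= 1) -> forall y, `|f y| <= 1.
  by move=> f01 y; have /andP[f0 f1] := f01 y; rewrite ger0_norm.
have eq12 M f : 0 <= M -> lipschitz M f -> (forall y, 0 <= f y <= 1) ->
    (\int[m1]_y (f y)%:E = \int[m2]_y (f y)%:E)%E.
  move=> M0 lf f01; apply/eqP; rewrite eq_le (le12 _ _ lf f01)/=.
  have mf := lipschitz_measurable lf.
  have lg : lipschitz M (fun y => 1 - f y).
    by move=> y z; rewrite (_ : _ - _ = f z - f y); [rewrite distrC|ring].
  have g01 y : 0 <= 1 - f y <= 1 by have := f01 y; lra.
  have := le12 _ _ lg g01.
  rewrite -!(EFin_Rintegral _ (lipschitz_measurable lg) (b01 _ g01)).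
  rewrite -!(EFin_Rintegral _ mf (b01 _ f01)) !lee_fin.
  have I (m : probability (borel E) R) := bounded_integrable m mf (b01 _ f01).
  have I1 (m : probability (borel E) R) : m.-integrable setT (EFin \o (fun=> 1 : R)).
    by apply: (@bounded_integrable _ _ _ m _ 1) => // y; rewrite normr1.
  have c1 (m : probability (borel E) R) : \int[m]_(y in [set: borel E]) (1 : R) = 1.
    by rewrite (@Rintegral_cst _ _ _ m _ measurableT) mul1r;
      exact: (congr1 fine (probability_setT m)).
  rewrite (RintegralB measurableT (I1 m1) (I m1)) (RintegralB measurableT (I1 m2) (I
    m2)); have := c1 m1; have := c1 m2.
  by move=> -> ->; lra.
have eqU (U : set E) : open U -> m1 U = m2 U.
  move=> oU; pose u n y := Num.min 1 (n%:R * inner_radius U y).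
  have lu n : lipschitz (Num.max 0 (n%:R * 1)) (u n).
    apply: lipschitz_min; first exact: lipschitz_cst.
    exact: lipschitzZ (inner_radius_lipschitz U).
  have u01 n y : 0 <= u n y <= 1.
    have /andP[h _] := inner_radius_bound U y.
    by rewrite le_min ler01 ge_min lexx /= mulr_ge0.
  have mU : measurable (U : set (borel E)) by exact: sub_sigma_algebra.
  have cv (m : probability (borel E) R) : (\int[m]_y (u n y)%:E)%E @[n --> \oo] --> m U.
    rewrite -(setIT U) -integral_indic//.
    apply: (@dominated_cvg _ _ _ m setT measurableT (fun n y => (u n y)%:E) _ (cst
      1%E)) => //.
    - by move=> n; apply/measurable_EFinP; exact: lipschitz_measurable (lu n).
    - move=> y _; apply: cvg_near_cst; rewrite indicE.
      have [Uy|nUy] := pselect (U y); last first.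
        rewrite memNset//; apply: nearW => n.
        by rewrite /u inner_radius0// mulr0 min_r.
      rewrite mem_set//; have r0 := inner_radius_gt0 oU Uy.
      exists (Num.truncn (inner_radius U y)^-1).+1 => // n /= hn.
      rewrite /u min_l// -ler_pdivrMr// mul1r.
      apply: (@le_trans _ _ (Num.truncn (inner_radius U y)^-1).+1%:R).
        by apply/ltW; exact: truncnS_gt.
      by rewrite ler_nat.
    - by apply: (@bounded_integrable _ _ _ m (fun=> 1) 1) => // y; rewrite normr1.
    - by move=> n y _; rewrite /cst lee_fin (b01 _ (u01 n)).
  apply: cvg_unique (cv m1) _ => //.
  rewrite (_ : (fun n => \int[m1]_y (u n y)%:E)%E = (fun n => \int[m2]_y (u n y)%:E)%E).
    exact: cv.
  by apply/funext => n; apply: eq12 (lu n) (u01 n); rewrite le_max lexx.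
move=> A mA; apply: (@measure_unique _ R (borel E) (@open E) (fun=> setT) _ _ _ _ m1 m2
  _ _ A mA) => //.
- exact: openI.
- by move=> _; exact: openT.
- by rewrite bigcup_const.
- by move=> _; rewrite (le_lt_trans (probability_le1 m1 measurableT)) ?ltry.
Qed.

(* Equals 1 off the first [J] cells of level [k], and decreases to 0 by density. *)
Fixpoint uncovered k J (y : E) : R :=
  if J is j.+1 then Num.min (uncovered k j y) (rho (x j) y / rad k) else 1.

Lemma uncovered_lipschitz k J : exists2 M, 0 <= M & lipschitz M (uncovered k J).
Proof.
elim: J => [|J [M M0 h]]; first by exists 0 => //; exact: lipschitz_cst.
have r0 : 0 <= (rad k)^-1 :> R by rewrite invr_ge0 ltW// rad_gt0.
exists (Num.max M ((rad k)^-1 * 1)); first by rewrite le_max M0.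
apply: lipschitz_min => //; have := lipschitzZ r0 (lipschitz_rho (x J)).
by move=> h' y z; have := h' y z; rewrite ![(rad k)^-1 * rho _ _]mulrC.
Qed.

Lemma uncovered_bound k J y : 0 <= uncovered k J y <= 1.
Proof.
elim: J => [|J /andP[h1 h2]] /=; first by rewrite ler01 lexx.
by rewrite le_min h1 ge_min h2/= andbT divr_ge0// ltW// rad_gt0.
Qed.

Lemma uncovered1 k J y : (forall j, (j < J)%N -> ~ cell rho x (k, j) y) ->
  uncovered k J y = 1.
Proof.
elim: J => // J ih h /=; rewrite ih ?min_l//; last by move=> j /ltnW; exact: h.
have /negP := h J (ltnSn J); rewrite /cell/= -leNgt => h'.
by rewrite ler_pdivlMr ?rad_gt0// mul1r.
Qed.

Lemma uncovered_le k J y j : (j < J)%N -> uncovered k J y <= rho (x j) y / rad k.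
Proof.
elim: J => // J ih; rewrite ltnS leq_eqVlt => /predU1P[->|/ih h] /=.
  by rewrite ge_min lexx orbT.
by rewrite ge_min h.
Qed.

(** A substitute for tightness: finitely many cells of a level carry almost all the mass, expressed
    through continuous functions so that it can enter a hedge. *)
Lemma uncovered_cvg0 (m : probability (borel E) R) k e : 0 < e ->
  exists J, (\int[m]_y (uncovered k J y)%:E <= e%:E)%E.
Proof.
move=> e0; have mu J : measurable_fun [set: borel E] (uncovered k J).
  by have [M _ h] := uncovered_lipschitz k J; exact: lipschitz_measurable h.
have b J y : `|uncovered k J y| <= 1.
  by have /andP[h1 h2] := uncovered_bound k J y; rewrite ger0_norm.
have cv : (\int[m]_y (uncovered k J y)%:E)%E @[J --> \oo] --> 0%E.
  rewrite -(@integral0 _ _ _ m setT).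
  apply: (@dominated_cvg _ _ _ m setT measurableT (fun J y => (uncovered k J y)%:E) _
    (cst 1%E)) => //.
  - by move=> J; exact/measurable_EFinP.
  - move=> y _; apply/fine_cvgP; split; first by apply: nearW.
    apply/cvgrPdist_le => t t0.
    (* A centre within [t * rad k] of [y] bounds [uncovered] at [y] by [t] from its index on. *)
    have tr : 0 < t * rad k by rewrite mulr_gt0// rad_gt0.
    have [j hj] := x_dense y tr.
    exists j.+1 => // J /= jJ; rewrite sub0r normrN ger0_norm; last first.
      by have /andP[] := uncovered_bound k J y.
    by rewrite (le_trans (uncovered_le k y jJ))// ler_pdivrMr ?rad_gt0// ltW.
  - by apply: (@bounded_integrable _ _ _ m (fun=> 1) 1) => // y; rewrite normr1.
  - by move=> J y _; rewrite /cst lee_fin b.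
have fin J := EFin_Rintegral m (mu J) (b J).
move: cv; under eq_fun do rewrite -fin.
move=> /fine_cvgP[_] /cvgrPdist_lt/(_ _ e0)[J _ /(_ J (leqnn J))] /=.
rewrite sub0r normrN => h; exists J; rewrite -fin lee_fin.
exact: le_trans (ler_norm _) (ltW h).
Qed.

End metric_measures.

(** * Kantorovich duality *)

Section bounded_continuous.
Context {R : realType} {E : ptopologicalType}.
Implicit Types f g : E -> R.

Lemma bounded_continuousP f : bounded_continuous f <->
  continuous f /\ exists M, forall y, `|f y| <= M.
Proof.
split=> -[cf bf]; split => //.
  have [M [_ h]] := bf; exists (M + 1) => y.
  by apply: (h (M + 1)) => //; lra.
have [M h] := bf; exists M; split; first exact: num_real.
by move=> N MN y _; exact: le_trans (h y) (ltW MN).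
Qed.

Lemma bounded_continuousD f g : bounded_continuous f -> bounded_continuous g ->
  bounded_continuous (fun y => f y + g y).
Proof.
move=> /bounded_continuousP[cf [M fM]] /bounded_continuousP[cg [N gN]].
apply/bounded_continuousP; split; first by move=> y; apply: cvgD; [exact: cf|exact: cg].
by exists (M + N) => y; rewrite (le_trans (ler_normD _ _))// lerD.
Qed.

Lemma bounded_continuousZ a f : bounded_continuous f ->
  bounded_continuous (fun y => a * f y).
Proof.
move=> /bounded_continuousP[cf [M fM]].
apply/bounded_continuousP; split; first by move=> y; apply: cvgM;
  [exact: cvg_cst|exact: cf].
by exists (`|a| * M) => y; rewrite normrM ler_wpM2l.
Qed.

Lemma bounded_continuous_cst (a : R) : bounded_continuous (fun _ : E => a).
Proof.
apply/bounded_continuousP; split; first by move=> y; exact: cvg_cst.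
by exists `|a|.
Qed.

Lemma bounded_continuous_integrable (m : probability (borel E) R) f :
  bounded_continuous f -> m.-integrable setT (EFin \o f).
Proof.
move=> /bounded_continuousP[cf [M fM]].
exact: (bounded_integrable m (continuous_borel_measurable cf) fM).
Qed.

Lemma EFin_mean (m : probability (borel E) R) f : bounded_continuous f ->
  (\int[m]_y f y)%:E = (\int[m]_y (f y)%:E)%E.
Proof. by move=> /(bounded_continuous_integrable m) h;
  rewrite fineK// integrable_fin_num. Qed.

Lemma meanD (m : probability (borel E) R) f g :
    bounded_continuous f -> bounded_continuous g ->
  \int[m]_y (f y + g y) = \int[m]_y f y + \int[m]_y g y.
Proof.
by move=> /(bounded_continuous_integrable m) bf /(bounded_continuous_integrable m) bg;
  rewrite RintegralD.
Qed.

Lemma meanZ (m : probability (borel E) R) a f : bounded_continuous f ->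
  \int[m]_y (a * f y) = a * \int[m]_y f y.
Proof. by move=> /(bounded_continuous_integrable m) bf; rewrite RintegralZl. Qed.

Lemma mean_cst d (T : measurableType d) (m : probability T R) a : \int[m]_y a = a :> R.
Proof.
rewrite (@Rintegral_cst _ _ _ m _ measurableT).
by rewrite -[RHS]mulr1; congr (_ * _); exact: (congr1 fine (probability_setT m)).
Qed.

End bounded_continuous.

(** * The superhedging price *)

Section dual_functional.
Context {R : realType} {E : ptopologicalType}.
Variables (P Q : probability (borel E) R) (c : E * E -> R) (V : R).
Hypothesis c0 : forall z, 0 <= c z.
Hypothesis dual : forall f g, bounded_continuous f -> bounded_continuous g ->
  (forall x y, g y - f x <= c (x, y)) -> \int[Q]_y g y - \int[P]_x f x <= V.

(* Each unit of the cost [c] is charged [V], so that a linear functional below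
   the price gives mean at most [V] to every function below [c]. *)
Definition superhedge (h : E * E -> R) (v : R) := exists f g t,
  [/\ bounded_continuous f, bounded_continuous g, 0 <= t,
    (forall z, h z <= f z.1 + g z.2 + t * c z)
  & v = \int[P]_x f x + \int[Q]_y g y + t * V].

Definition superhedging_price (h : E * E -> R) : R := inf [set v | superhedge h v].

Lemma dual_bound_ge0 : 0 <= V.
Proof.
have b0 := bounded_continuous_cst (E := E) (0 : R).
have := dual b0 b0; rewrite !mean_cst subr0; apply => x y.
by rewrite ?subr0.
Qed.

(** This is where the dual bound is used. From f + g + t c >= -M one gets a competitor for the cost
    [c]: the pair (f + M)/(t + s) and -g/(t + s). *)
Lemma superhedge_ge h M v : (forall z, - M <= h z) -> superhedge h v -> - M <= v.
Proof.
move=> hM [f [g [t [bf bg t0 hfg ->]]]].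
have V0 := dual_bound_ge0.
(* The hedge may use no cost at all ([t = 0]); the extra amount [s] makes the division legitimate
   and then tends to 0. *)
suff H s : 0 < s -> - M <= \int[P]_x f x + \int[Q]_y g y + (t + s) * V.
  apply/ler_addgt0Pr => e e0.
  have e1 : 0 < e / (V + 1) by rewrite divr_gt0// ltr_wpDl.
  apply: (le_trans (H _ e1)); rewrite mulrDl addrA lerD2l.
  by rewrite mulrAC ler_pdivrMr ?ltr_wpDl// ler_pM2l//; lra.
move=> s0; have ts : 0 < t + s by lra.
have ts0 : t + s != 0 by rewrite gt_eqF.
have bM := bounded_continuous_cst (E := E) M.
have hV : (- (t + s)^-1 * \int[Q]_y g y - (t + s)^-1 * (\int[P]_x f x + M)) <= V.
  rewrite -(mean_cst P M) -meanD// -!meanZ//; last exact: bounded_continuousD.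
  apply: dual => [||x y]; [exact/bounded_continuousZ/bounded_continuousD|exact:
    bounded_continuousZ|].
  have h1 := hfg (x, y); have h2 := hM (x, y); rewrite /= in h1.
  have h3 : 0 <= s * c (x, y) by rewrite mulr_ge0// ltW.
  rewrite mulNr -opprD -mulrDr -mulrN -ler_pdivlMl ?invr_gt0// invrK mulrDl.
  lra.
have : (t + s) * (- (t + s)^-1 * \int[Q]_y g y - (t + s)^-1 * (\int[P]_x f x + M)) <=
   (t + s) * V by rewrite ler_pM2l.
rewrite mulrBr mulrA mulrN mulfV// mulrA mulfV//; lra.
Qed.

Definition bounded_on_pairs (h : E * E -> R) := exists M, forall z, `|h z| <= M.

Lemma superhedge_cst h M : (forall z, `|h z| <= M) -> superhedge h M.
Proof.
move=> hM; exists (cst M), (cst 0), 0; split => //; first 2 last.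
- by move=> z; rewrite mul0r !addr0 (le_trans (ler_norm _)).
- by rewrite !mean_cst mul0r !addr0.
- exact: bounded_continuous_cst.
- exact: bounded_continuous_cst.
Qed.

Lemma superhedging_price_le h v : bounded_on_pairs h -> superhedge h v ->
  superhedging_price h <= v.
Proof.
move=> [M hM] hv; apply: ge_inf => //; exists (- M) => w.
by apply: superhedge_ge => z; have := hM z; rewrite ler_norml => /andP[].
Qed.

Lemma le_superhedging_price h a : bounded_on_pairs h ->
  (forall v, superhedge h v -> a <= v) -> a <= superhedging_price h.
Proof. by move=> [M /superhedge_cst hM] H; apply: lb_le_inf => //; exists M. Qed.

Lemma bounded_on_pairs_submodule : submodule bounded_on_pairs.
Proof.
split=> [h k [M hM] [N kN]|a h [M hM]].
  by exists (M + N) => z; rewrite (le_trans (ler_normD _ _))// lerD.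
by exists (`|a| * M) => z; rewrite normrM ler_wpM2l.
Qed.

Lemma superhedging_price_sublinear : sublinear_on bounded_on_pairs superhedging_price.
Proof.
have [SD SZ] := bounded_on_pairs_submodule.
split=> [h k bh bk|a h a0 bh].
  suff H v : superhedge h v -> superhedging_price (h + k) - v <= superhedging_price k.
    suff : superhedging_price (h + k) - superhedging_price k <= superhedging_price h by
      lra.
    by apply: le_superhedging_price => // v /H; lra.
  move=> hv; apply: le_superhedging_price => // w kw; rewrite lerBlDl.
  apply: superhedging_price_le; first exact: SD.
  case: hv => f [g [t [bf bg t0 hfg ->]]]; case: kw => f' [g' [t' [bf' bg' t0' hfg'
    ->]]].
  exists (fun y => f y + f' y), (fun y => g y + g' y), (t + t'); split.
  - exact: bounded_continuousD.
  - exact: bounded_continuousD.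
  - exact: addr_ge0.
  - by move=> z; rewrite (_ : (h + k) z = h z + k z)//; have := hfg z; have := hfg' z;
    rewrite mulrDl; lra.
  - by rewrite !meanD// mulrDl; lra.
rewrite -ler_pdivrMl//; apply: le_superhedging_price => // v hv; rewrite ler_pdivrMl//.
apply: superhedging_price_le; first exact: SZ.
case: hv => f [g [t [bf bg t0 hfg ->]]].
exists (fun y => a * f y), (fun y => a * g y), (a * t); split.
- exact: bounded_continuousZ.
- exact: bounded_continuousZ.
- by rewrite mulr_ge0// ltW.
- by move=> z; rewrite -mulrA -!mulrDr ler_pM2l.
- by rewrite !meanZ// -mulrA -!mulrDr.
Qed.

End dual_functional.

(** * Finite bit functions and the joint law of the bits *)

Definition decode (s : seq bool) i := nth false s (size s - i.+1).

Lemma size_code b n : size (code b n) = n.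
Proof. by elim: n => //= n ->. Qed.

(** Since [code] lists the latest bit first, bit [i] of a word of length [n] stands at position
    [n - i.+1]. *)
Lemma code_decode b n i : (i < n)%N -> decode (code b n) i = b i.
Proof.
elim: n => // n ih; rewrite ltnS leq_eqVlt /decode /= size_code subSS.
move=> /predU1P[->|lt_in]; first by rewrite subnn.
by rewrite -(subnSK lt_in) /=; have := ih lt_in; rewrite /decode size_code.
Qed.

Lemma sum_code {R : realType} N (a : seq bool -> R) (b : nat -> bool) :
  \sum_(s : N.-tuple bool) a s * (code b N == s)%:R = a (code b N).
Proof.
have sz : size (code b N) == N by rewrite size_code.
rewrite (bigD1 (Tuple sz))//= eqxx mulr1 big1 ?addr0// => s ns.
rewrite (_ : (_ == _) = false) ?mulr0//; apply: contraNF ns => /eqP e.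
by apply/eqP; apply: val_inj => /=.
Qed.

(** The functions of the first [N] bits: combinations of indicators of words of length [N], on which
    the linearised price can be evaluated. *)
Definition finite_range {R : realType} N (G : (nat -> bool) -> R) :=
  forall b b', (forall i, (i < N)%N -> b i = b' i) -> G b = G b'.

Lemma finite_range_sum {R : realType} N (G : (nat -> bool) -> R) b : finite_range N G ->
  G b = \sum_(s : N.-tuple bool) G (decode s) * (code b N == s)%:R.
Proof.
by move=> GN; rewrite (sum_code N (fun s => G (decode s)));
  apply: GN => i /code_decode ->.
Qed.

Section random_bits.
Context {R : realType}.
Variables (mu : probability (measurableTypeR R) R) (bit : nat -> R -> bool)
  (m : seq bool -> R).
Hypothesis mubit : forall s,
  measurable [set w : measurableTypeR R | code (bit^~ w) (size s) = s] /\
  mu [set w : measurableTypeR R | code (bit^~ w) (size s) = s] = (m s)%:E.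

Let term N (s : N.-tuple bool) : measurable_fun [set: measurableTypeR R]
  (fun w => (code (bit^~ w) N == s)%:R : R) /\
  (\int[mu]_w ((code (bit^~ w) N == s)%:R : R)%:E = (m s)%:E)%E.
Proof.
have [mA muA] := mubit s; rewrite size_tuple in mA muA.
have e w : (code (bit^~ w) N == s)%:R = \1_[set w : measurableTypeR R | code (bit^~ w)
  N = s] w :> R.
  rewrite indicE (_ : (_ \in _) = (code (bit^~ w) N == s))//.
  by apply/idP/eqP; rewrite inE.
split; first by rewrite (funext e); exact: measurable_indic.
have h := integral_indic mu measurableT mA; rewrite setIT in h; rewrite -muA -h.
by apply: eq_integral => w _; rewrite e.
Qed.

Lemma measurable_finite_range N (G : (nat -> bool) -> R) : finite_range N G ->
  measurable_fun [set: measurableTypeR R] (fun w => G (bit^~ w)).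
Proof.
move=> GN; under eq_fun do rewrite (finite_range_sum _ GN).
apply: measurable_sum => s; apply: measurable_funM; first exact: measurable_cst.
exact: (term s).1.
Qed.

Lemma integral_finite_range N (G : (nat -> bool) -> R) : finite_range N G ->
    (forall b, 0 <= G b) ->
  (\int[mu]_w (G (bit^~ w))%:E = (\sum_(s : N.-tuple bool) G (decode s) * m s)%:E)%E.
Proof.
move=> GN G0; under eq_integral do rewrite (finite_range_sum _ GN) -sumEFin.
rewrite ge0_integral_sum//; first last.
- by move=> s w _; rewrite lee_fin mulr_ge0.
- move=> s; apply/measurable_EFinP; apply: measurable_funM; first exact: measurable_cst.
  exact: (term s).1.
rewrite -sumEFin; apply: eq_bigr => s _.
under eq_integral do rewrite EFinM.
rewrite ge0_integralZl_EFin//; first by rewrite (term s).2.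
by apply/measurable_EFinP; exact: (term s).1.
Qed.

End random_bits.

Lemma ae_forall_countable d (T : measurableType d) {R : realType}
    (mu : {measure set T -> \bar R}) (I : countType) (A : I -> T -> Prop) :
  (forall i, \forall x \ae mu, A i x) -> \forall x \ae mu, forall i, A i x.
Proof.
move=> H; pose B n x := if unpickle n is Some i then A i x else True.
have : \forall x \ae mu, forall n, B n x.
  by apply: ae_foralln => n; rewrite /B; case: unpickle => // ; exact: aeW.
by apply: ae_mono => x h i; have := h (pickle i); rewrite /B pickleK.
Qed.

Section transfer.
Context {R : realType} {E : ptopologicalType}.
Variables (P Q : probability (borel E) R) (c : E * E -> R) (V : R).
Hypothesis c0 : forall z, 0 <= c z.
Hypothesis dual : forall f g, bounded_continuous f -> bounded_continuous g ->
  (forall x y, g y - f x <= c (x, y)) -> \int[Q]_y g y - \int[P]_x f x <= V.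
Variable D : nat -> E * E -> bool.

(** The mass of a word is the linearised price [L] of the indicator that the bits of z spell it. The
    mean under [mu] of a function of finitely many bits is then [L] of the corresponding function of
    z, hence at most any superhedging value. *)
Lemma superhedged_bits :
  exists (mu : probability (measurableTypeR R) R) (bit : nat -> R -> bool),
  forall N (G : (nat -> bool) -> R), finite_range N G -> (forall b, 0 <= G b) ->
    measurable_fun [set: measurableTypeR R] (fun w => G (bit^~ w)) /\
    forall v, superhedge P Q c V (fun z => G (D^~ z)) v ->
      (\int[mu]_w (G (bit^~ w))%:E <= v%:E)%E.
Proof.
pose ind (s : seq bool) (z : E * E) : R := (code (D^~ z) (size s) == s)%:R.
(* Words are countable, so one sequence lists all the indicators along which the price has to become
   linear. *)
pose v n : E * E -> R := if unpickle n is Some s then ind s else 0.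
have sub := bounded_on_pairs_submodule (R := R) (E := E).
have bind s : bounded_on_pairs (ind s).
  by exists 1 => z; rewrite /ind; case: (_ == _); rewrite ?normr1 ?normr0.
have b0 : bounded_on_pairs (0 : E * E -> R) by exists 0 => z; rewrite normr0.
have bv n : bounded_on_pairs (v n) by rewrite /v; case: unpickle => [s|].
have [L [sL Lp Ll]] := sublinear_linearize sub (superhedging_price_sublinear c0 dual)
  bv.
have Lind s : linear_along L (ind s).
  by have := Ll (pickle s); rewrite /v pickleK.
have Lle h w : bounded_on_pairs h -> superhedge P Q c V h w -> L h <= w.
  by move=> bh hw; exact: le_trans (Lp _ bh) (superhedging_price_le c0 dual bh hw).
have bN h : bounded_on_pairs h -> bounded_on_pairs (- h).
  by move=> [M hM]; exists M => z; rewrite normrN.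
have hedge_cst (h : E * E -> R) a : (forall z, h z <= a) -> superhedge P Q c V h a.
  move=> ha; exists (fun=> a), (fun=> 0), 0; split => //.
  - exact: bounded_continuous_cst.
  - exact: bounded_continuous_cst.
  - by move=> z; rewrite mul0r !addr0.
  - by rewrite !mean_cst mul0r !addr0.
pose m s := L (ind s).
(* The function [- ind s] is hedged at 0, and linearity along [ind s] turns this upper bound into a
   lower bound for [m s]. *)
have m0 s : 0 <= m s.
  rewrite /m -[L _]opprK -Lind oppr_ge0; apply: Lle; first exact: bN.
  by apply: hedge_cst => z; rewrite oppr_le0.
have m1 : m [::] = 1.
  apply/eqP; rewrite eq_le; apply/andP; split.
    by apply: Lle => //; apply: hedge_cst => z; rewrite /ind eqxx.
  rewrite /m -[L _]opprK -Lind lerNr; apply: Lle; first exact: bN.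
  by apply: hedge_cst => z; rewrite (_ : (- ind [::]) z = - ind [::] z)// /ind eqxx.
have mS s : m s = m (false :: s) + m (true :: s).
  rewrite /m; pose bs := [:: false; true].
  have := @linear_along_sum _ _ bounded_on_pairs L _ bs (fun=> 1) (fun b => ind (b ::
    s)) sub sL b0
    (fun b _ => bind _) (fun b _ => Lind _).
  rewrite !big_cons !big_nil !scale1r !mul1r !addr0 => <-; congr L.
  apply/funext => z; rewrite (_ : (_ + _) z = ind (false :: s) z + ind (true :: s) z)//.
  rewrite /ind /= !eqseq_cons.
  by case: (D _ z); case: (_ == s); rewrite /= ?addr0 ?add0r.
have [mu [bit mubit]] := coin_flips m0 m1 mS.
exists mu, bit => N G GN G0; split; first exact: measurable_finite_range mubit _ _ GN.
move=> w hw; rewrite (integral_finite_range mubit GN G0) lee_fin.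
have := @linear_along_sum _ _ bounded_on_pairs L _ (index_enum (N.-tuple bool))
  (fun s => G (decode s)) (fun s => ind s) sub sL b0 (fun s _ => bind _) (fun s _ =>
    Lind _).
rewrite -/m => <-.
have -> : \sum_(s : N.-tuple bool) G (decode s) *: ind s = (fun z => G (D^~ z)).
  apply/funext => z; rewrite fct_sumE (finite_range_sum _ GN).
  by apply: eq_bigr => s _; rewrite /ind size_tuple.
apply: Lle => //.
exists (\sum_(s : N.-tuple bool) G (decode s)) => z; rewrite (finite_range_sum _ GN).
rewrite ger0_norm; last by apply: sumr_ge0 => s _; rewrite mulr_ge0.
by apply: ler_sum => s _; rewrite ler_piMr//; case: (_ == _).
Qed.

End transfer.

(** * Decoding the bits into a coupling *)

Section coupling.
Context {R : realType} {E : ptopologicalType}.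
Variables (rho : E -> E -> R) (x : nat -> E).
Hypotheses (rho_metric : is_metric rho) (rhoE : metrizes rho)
  (rho_complete : complete_metric rho).
Hypothesis x_dense : forall y e, 0 < e -> exists j, rho (x j) y < e.

Let rhoC y z : rho y z = rho z y. Proof. by have [_ _ h _] := rho_metric. Qed.
Let rho_tri y z t : rho y t <= rho y z + rho z t.
Proof. by have [_ _ _ h] := rho_metric. Qed.
Let rho_ge0 y z : 0 <= rho y z. Proof. by have [h _ _ _] := rho_metric. Qed.

Variables (P Q : probability (borel E) R) (c : E * E -> R) (V : R).
Hypothesis c0 : forall z, 0 <= c z.
Hypothesis dual : forall f g, bounded_continuous f -> bounded_continuous g ->
  (forall x y, g y - f x <= c (x, y)) -> \int[Q]_y g y - \int[P]_x f x <= V.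
Hypothesis lsc_c : lower_semicontinuous (EFin \o c).

Definition side (b : bool) (z : E * E) := if b then z.1 else z.2.
Let marginal (b : bool) := if b then P else Q.
Definition idx (b : bool) (n : nat * nat) : nat := pickle (b, n).

Definition cell_bit n (z : E * E) : bool :=
  if unpickle n is Some bn then
    let bn : bool * (nat * nat) := bn in `[< cell rho x bn.2 (side bn.1 z) >]
  else false.

Let cell_bitE b n z : cell_bit (idx b n) z <-> cell rho x n (side b z).
Proof. by rewrite /cell_bit /idx pickleK/=; split => /asboolP. Qed.

Let superhedge_side b (h : E * E -> R) f : bounded_continuous f ->
  (forall z, h z <= f (side b z)) -> superhedge P Q c V h (\int[marginal b]_y f y).
Proof.
move=> bf hf; have b0 := bounded_continuous_cst (E := E) (0 : R).
case: b hf => hf; [exists f, (fun=> 0), 0|exists (fun=> 0), f, 0]; split => //.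
- by move=> z; rewrite mul0r !addr0; exact: hf.
- by rewrite mean_cst mul0r !addr0.
- by move=> z; rewrite mul0r addr0 add0r; exact: hf.
- by rewrite mean_cst mul0r addr0 add0r.
Qed.

Variables (mu : probability (measurableTypeR R) R) (bit : nat -> R -> bool).
Hypothesis mu_le : forall N (G : (nat -> bool) -> R), finite_range N G -> (forall b, 0
  <= G b) ->
    measurable_fun [set: measurableTypeR R] (fun w => G (bit^~ w)) /\
    forall v, superhedge P Q c V (fun z => G (cell_bit^~ z)) v ->
      (\int[mu]_w (G (bit^~ w))%:E <= v%:E)%E.

Let measurable_bit n : measurable [set w : measurableTypeR R | bit n w].
Proof.
have [|//|+ _] := @mu_le n.+1 (fun b => (b n)%:R).
  by move=> b b' h; rewrite h.
move=> /(_ measurableT [set 1] (measurable_set1 _)); rewrite setTI.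
congr measurable; apply/seteqP; split => w /=; case: (bit n w) => //= /eqP.
by rewrite eq_sym oner_eq0.
Qed.

Let ae_finite_event N (A : (nat -> bool) -> bool) e :
  (forall b b', (forall i, (i < N)%N -> b i = b' i) -> A b = A b') ->
  superhedge P Q c V (fun z => (A (cell_bit^~ z))%:R) e ->
  measurable [set w : measurableTypeR R | A (bit^~ w)] /\
  (mu [set w : measurableTypeR R | A (bit^~ w)] <= e%:E)%E.
Proof.
move=> AN hA; have [|//|mA H] := @mu_le N (fun b => (A b)%:R).
  by move=> b b' /AN ->.
have mS : measurable [set w : measurableTypeR R | A (bit^~ w)].
  move: mA => /(_ measurableT [set 1] (measurable_set1 _)); rewrite setTI.
  congr measurable; apply/seteqP; split => w /=; case: (A _) => //= /eqP.
  by rewrite eq_sym oner_eq0.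
split => //; have := H _ hA.
have h := integral_indic mu measurableT mS; rewrite setIT in h; rewrite -h.
apply: le_trans; rewrite le_eqVlt; apply/orP; left; apply/eqP.
apply: eq_integral => w _; rewrite indicE (_ : (_ \in _) = A (bit^~ w))//.
by apply/idP/idP; rewrite inE.
Qed.

(** The indicator of a bit pattern that no pair of points produces is identically 0 on pairs, so it
    is hedged at 0. *)
Let ae_impossible N (A : (nat -> bool) -> bool) :
  (forall b b', (forall i, (i < N)%N -> b i = b' i) -> A b = A b') ->
  (forall z, ~~ A (cell_bit^~ z)) -> \forall w \ae mu, ~~ A (bit^~ w).
Proof.
move=> AN nA; have [|mA muA] := @ae_finite_event N A 0 AN.
  rewrite -(mean_cst P 0); apply: (@superhedge_side true);
    first exact: bounded_continuous_cst.
  by move=> z; rewrite (negbTE (nA z)).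
exists [set w | A (bit^~ w)]; split => //; last by move=> w /= /negP; rewrite negbK.
by apply/eqP; rewrite eq_le measure_ge0 andbT.
Qed.

(** No mass escapes: the event that the first [J] bits of level [k] are all false is hedged by
    [uncovered], whose marginal mean tends to 0 with [J]. *)
Let ae_covered b k : \forall w \ae mu, exists j, bit (idx b (k, j)) w.
Proof.
pose A J (bs : nat -> bool) := all (fun j => ~~ bs (idx b (k, j))) (iota 0 J).
pose N J := (\max_(j < J) idx b (k, nat_of_ord j)).+1.
have AN J bs bs' : (forall i, (i < N J)%N -> bs i = bs' i) -> A J bs = A J bs'.
  move=> h; apply: eq_in_all => j; rewrite mem_iota add0n => /= jJ.
  by rewrite h// ltnS (leq_bigmax (Ordinal jJ)).
have H e : 0 < e -> exists J, measurable [set w : measurableTypeR R | A J (bit^~ w)] /\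
    (mu [set w : measurableTypeR R | A J (bit^~ w)] <= e%:E)%E.
  move=> e0; have [J hJ] := uncovered_cvg0 rho_metric rhoE x_dense (marginal b) k e0.
  exists J; have [M _ lM] := uncovered_lipschitz x rho_metric k J.
  have bc : bounded_continuous (uncovered rho x k J).
    apply/bounded_continuousP; split; first exact: lipschitz_continuous lM.
    by exists 1 => y; have /andP[h1 h2] := uncovered_bound x rho_metric k J y;
      rewrite ger0_norm.
  have [|mA muA] := @ae_finite_event (N J) (A J) (\int[marginal b]_y uncovered rho x k
    J y) (@AN J).
    apply: superhedge_side bc _ => z; have [h|] := boolP (A J _); last first.
      by move=> _; have /andP[] := uncovered_bound x rho_metric k J (side b z).
    rewrite uncovered1// => j jJ /cell_bitE hj; move/allP : h => /(_ j).
    by rewrite mem_iota add0n jJ => /(_ isT)/negP.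
  by split => //; apply: le_trans muA _; rewrite EFin_mean.
have [J hJ] := choice (fun n => H (rad n) (rad_gt0 n)).
exists (\bigcap_n [set w | A (J n) (bit^~ w)]).
have mcap : measurable (\bigcap_n [set w : measurableTypeR R | A (J n) (bit^~ w)]).
  by apply: bigcapT_measurable => n; have [] := hJ n.
split => //; last first.
  move=> w /= nE n _ /=; apply/allP => j _; apply/negP => hj; apply: nE; by exists j.
apply/eqP; rewrite eq_le measure_ge0 andbT.
apply/lee_addgt0Pr => e /rad_small[n /(_ n (leqnn _))/ltW ne].
rewrite add0e; have [mA h] := hJ n.
apply: (@le_trans _ _ (mu [set w | A (J n) (bit^~ w)])).
  by apply: le_measure; rewrite ?inE//; exact: bigcap_inf.
by apply: (le_trans h); rewrite lee_fin.
Qed.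

Let ae_pair b n1 n2 : \forall w \ae mu,
  (cell rho x n1 `&` cell rho x n2 = set0 -> ~ (bit (idx b n1) w /\ bit (idx b n2) w))
    /\
  (cell rho x n1 `<=` cell rho x n2 -> bit (idx b n1) w -> bit (idx b n2) w).
Proof.
pose A1 (bs : nat -> bool) := `[< cell rho x n1 `&` cell rho x n2 = set0 >] &&
  (bs (idx b n1) && bs (idx b n2)).
pose A2 (bs : nat -> bool) := `[< cell rho x n1 `<=` cell rho x n2 >] &&
  (bs (idx b n1) && ~~ bs (idx b n2)).
pose N := (maxn (idx b n1) (idx b n2)).+1.
have H : \forall w \ae mu, ~~ (A1 (bit^~ w) || A2 (bit^~ w)).
  apply: (@ae_impossible N (fun bs => A1 bs || A2 bs)) => [bs bs' h|z].
    by rewrite /A1 /A2 !h// ltnS ?leq_maxl ?leq_maxr.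
  rewrite negb_or; apply/andP; split; apply/negP => /andP[/asboolP h].
    move=> /andP[/cell_bitE h1 /cell_bitE h2].
    by have : (cell rho x n1 `&` cell rho x n2) (side b z); [|rewrite h].
  by move=> /andP[/cell_bitE/h/cell_bitE ->].
apply: ae_mono H => w; rewrite negb_or => /andP[h1 h2]; split.
  by move=> e [b1 b2]; move: h1; rewrite /A1 b1 b2 asboolT.
move=> e b1; move: h2; rewrite /A2 b1/= asboolT//= negbK; exact.
Qed.

(** Bits that behave like membership of a point in the cells. The first two conditions produce a
    Cauchy sequence of centres; the third recovers the bit of every cell that contains the limit. *)
Definition good w := forall b,
  [/\ forall k, exists j, bit (idx b (k, j)) w,
    forall n1 n2, cell rho x n1 `&` cell rho x n2 = set0 ->
      ~ (bit (idx b n1) w /\ bit (idx b n2) w)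
  & forall n1 n2, cell rho x n1 `<=` cell rho x n2 ->
      bit (idx b n1) w -> bit (idx b n2) w].

Let ae_good : \forall w \ae mu, good w.
Proof.
have H b : \forall w \ae mu, forall n1 n2,
  (cell rho x n1 `&` cell rho x n2 = set0 -> ~ (bit (idx b n1) w /\ bit (idx b n2) w))
    /\
  (cell rho x n1 `<=` cell rho x n2 -> bit (idx b n1) w -> bit (idx b n2) w).
  by apply: ae_forall_countable => n1; apply: ae_forall_countable => n2; exact: ae_pair.
have H1 b : \forall w \ae mu, forall k, exists j, bit (idx b (k, j)) w.
  by apply: ae_forall_countable => k; exact: ae_covered.
have H2 : \forall w \ae mu, forall (i : bool * bool), if i.1 then
    forall n1 n2,
  (cell rho x n1 `&` cell rho x n2 = set0 -> ~ (bit (idx i.2 n1) w /\ bit (idx i.2 n2)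
    w)) /\
  (cell rho x n1 `<=` cell rho x n2 -> bit (idx i.2 n1) w -> bit (idx i.2 n2) w)
  else forall k, exists j, bit (idx i.2 (k, j)) w.
  by apply: ae_forall_countable => -[[] b]; [exact: H|exact: H1].
apply: ae_mono H2 => w h b; split; first exact: (h (false, b)).
  by move=> n1 n2; have [] := h (true, b) n1 n2.
by move=> n1 n2; have [] := h (true, b) n1 n2.
Qed.

(** Two cells with true bits must meet, so choosing one per level gives Cauchy centres. The limit
    can lie on the boundary of a cell, hence the weak inequality. *)
Let good_point w b : good w ->
  exists l, forall n, bit (idx b n) w -> rho (x n.2) l <= rad n.1.
Proof.
move=> /(_ b)[ex disj _].
have near2 n1 n2 : bit (idx b n1) w -> bit (idx b n2) w ->
    rho (x n1.2) (x n2.2) < rad n1.1 + rad n2.1.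
  move=> h1 h2; rewrite ltNge; apply/negP => far; apply: (disj n1 n2) => //.
  rewrite -subset0 => y [/= y1 y2]; move: y1 y2; rewrite /cell/= => y1 y2.
  by have := rho_tri (x n1.2) y (x n2.2); rewrite (rhoC y); lra.
have [j hj] := choice ex.
have [l hl] : exists l, forall e, (0 < e)%R -> exists N, forall n, (N <= n)%N ->
    (rho (x (j n)) l < e)%R.
  apply: (rho_complete (u := fun i => x (j i))) => e e0.
  have [N hN] := rad_small (ltac:(lra) : (0 < e / 2)%R).
  exists N => i i' /hN h /hN h'; have := near2 _ _ (hj i) (hj i') => /=; lra.
exists l => n bn; apply/ler_addgt0Pr => e e0.
have [N hN] := hl _ (ltac:(lra) : (0 < e / 2)%R).
have [N1 hN1] := rad_small (ltac:(lra) : (0 < e / 2)%R).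
pose i := maxn N N1.
have := near2 _ _ bn (hj i) => /=; have := hN i (leq_maxl _ _).
have := hN1 i (leq_maxr _ _); have := rho_tri (x n.2) (x (j i)) l; lra.
Qed.

Let null_bad : {M : set (measurableTypeR R) |
  [/\ measurable M, mu M = 0%E & forall w, ~ M w -> good w]}.
Proof.
apply: cid; have [M [mM M0 h]] := ae_good.
by exists M; split => // w nM; apply: contrapT => ng; apply: nM; exact: h.
Qed.

Let bad := sval null_bad.
Let bad_good w : ~ bad w -> good w. Proof. by have [_ _] := svalP null_bad; exact. Qed.

Definition decoded (b : bool) (w : R) : E :=
  if pselect (bad w) is right nb then sval (cid (good_point b (bad_good nb))) else
    point.

Let decodedP b w n : ~ bad w -> bit (idx b n) w -> rho (x n.2) (decoded b w) <= rad n.1.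
Proof.
by rewrite /decoded => nb; case: pselect => // nb'; case: cid => l /= h; exact: h.
Qed.

(** The decoded point has room inside an open cell, so a true cell of small radius is included in
    it, and the inclusion condition of [good] transfers the bit. *)
Let decoded_cell b w n : ~ bad w -> cell rho x n (decoded b w) -> bit (idx b n) w.
Proof.
move=> nb; set l := decoded b w => h.
have /(open_metricP rhoE)/(_ _ h)[e e0 le] := open_cell x rho_metric rhoE n.
have [N /(_ N (leqnn _)) hN] := rad_small (ltac:(lra) : (0 < e / 2)%R).
have [ex _ sub] := bad_good nb b.
have [j hj] := ex N; apply: (sub _ _ _ hj) => y; rewrite /cell/= => hy.
have := decodedP nb hj; rewrite -/l /= => hl.
by apply: le => /=; have := rho_tri l (x j) y; rewrite (rhoC l (x j)); lra.
Qed.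

Let measurable_decoded b :
  measurable_fun [set: measurableTypeR R] (decoded b : measurableTypeR R -> borel E).
Proof.
have mbad : measurable bad by have [] := svalP null_bad.
apply: (@measurability _ _ (measurableTypeR R) (borel E) setT (decoded b) (@open E)
  erefl) => _ [U oU <-]; rewrite setTI.
(* A true bit places the decoded point only in the closed ball, so the closed ball has to lie in
   [U]. *)
pose closed_cell n : set E := [set y | rho (x n.2) y <= rad n.1].
rewrite (_ : _ @^-1` U = (~` bad `&` \bigcup_n (if `[< closed_cell n `<=` U >]
    then [set w | bit (idx b n) w] else set0)) `|`
   (bad `&` (if `[< U point >] then setT else set0))).
  apply: measurableU.
    apply: measurableI; first exact: measurableC.
    apply: countable_bigcupT_measurable; first exact: countableP.
    by move=> n; case: asboolP.
  by apply: measurableI => //; case: asboolP.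
apply/seteqP; split => w /=.
  have [wb|nb] := pselect (bad w).
    by rewrite /decoded; case: pselect => // _ Up; right; split => //; rewrite asboolT.
  move=> Uw; left; split => //; have [ex _ _] := bad_good nb b.
  have /(open_metricP rhoE)/(_ _ Uw)[e e0 eU] := oU.
  have [N /(_ N (leqnn _)) hN] := rad_small (ltac:(lra) : (0 < e / 2)%R).
  have [j hj] := ex N; exists (N, j) => //; rewrite asboolT// => y;
    rewrite /closed_cell/= => hy.
  apply: eU => /=; have := decodedP nb hj => /= hl.
  by have := rho_tri (decoded b w) (x j) y; rewrite (rhoC _ (x j)); lra.
move=> [[nb [n _]]|[wb]]; case: asboolP => //.
  by move=> h bn; apply: h; exact: decodedP.
by rewrite /decoded; case: pselect.
Qed.

(** The integrand is bounded by a function [G] of finitely many bits, evaluated at the centre of the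
    first true cell. On actual points [G] is at most f + 2|M| rad k + [uncovered], whose marginal
    mean is within [e] of that of f. *)
Let decoded_le b M (f : E -> R) : lipschitz rho M f -> (forall y, 0 <= f y <= 1) ->
  (\int[mu]_w (f (decoded b w))%:E <= \int[marginal b]_y (f y)%:E)%E.
Proof.
move=> lf f01; have mf := lipschitz_measurable rho_metric rhoE lf.
have bf : bounded_continuous f.
  apply/bounded_continuousP; split; first exact: (lipschitz_continuous rho_metric rhoE
    lf).
  by exists 1 => y; have /andP[h1 h2] := f01 y; rewrite ger0_norm.
have lM y z : f y <= f z + `|M| * rho z y.
  have := lf y z; rewrite ler_norml => /andP[_]; have := ler_norm M;
    have := rho_ge0 y z.
  move=> r0 /(ler_wpM2r r0); rewrite (rhoC z); lra.
rewrite -(EFin_mean _ bf); apply/lee_addgt0Pr => e e0; rewrite -EFinD.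
(* Half of [e] pays twice for moving by [rad k] (once to the centre and once back); the other half
   pays for the uncovered part. *)
have d0 : 0 < e / 2 / (2 * `|M| + 1) by rewrite !divr_gt0// ltr_wpDl// mulr_ge0.
have [k /(_ k (leqnn _)) hk] := rad_small d0.
have hk2 : 2 * `|M| * rad k <= e / 2.
  move: hk; rewrite ltr_pdivlMr ?ltr_wpDl ?mulr_ge0// mulrDr mulr1 mulrC => /ltW.
  by have := @rad_gt0 R k; lra.
have [J hJ] := uncovered_cvg0 rho_metric rhoE x_dense (marginal b) k (ltac:(lra) : 0 <
  e / 2).
have [K _ lK] := uncovered_lipschitz x rho_metric k J.
have ub := uncovered_bound x rho_metric k J.
have bu : bounded_continuous (uncovered rho x k J).
  apply/bounded_continuousP; split; first exact: (lipschitz_continuous rho_metric rhoE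
    lK).
  by exists 1 => y; have /andP[h1 h2] := ub y; rewrite ger0_norm.
rewrite -EFin_mean// lee_fin in hJ.
(* The default 1 is an upper bound for [f] when none of the first [J] cells is true. *)
pose G (bs : nat -> bool) : R :=
  if [seq j <- iota 0 J | bs (idx b (k, j))] is j :: _ then f (x j) + `|M| * rad k else
    1.
pose N := (\max_(j < J) idx b (k, nat_of_ord j)).+1.
have GN : finite_range N G.
  move=> bs bs' h; rewrite /G (@eq_in_filter _ _ (fun j => bs' (idx b (k, j)))) // => j.
  rewrite mem_iota add0n => /= jJ.
  by rewrite h// ltnS (leq_bigmax (Ordinal jJ)).
have G0 bs : 0 <= G bs.
  rewrite /G; case: (seq.filter _ _) => [|j _]; first exact: ler01.
  by rewrite addr_ge0 ?mulr_ge0 ?(ltW (rad_gt0 k))//; have /andP[] := f01 (x j).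
have [mG muG] := mu_le GN G0.
pose g y := f y + (2 * `|M| * rad k + uncovered rho x k J y).
have bg : bounded_continuous g.
  apply: bounded_continuousD => //; apply: bounded_continuousD => //.
  exact: bounded_continuous_cst.
have hG : superhedge P Q c V (fun z => G (cell_bit^~ z)) (\int[marginal b]_y g y).
  apply: superhedge_side bg _ => z; rewrite /G /g.
  case E1 : [seq j <- iota 0 J | cell_bit (idx b (k, j)) z] => [|j s].
    rewrite uncovered1.
      have /andP[h _] := f01 (side b z); have : 0 <= 2 * `|M| * rad k.
        by rewrite !mulr_ge0// ltW ?rad_gt0.
      lra.
    move=> j jJ /cell_bitE hj; have : j \in [seq j <- iota 0 J | cell_bit (idx b (k,
      j)) z].
      by rewrite mem_filter hj mem_iota.
    by rewrite E1.
  have : j \in [seq j <- iota 0 J | cell_bit (idx b (k, j)) z] by rewrite E1 mem_head.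
  rewrite mem_filter => /andP[/cell_bitE + _]; rewrite /cell/= => hj.
  have := lM (x j) (side b z); have /andP[+ _] := ub (side b z).
  have : `|M| * rho (side b z) (x j) <= `|M| * rad k by rewrite ler_wpM2l// rhoC ltW.
  lra.
have := muG _ hG; rewrite /g meanD//; last first.
  by apply: bounded_continuousD => //; exact: bounded_continuous_cst.
rewrite meanD//; last exact: bounded_continuous_cst.
rewrite mean_cst => muG'.
apply: (@le_trans _ _ (\int[mu]_w (G (bit^~ w))%:E)%E); last first.
  by apply: (le_trans muG'); rewrite lee_fin; lra.
apply: ae_ge0_le_integral => //.
- by move=> w _; rewrite lee_fin; have /andP[] := f01 (decoded b w).
- apply/measurable_EFinP; exact: (measurableT_comp mf (measurable_decoded b)).
- by move=> w _; rewrite lee_fin.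
- exact/measurable_EFinP.
exists bad; have [mb mub _] := svalP null_bad; split => // w /= h;
  apply: contrapT => nb.
apply: h => _; rewrite lee_fin /G.
case E1 : [seq j <- iota 0 J | bit (idx b (k, j)) w] => [|j s].
  by have /andP[] := f01 (decoded b w).
have : j \in [seq j <- iota 0 J | bit (idx b (k, j)) w] by rewrite E1 mem_head.
rewrite mem_filter => /andP[/(decodedP nb) /= hj _].
apply: (le_trans (lM _ (x j))); rewrite lerD2l ler_wpM2l//.
Qed.

(** By lower semicontinuity [c] is a supremum of rational constants on products of cells. The maxima
    of these steps are nonnegative functions of finitely many bits, lie below [c] on actual pairs,
    and reach the cost of the decoded pair in the limit. *)
Let lower_step (i : nat) (bs : nat -> bool) : R :=
  if unpickle i is Some t then
    let t : rat * ((nat * nat) * (nat * nat)) := t in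
    if `[< cell rho x t.2.1 `*` cell rho x t.2.2 `<=` [set z | ratr t.1 < c z] >]
      && (bs (idx true t.2.1) && bs (idx false t.2.2)) then ratr t.1 else 0
  else 0.

Let lower_cost := fix lower_cost i bs :=
  if i is j.+1 then Num.max (lower_cost j bs) (lower_step j bs) else 0.

Let lower_cost_finite i : exists N, finite_range N (lower_cost i).
Proof.
elim: i => [|i [N hN]]; first by exists 0%N.
have [M hM] : exists M, finite_range M (lower_step i).
  rewrite /lower_step; case: (unpickle i) => [[t [m n]]|]; last by exists 0%N.
  exists (maxn (idx true m) (idx false n)).+1 => bs bs' h /=.
  by rewrite !h// ltnS ?leq_maxl ?leq_maxr.
exists (maxn N M) => bs bs' h /=.
by rewrite (hN bs bs') ?(hM bs bs')// => j hj; apply: h; rewrite leq_max hj ?orbT.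
Qed.

Let lower_cost_ge0 i bs : 0 <= lower_cost i bs.
Proof. by case: i => //= i; elim: i => [|i ih]; rewrite le_max ?lexx//= ih. Qed.

Let lower_cost_le i z : lower_cost i (cell_bit^~ z) <= c z.
Proof.
elim: i => [|i ih] /=; first exact: c0.
rewrite ge_max ih/= /lower_step; case: (unpickle i) => [[t [m n]]|]; last exact: c0.
case: ifPn => [|_]; last exact: c0.
by move=> /andP[/asboolP h /andP[/cell_bitE h1 /cell_bitE h2]]; apply/ltW/(h z).
Qed.

Let lower_cost_nd bs : {homo lower_cost ^~ bs : n m / (n <= m)%N >-> n <= m}.
Proof. by apply/nondecreasing_seqP => n /=; rewrite le_max lexx. Qed.

Let lower_cost_reach w (t : rat) : ~ bad w ->
  ratr t < c (decoded true w, decoded false w) -> exists i, ratr t <= lower_cost i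
    (bit^~ w).
Proof.
move=> nb tc; have := (lower_semicontinuousP (EFin \o c)).1 lsc_c (ratr t) => oc.
have [|n [/= n1 n2 sub]] := open_prod_basis rho_metric rhoE x_dense oc (z := (decoded
  true w, decoded false w)).
  by rewrite /= lte_fin.
exists (pickle (t, n)).+1 => /=; rewrite le_max; apply/orP; right.
rewrite /lower_step pickleK/= asboolT/=; last by move=> z /sub /=; rewrite lte_fin.
by rewrite (decoded_cell nb n1) (decoded_cell nb n2).
Qed.

Let measurable_decoded_pair : measurable_fun [set: measurableTypeR R]
  (fun w => (decoded true w : borel E, decoded false w : borel E)).
Proof. exact: measurable_fun_pair (measurable_decoded true) (measurable_decoded false).
  Qed.

Let measurable_cost : measurable_fun [set: (borel E * borel E)%type] (EFin \o c).
Proof. exact: (lsc_prod_measurable rho_metric rhoE x_dense lsc_c). Qed.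

(** Each [lower_cost] is hedged by one unit of [c], which is priced at [V]; monotone convergence
    does the rest. *)
Let decoded_cost :
  (\int[mu]_w (c (decoded true w, decoded false w))%:E <= V%:E)%E.
Proof.
have mH i : measurable_fun [set: measurableTypeR R] (fun w => (lower_cost i (bit^~
  w))%:E).
  have [N hN] := lower_cost_finite i; apply/measurable_EFinP.
  by have [] := mu_le hN (lower_cost_ge0 i).
have HV i : (\int[mu]_w (lower_cost i (bit^~ w))%:E <= V%:E)%E.
  have [N hN] := lower_cost_finite i.
  have [_] := mu_le hN (lower_cost_ge0 i); apply.
  exists (fun=> 0), (fun=> 0), 1; split.
  - exact: bounded_continuous_cst.
  - exact: bounded_continuous_cst.
  - exact: ler01.
  - by move=> z; rewrite mul1r !add0r.
  - by rewrite !mean_cst mul1r !add0r.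
have nd w : {homo (fun i => (lower_cost i (bit^~ w))%:E) : n m / (n <= m)%N >-> (n <=
  m)%E}.
  by move=> n m nm; rewrite lee_fin lower_cost_nd.
have cvI : cvgn (fun i => \int[mu]_w (lower_cost i (bit^~ w))%:E)%E.
  apply: ereal_nondecreasing_is_cvgn => n m nm.
  by apply: ge0_le_integral => // w _; rewrite lee_fin//; exact: lower_cost_nd.
apply: (@le_trans _ _ (\int[mu]_w limn (fun i => (lower_cost i (bit^~ w))%:E))%E);
  last first.
  rewrite monotone_convergence//; last by move=> n w _; rewrite lee_fin.
  by apply: lime_le => //; exact: nearW.
apply: ae_ge0_le_integral => //.
- by move=> w _; rewrite lee_fin.
- exact: (measurableT_comp measurable_cost measurable_decoded_pair).
- move=> w _; apply: lime_ge; first exact: ereal_nondecreasing_is_cvgn.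
  by apply: nearW => n; rewrite lee_fin.
- apply: (@emeasurable_fun_cvg _ _ _ _ (fun i w => (lower_cost i (bit^~ w))%:E)) => //
  w _.
  exact: ereal_nondecreasing_is_cvgn.
exists bad; have [mb mub _] := svalP null_bad; split => // w /= h;
  apply: contrapT => nb.
apply: h => _; apply/lee_addgt0Pr => e e0.
have [t] := rat_in_itvoo (ltac:(lra) : c (decoded true w, decoded false w) - e <
  c (decoded true w, decoded false w)).
rewrite in_itv/= => /andP[t1 t2]; have [i hi] := lower_cost_reach nb t2.
apply: (@le_trans _ _ ((lower_cost i (bit^~ w))%:E + e%:E)%E);
  first by rewrite -EFinD lee_fin; lra.
rewrite leeD2r//; rewrite (cvg_lim _ (ereal_nondecreasing_cvgn (nd w)))//.
by apply: ereal_sup_ubound; exists i.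
Qed.

Lemma decoded_coupling : exists2 pi, couplings P Q pi & (\int[pi]_z (c z)%:E <= V%:E)%E.
Proof.
pose X : {mfun measurableTypeR R >-> (borel E * borel E)%type} :=
  HB.pack (fun w => (decoded true w : borel E, decoded false w : borel E))
    (isMeasurableFun.Build _ _ _ _ _ measurable_decoded_pair).
pose Y b : {mfun measurableTypeR R >-> borel E} :=
  HB.pack (decoded b : measurableTypeR R -> borel E)
    (isMeasurableFun.Build _ _ _ _ _ (measurable_decoded b)).
have law b A : measurable (A : set (borel E)) -> distribution mu (Y b) A = marginal b A.
  move=> mA; apply: (lipschitz_measure_unique rho_metric rhoE (m1 := distribution mu (Y
    b))) => //.
  move=> M f lf f01; rewrite ge0_integral_distribution;
    first exact: (decoded_le b lf f01).
    by apply/measurable_EFinP; exact: (lipschitz_measurable rho_metric rhoE lf).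
  by move=> y; rewrite lee_fin; have /andP[] := f01 y.
exists (distribution mu X).
  by split => A mA; [exact: (law true)|exact: (law false)].
by rewrite ge0_integral_distribution// => z; rewrite lee_fin.
Qed.

End coupling.

Theorem kantorovich_duality {R : realType} {E : ptopologicalType}
    (hE : polish R E) (P Q : probability (borel E) R) (c : E * E -> R) (V : R) :
    (forall z, 0 <= c z) -> lower_semicontinuous (EFin \o c) ->
    (forall f g, bounded_continuous f -> bounded_continuous g ->
      (forall x y, g y - f x <= c (x, y)) -> \int[Q]_y g y - \int[P]_x f x <= V) ->
  exists2 pi, couplings P Q pi & (\int[pi]_z (c z)%:E <= V%:E)%E.
Proof.
move=> c0 lc dual.
have [rho [x [rho_metric rhoE rho_complete x_dense]]] := polish_dense_sequence hE.
have [mu [bit H]] := superhedged_bits c0 dual (cell_bit rho x).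
exact: (decoded_coupling rho_metric rhoE rho_complete x_dense c0 lc H).
Qed.

(** * Relative entropy *)

Section entropy.
Local Open Scope ereal_scope.
Local Open Scope charge_scope.

Section ae_monotone.
Context d (T : measurableType d) {R : realType} (mu : {measure set T -> \bar R}).

(** Setting the measurable majorant to +oo on the exceptional null set makes the comparison hold
    everywhere and leaves its integral unchanged, so the smaller function may be arbitrary. *)
Lemma ae_integral_le (f g : T -> \bar R) : measurable_fun setT g ->
  (\forall x \ae mu, f x <= g x) -> \int[mu]_x f x <= \int[mu]_x g x.
Proof.
move=> mg [N [mN muN h]]; pose g' x := if x \in N then +oo else g x.
apply: (@le_trans _ _ (\int[mu]_x g' x)).
  apply: integral_mono => x; rewrite /g'; case: ifPn => [_|]; first exact: leey.
  by rewrite notin_setE => nN; apply: contrapT => nle; apply: nN; exact: h.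
rewrite (@ae_eq_integral _ _ _ mu setT g)//.
  apply: measurable_fun_ifT => //.
  by apply: (measurable_fun_bool true); rewrite setTI (_ : _ @^-1` _ = N)//;
    apply/seteqP; split => x /=; [move=> /set_mem|move=> /mem_set].
exists N; split => // x /= h'; apply: contrapT => nN; apply: h' => _.
by rewrite /g' memNset.
Qed.

Lemma ae_integral_ge (f g : T -> \bar R) : measurable_fun setT g ->
  (\forall x \ae mu, g x <= f x) -> \int[mu]_x g x <= \int[mu]_x f x.
Proof.
move=> mg [N [mN muN h]]; pose g' x := if x \in N then -oo else g x.
apply: (@le_trans _ _ (\int[mu]_x g' x)); last first.
  apply: integral_mono => x; rewrite /g'; case: ifPn => [_|]; first exact: leNye.
  by rewrite notin_setE => nN; apply: contrapT => nle; apply: nN; exact: h.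
rewrite (@ae_eq_integral _ _ _ mu setT g' g)//.
  apply: measurable_fun_ifT => //.
  by apply: (measurable_fun_bool true); rewrite setTI (_ : _ @^-1` _ = N)//;
    apply/seteqP; split => x /=; [move=> /set_mem|move=> /mem_set].
exists N; split => // x /= h'; apply: contrapT => nN; apply: h' => _.
by rewrite /g' memNset.
Qed.

End ae_monotone.

Lemma ae_and d (T : measurableType d) {R : realType} (mu : {measure set T -> \bar R})
    (A B : T -> Prop) :
  (\forall x \ae mu, A x) -> (\forall x \ae mu, B x) -> \forall x \ae mu, A x /\ B x.
Proof.
move=> hA hB; apply: negligibleS (negligibleU hA hB) => x /= /not_andP[];
  [by left|by right].
Qed.

Section relative_entropy.
Context d (T : measurableType d) {R : realType}.
Implicit Types P Q : probability T R.

Lemma dominated_ae P Q (A : T -> Prop) : Q `<< P ->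
  (\forall x \ae P, A x) -> \forall x \ae Q, A x.
Proof.
move=> /null_content_dominatesP QP [N [mN PN h]]; exists N; split => //.
exact: QP.
Qed.

Section gibbs.
Variables (P Q : probability T R).
Hypothesis QP : Q `<< P.

Let rho := 'd (charge_of_finite_measure Q) '/d P.
Let r x : R := fine (rho x).

Let rhoE x : rho x = (r x)%:E.
Proof. by rewrite /r fineK// Radon_Nikodym_fin_num//. Qed.

Let mrho : measurable_fun setT rho.
Proof. by apply: measurable_int; exact: Radon_Nikodym_integrable. Qed.

Let mr : measurable_fun setT r.
Proof. by apply: (measurableT_comp _ mrho); exact: fine_measurable. Qed.

Let density_integral (v : T -> R) : (forall x, 0 <= v x)%R -> measurable_fun setT v ->
  \int[Q]_x (v x)%:E = \int[P]_x ((v x)%:E * rho x).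
Proof.
move=> v0 mv; rewrite -(Radon_Nikodym_SigmaFinite.change_of_variables QP)//=;
  last first.
  exact/measurable_EFinP.
apply: ae_eq_integral => //.
- apply: emeasurable_funM; first exact/measurable_EFinP.
  exact: measurable_int (Radon_Nikodym_SigmaFinite.f_integrable QP).
- by apply: emeasurable_funM => //; exact/measurable_EFinP.
apply: ae_eqe_mul2l; exact: ae_eq_Radon_Nikodym_SigmaFinite.
Qed.

Let density_pos : \forall x \ae Q, (0 < r x)%R.
Proof.
have mA : measurable [set x | (r x <= 0)%R].
  rewrite (_ : [set _ | _] = r @^-1` `]-oo, 0%R]%classic); last first.
    by apply/seteqP; split => x /=; rewrite in_itv.
  by rewrite -[X in measurable X]setTI; exact: mr.
exists [set x | (r x <= 0)%R]; split => //; last by move=> x /= /negP; rewrite -leNgt.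
apply/eqP; rewrite eq_le measure_ge0 andbT.
rewrite -[X in Q X]setIT -integral_indic// density_integral//.
rewrite -(@integral0 _ _ _ P setT); apply: integral_mono => x.
rewrite rhoE -EFinM lee_fin indicE; case: (boolP (x \in _)) => [|_];
  last by rewrite mul0r.
by rewrite inE mul1r.
Qed.

(** With r = dQ/dP, the inequality 1 + x <= exp x gives ln r >= phi + 1 - exp(phi)/r pointwise where
    r > 0. The last term has Q-mean at most P[exp phi] <= 1, so integrating under Q ends the proof
    without a truncation. *)
Lemma gibbs_le_relative_entropy (phi : T -> R) :
  Q.-integrable setT (EFin \o phi) -> \int[P]_x (expR (phi x))%:E <= 1 ->
  \int[Q]_x (phi x)%:E <= relative_entropy Q P.
Proof.
move=> iphi Pphi; rewrite /relative_entropy; case: pselect => // QP'.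
have mphi : measurable_fun setT phi by apply/measurable_EFinP;
  exact: measurable_int iphi.
pose v x : R := if (0 < r x)%R then expR (phi x - ln (r x)) else 0%R.
have mv : measurable_fun setT v.
  apply: measurable_fun_ifT => //; first exact: measurable_fun_ltr.
  by apply: measurableT_comp => //; apply: measurable_funB => //;
    exact: measurableT_comp.
have v0 x : (0 <= v x)%R by rewrite /v; case: ifPn => // h; exact: expR_ge0.
have Qv : \int[Q]_x (v x)%:E <= 1.
  rewrite density_integral//; apply: le_trans Pphi; apply: integral_mono => x.
  rewrite rhoE /v; case: ifPn => h; last by rewrite mul0e lee_fin expR_ge0.
  by rewrite -EFinM expRB lnK// divfK// gt_eqF.
have iv : Q.-integrable setT (EFin \o v).
  apply/integrableP; split; first exact/measurable_EFinP.
  rewrite (eq_integral (fun x => (v x)%:E)); first exact: le_lt_trans Qv (ltry _).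
  by move=> x _ /=; rewrite ger0_norm.
have i1 : Q.-integrable setT (EFin \o (fun=> 1%R : R)).
  by apply: (@bounded_integrable _ _ _ Q (fun=> 1%R) 1%R) => // x; rewrite normr1.
pose u x := ((phi x + 1) - v x)%R.
have iphi1 : Q.-integrable setT (EFin \o (fun x => phi x + 1)%R).
  by rewrite (_ : _ \o _ = (EFin \o phi) \+ (EFin \o fun=> 1%R))//; exact: integrableD.
have iu : Q.-integrable setT (EFin \o u).
  rewrite (_ : _ \o _ = (EFin \o (fun x => phi x + 1)%R) \- (EFin \o v))//.
  exact: integrableB.
apply: (@le_trans _ _ (\int[Q]_x (u x)%:E)); last first.
  apply: ae_integral_ge; first exact: measurable_int iu.
  apply: ae_mono density_pos => x h; rewrite -/rho rhoE lne_EFin// lee_fin /u /v h.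
  have := expR_ge1Dx (phi x - ln (r x)); lra.
have e1 : \int[Q]_x (phi x)%:E = (\int[Q]_x phi x)%:E by rewrite fineK//
  integrable_fin_num.
have e2 : \int[Q]_x (u x)%:E = (\int[Q]_x u x)%:E by rewrite fineK// integrable_fin_num.
rewrite e1 e2 lee_fin /u RintegralB// RintegralD// mean_cst.
have : (\int[Q]_x v x <= 1)%R.
  by rewrite -lee_fin fineK//; exact: integrable_fin_num.
by lra.
Qed.

End gibbs.

Lemma relative_entropy_ge0 P Q : 0 <= relative_entropy Q P.
Proof.
have [QP|nQP] := pselect (Q `<< P); last by rewrite /relative_entropy; case: pselect.
rewrite -(@integral0 _ _ _ Q setT).
apply: (gibbs_le_relative_entropy QP (phi := fun=> 0%R)).
  by apply: (@bounded_integrable _ _ _ Q (fun=> 0%R) 0%R) => // x; rewrite normr0.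
by under eq_integral do rewrite expR0; rewrite integral_cst// mul1e;
  exact: probability_le1.
Qed.

(** The law s P / P[s], for which the Gibbs inequality is sharp. A bounded [psi] stands for the
    logarithm of [s], so that [s] may vanish. *)
Lemma tilted_probability P (s psi : T -> R) (M : R) :
    measurable_fun setT s -> (forall x, 0 <= s x)%R ->
    measurable_fun setT psi -> (forall x, `|psi x| <= M)%R ->
    (forall x, 0 < s x -> s x = expR (psi x))%R -> (0 < \int[P]_x s x)%R ->
  exists Q, [/\ Q `<< P, \forall x \ae Q, (0 < s x)%R
    & relative_entropy Q P <= (\int[Q]_x psi x - ln (\int[P]_x s x))%:E].
Proof.
move=> ms s0 mpsi psiM spsi; set Z := (\int[P]_x s x)%R => Z0.
have sM x : (`|s x| <= expR M)%R.
  rewrite ger0_norm//; have := s0 x; rewrite le_eqVlt => /predU1P[<-|h];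
    first exact: expR_ge0.
  by rewrite spsi// ler_expR; have := psiM x; rewrite ler_norml => /andP[].
have is_ := bounded_integrable P ms sM.
pose dens x := (s x / Z)%:E.
have dens0 x : 0 <= dens x by rewrite lee_fin divr_ge0// ltW.
have mdens : measurable_fun setT dens.
  by apply/measurable_EFinP; apply: measurable_funM => //; exact: measurable_cst.
have idens : P.-integrable setT dens.
  rewrite (_ : dens = fun x => (EFin \o s) x * (Z^-1)%:E); first exact: integrableZr.
  by apply/funext => x; rewrite /dens EFinM.
pose nu (A : set T) := \int[P]_(x in A) dens x.
have nu0 : nu set0 = 0 by rewrite /nu integral_set0.
have nu_ge0 A : 0 <= nu A by exact: integral_ge0.
have nus : semi_sigma_additive nu by exact: semi_sigma_additive_nng_induced.
pose m : {measure set T -> \bar R} := HB.pack nu (isMeasure.Build _ _ _ nu nu0 nu_ge0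
  nus).
have nu1 : m setT = 1.
  rewrite /m/= /nu /dens; under eq_integral do rewrite EFinM.
  rewrite ge0_integralZr ?lee_fin ?invr_ge0 ?ltW//; last first.
  - by move=> x _; rewrite lee_fin.
  - exact/measurable_EFinP.
  rewrite (_ : \int[P]_x (s x)%:E = Z%:E) -?EFinM ?divff ?gt_eqF//.
  by rewrite /Z fineK// integrable_fin_num.
pose Q : probability T R := HB.pack nu m (Measure_isProbability.Build _ _ _ m nu1).
have QP : Q `<< P.
  apply/null_content_dominatesP => A mA PA0; rewrite /Q/= /nu.
  by apply: null_set_integral => //; exact: measurable_funTS.
have spos : \forall x \ae Q, (0 < s x)%R.
  have mB : measurable [set x | (s x <= 0)%R].
    rewrite (_ : [set _ | _] = s @^-1` `]-oo, 0%R]%classic); last first.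
      by apply/seteqP; split => x /=; rewrite in_itv.
    by rewrite -[X in measurable X]setTI; exact: ms.
  exists [set x | (s x <= 0)%R]; split => //; last by move=> x /= /negP; rewrite -leNgt.
  rewrite /Q/= /nu; under eq_integral => x.
    rewrite inE/= => sx; rewrite /dens (_ : s x = 0%R) ?mul0r; last first.
      by apply/eqP; rewrite eq_le sx s0.
    over.
  by rewrite integral0.
exists Q; split => //; rewrite /relative_entropy; case: pselect => // QP'.
have mpZ : measurable_fun setT (fun x => psi x - ln Z)%R by exact: measurable_funB.
apply: (@le_trans _ _ (\int[Q]_x (psi x - ln Z)%:E)).
  apply: ae_integral_le; first exact/measurable_EFinP.
  have : \forall x \ae Q, ('d (charge_of_finite_measure Q) '/d P) x = dens x.
    apply: (dominated_ae QP).
    have : ae_eq P setT ('d (charge_of_finite_measure Q) '/d P) dens.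
      apply: integral_ae_eq => //; first exact: Radon_Nikodym_integrable.
      by move=> A _ mA; rewrite -Radon_Nikodym_integral.
    move=> [N [mN N0 h]]; exists N; split => // x /= h'.
    by apply: (h x) => h2; apply: h'; apply: h2.
  move=> /ae_and/(_ spos); apply: ae_mono => x [-> sx].
  rewrite /dens lne_EFin ?divr_gt0// lee_fin ln_div ?posrE//.
  by rewrite spsi// expRK.
have ipsi := bounded_integrable Q mpsi psiM.
have ic : Q.-integrable setT (EFin \o (fun=> ln Z)).
  exact: (@bounded_integrable _ _ _ Q (fun=> ln Z) `|ln Z|%R).
rewrite (_ : \int[Q]_x _ = (\int[Q]_x (psi x - ln Z))%:E).
  by rewrite RintegralB// mean_cst.
rewrite fineK//; apply: integrable_fin_num => //.
rewrite (_ : (fun _ => _) = (EFin \o psi) \- (EFin \o (fun=> ln Z)))//;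
  exact: integrableB.
Qed.

End relative_entropy.

End entropy.

(** * Weights and their norms *)

Section weights.
Context {R : realType}.

Lemma conjugate_ge2 (p : R) (q : \bar R) : 1 <= p <= 2 -> (p%:E^-1 + q^-1 = 1)%E ->
  q = +oo%E \/ exists2 r, q = r%:E & 2 <= r.
Proof.
move=> p12; have p0 : p != 0 by apply/eqP => p0; move: p12; rewrite p0; lra.
rewrite {1}/inve (negbTE p0); case: q => [r| |] //; last by left.
rewrite /inve; have [//|r0] := eqVneq r 0.
move=> /eqP; rewrite -EFinD eqe => /eqP e; right; exists r => //.
have pV : 2^-1 <= p^-1 <= 1.
  by rewrite lef_pV2 ?posrE ?invf_le1//; lra.
have rV : 0 < r^-1.
  by rewrite lt_neqAle eq_sym invr_neq0//=; lra.
by rewrite -(invrK r) -[2]invrK lef_pV2 ?posrE; lra.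
Qed.

Definition penalty (q : \bar R) (a : R) : R :=
  if q is r%:E then (a `^ r - 1) / r + 2^-1 else 2^-1.

(** Young's inequality for n^2 times 1 with the exponent r/2 and its conjugate (1 - 2/r)^-1; the
    latter is infinite at r = 2, where the claim is an equality. *)
Lemma half_sqr_le_penalty (r n : R) : 2 <= r -> 0 <= n -> n ^+ 2 / 2 <= penalty r%:E n.
Proof.
move=> r2 n0; rewrite /penalty; have r0 : 0 < r by lra.
have [->|rn2] := eqVneq r 2; first by rewrite powR_mulrn//; lra.
have r2' : 2 < r by rewrite lt_neqAle eq_sym rn2.
have h : 0 < 1 - 2 / r by rewrite subr_gt0 ltr_pdivrMr// mul1r.
have := conjugate_powR (sqr_ge0 n) ler01 (divr_gt0 r0 (ltr0n _ 2)) (ltac:(by rewrite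
  invr_gt0) : 0 < (1 - 2 / r)^-1).
rewrite invrK invf_div mulr1 powR1 => /(_ ltac:(lra)).
rewrite mul1r -powR_mulrn// -powRrM (_ : 2%:R * (r / 2) = r); last by field.
rewrite powR_mulrn// => H.
have -> : (n `^ r - 1) / r + 2^-1 = (n `^ r * (2 / r) + (1 - 2 / r)) / 2.
  by field; lra.
by rewrite ler_pM2r ?invr_gt0//; exact: H.
Qed.

Lemma bracketE (q : \bar R) a : (forall r, q = r%:E -> r != 0) ->
  bracket q (fun r => (a `^ r)%:E) = (penalty q a)%:E.
Proof.
case: q => [r| |] //= /(_ r erefl) r0; rewrite /inve (negbTE r0) -EFinM -EFinD//.
Qed.

Lemma mul_sqrt_le (C k n l : R) : 0 < C -> 0 <= k -> 0 < l ->
  n * Num.sqrt (2 * C * k) <= k / l + l * C * (n ^+ 2 / 2).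
Proof.
move=> C0 k0 l0; pose s := Num.sqrt (2 * C * k); rewrite -/s.
have s2 : s ^+ 2 = 2 * C * k by rewrite sqr_sqrtr// !mulr_ge0// ltW.
rewrite -(ler_pM2l (mulr_gt0 l0 C0)) -subr_ge0.
have -> : l * C * (k / l + l * C * (n ^+ 2 / 2)) - l * C * (n * s) = (s - l * C * n) ^+
  2 / 2.
  rewrite sqrrB s2; field; lra.
by rewrite divr_ge0// sqr_ge0.
Qed.

Lemma le_sqrt_of_quadratic (C k x : R) : 0 < C ->
  (forall l, 0 < l -> l * x <= k + C * l ^+ 2 / 2) -> x <= Num.sqrt (2 * C * k).
Proof.
move=> C0 H; have [x0|x0] := lerP x 0; first exact: le_trans x0 (sqrtr_ge0 _).
(* The optimal choice is [l = x / C]. *)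
have := H _ (divr_gt0 x0 C0); rewrite -(ler_pM2l C0).
rewrite (_ : C * (x / C * x) = x ^+ 2); last by field; lra.
rewrite (_ : C * (k + C * (x / C) ^+ 2 / 2) = C * k + x ^+ 2 / 2); last by field; lra.
move=> h; have h2 : x ^+ 2 <= 2 * C * k by rewrite -mulrA; lra.
by rewrite -[x]gtr0_norm// -sqrtr_sqr ler_sqrt// (le_trans (sqr_ge0 x)).
Qed.

End weights.

Section norms.
Context {R : realType} {E : ptopologicalType}.
Implicit Types (m : probability (borel E) R) (alpha : E -> R).
Local Open Scope ereal_scope.

Lemma nonneg_lsc_measurable alpha : nonneg_lsc alpha ->
  measurable_fun [set: borel E] alpha.
Proof. by move=> [_ /lsc_measurable/measurable_EFinP]. Qed.

Lemma Lnorm_finE m alpha r : (forall y, 0 <= alpha y)%R ->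
  'N[m]_(r%:E)[EFin \o alpha] = (\int[m]_y (alpha y `^ r)%:E) `^ r^-1.
Proof.
move=> a0; rewrite unlock; congr (_ `^ _); apply: eq_integral => y _ /=.
by rewrite ger0_norm.
Qed.

Lemma Lnorm_inftyE m alpha : (forall y, 0 <= alpha y)%R ->
  'N[m]_(+oo)[EFin \o alpha] = ess_sup m (EFin \o alpha).
Proof.
move=> a0; rewrite unlock ifT; last first.
  exact: (eq_ind_r (fun t => 0 < t) lte01 (probability_setT m)).
congr ess_sup; by apply/funext => y /=; rewrite ger0_norm.
Qed.

Lemma Lnorm_ae_bound q m alpha M : q = +oo \/ (exists2 r, q = r%:E & (2 <= r)%R) ->
  nonneg_lsc alpha -> (\forall y \ae m, (alpha y <= M)%R) ->
  'N[m]_q[EFin \o alpha] < +oo.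
Proof.
move=> qr la aM; have [a0 _] := la; have ma := nonneg_lsc_measurable la.
case: qr => [->|[r -> r2]].
  rewrite Lnorm_inftyE//; apply: le_lt_trans (ltry M); apply/ess_supP.
  by apply: ae_mono aM => y; rewrite lee_fin.
rewrite Lnorm_finE//; apply: poweR_lty.
apply: le_lt_trans (ltry (`|M| `^ r)%R).
apply: (@le_trans _ _ (\int[m]_y (`|M| `^ r)%:E)).
  apply: ae_integral_le => //; apply: ae_mono aM => y h; rewrite lee_fin.
  by rewrite ge0_ler_powR ?nnegrE//; [lra|exact: le_trans h (ler_norm _)].
rewrite integral_cst//.
by apply: (eq_ind_r (fun t => _ * t <= _) _ (probability_setT m)); rewrite mule1.
Qed.

Lemma ae_eq0_of_Lnorm q m alpha : q = +oo \/ (exists2 r, q = r%:E & (2 <= r)%R) ->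
  nonneg_lsc alpha -> 'N[m]_q[EFin \o alpha] = 0 -> \forall y \ae m, alpha y = 0%R.
Proof.
move=> qr la; have [a0 _] := la; have ma := nonneg_lsc_measurable la.
case: qr => [->|[r -> r2]].
  rewrite Lnorm_inftyE// => e; have := ess_sup_ge m (EFin \o alpha); rewrite e.
  by apply: ae_mono => y /=; rewrite lee_fin => h; apply/eqP; rewrite eq_le h a0.
have r0 : (0 < r)%R by lra.
move=> e; have mE : measurable_fun [set: borel E] (EFin \o alpha) by
  exact/measurable_EFinP.
have rE : 0 < r%:E by rewrite lte_fin.
have [N [mN N0 hN]] := Lnorm_eq0_eq0 mE rE e; exists N; split => // y /= ny;
  apply: (hN y) => /= ey; apply: ny.
by have [] := ey I.
Qed.

Lemma ae_le_Lnorm_infty m alpha n : nonneg_lsc alpha ->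
  'N[m]_(+oo)[EFin \o alpha] = n%:E -> \forall y \ae m, (alpha y <= n)%R.
Proof.
move=> [a0 _]; rewrite Lnorm_inftyE// => e; have := ess_sup_ge m (EFin \o alpha).
by rewrite e; apply: ae_mono.
Qed.

(** For finite [q] the penalty is affine in the power a^q, so its mean depends on [alpha] only
    through its norm. *)
Lemma penalty_mean q m alpha n : q = +oo \/ (exists2 r, q = r%:E & (2 <= r)%R) ->
  nonneg_lsc alpha -> (0 <= n)%R -> 'N[m]_q[EFin \o alpha] = n%:E ->
  [/\ m.-integrable setT (EFin \o (penalty q \o alpha)),
    (\int[m]_y penalty q (alpha y) = penalty q n)%R
  & bracket q (fun r => \int[m]_y (alpha y `^ r)%:E) = (penalty q n)%:E].
Proof.
move=> qr la n0; have [a0 _] := la; have ma := nonneg_lsc_measurable la.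
case: qr => [->|[r -> r2]].
  move=> _; split => //; last by rewrite /penalty/= mean_cst.
  exact: (@bounded_integrable _ _ _ m (fun _ : borel E => 2^-1%R) `|2^-1|%R).
have r0 : (r != 0)%R by apply/eqP; lra.
have rV : (0 < r^-1)%R by rewrite invr_gt0; lra.
rewrite Lnorm_finE//.
have Ipos : 0 <= \int[m]_y (alpha y `^ r)%:E.
  by apply: integral_ge0 => y _; rewrite lee_fin powR_ge0.
case Ei : (\int[m]_y (alpha y `^ r)%:E) Ipos => [i| |]//; last first.
  by rewrite poweRyr// gt_eqF.
rewrite lee_fin => i0 /= [e].
have ei : i = (n `^ r)%R by rewrite -e -powRrM mulVf// powRr1.
have mp : measurable_fun [set: borel E] (fun y : borel E => alpha y `^ r)%R.
  by apply: (measurableT_comp (measurable_powR r) ma).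
have ip : m.-integrable setT (EFin \o (fun y : borel E => alpha y `^ r)%R).
  apply/integrableP; split; first exact/measurable_EFinP.
  rewrite (eq_integral (fun y : borel E => (alpha y `^ r)%:E)) ?Ei ?ltry// => y _ /=.
  by rewrite ger0_norm// powR_ge0.
have i1 a : m.-integrable setT (EFin \o (fun _ : borel E => a : R)).
  exact: (@bounded_integrable _ _ _ m (fun _ : borel E => a) `|a|%R).
have i2 : m.-integrable setT (EFin \o (fun y : borel E => (alpha y `^ r - 1))%R).
  rewrite (_ : _ \o _ = (EFin \o (fun y : borel E => alpha y `^ r)%R) \- (EFin \o (fun
    _ : borel E => 1%R)))//.
  exact: integrableB.
have i3 : m.-integrable setT (EFin \o (fun y : borel E => (alpha y `^ r - 1) / r)%R).
  rewrite (_ : _ \o _ = fun y => (EFin \o (fun y : borel E => (alpha y `^ r - 1))%R) y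
    * (r^-1)%:E)//.
  exact: integrableZr.
split.
- rewrite (_ : _ \o _ = (EFin \o (fun y : borel E => (alpha y `^ r - 1) / r)%R) \+
  (EFin \o (fun _ : borel E => 2^-1%R)))//.
  exact: integrableD.
- rewrite /penalty RintegralD// RintegralZr// RintegralB// !mean_cst.
  by rewrite /Rintegral Ei/= ei.
- by rewrite /bracket/= Ei ei /inve (negbTE r0) -EFinM -EFinD.
Qed.

(** In the limit case the constraint [alpha <= 1] takes the place of the power inequality: it gives
    n <= 1, hence n^2/2 <= 1/2. *)
Lemma penalty_dual_weight q n m alpha : q = +oo \/ (exists2 r, q = r%:E & (2 <= r)%R) ->
  dual_weights q alpha -> (0 <= n)%R -> 'N[m]_q[EFin \o alpha] = n%:E ->
  (n ^+ 2 / 2 <= penalty q n)%R.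
Proof.
move=> qr [la a1] n0 e; case: qr => [qE|[r -> r2]]; last exact: half_sqr_le_penalty.
move: e; rewrite qE /penalty Lnorm_inftyE; last by case: la.
move=> e; have : ess_sup m (EFin \o alpha) <= 1.
  by apply/ess_supP; apply: aeW => y; rewrite lee_fin a1.
rewrite e lee_fin => n1; rewrite ler_pdivrMr// mulVf// expr2.
exact: le_trans (ler_piMr n0 n1) n1.
Qed.

(** For [q = +oo] the bound [alpha <= n] holds almost everywhere, but dual weights are bounded at
    every point. Truncating at [n] before dividing repairs this and changes [alpha] on a null
    set. *)
Lemma Lnorm_scale q m alpha n : (0 < n)%R -> nonneg_lsc alpha ->
  q = +oo \/ (exists2 r, q = r%:E & (2 <= r)%R) -> 'N[m]_q[EFin \o alpha] = n%:E ->
  exists beta, [/\ dual_weights q beta, 'N[m]_q[EFin \o beta] = 1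
    & \forall y \ae m, alpha y = (n * beta y)%R].
Proof.
move=> n0 la qr; have [a0 lsa] := la; have ma := nonneg_lsc_measurable la.
have nN0 : (n != 0)%R by rewrite gt_eqF.
have cancel (X : \bar R) : n%:E = n%:E * X -> X = 1.
  case: X => [t| |]; rewrite ?gt0_muley ?gt0_muleNy ?lte_fin// -EFinM => -[e].
  by congr EFin; apply: (mulfI nN0); rewrite mulr1 -e.
have eq_open (A B : set E) : A `<=>` B -> open A -> open B by move=> /seteqP ->.
have lscP (beta : E -> R) : (forall t, open [set y | (t < beta y)%R]) ->
  lower_semicontinuous (EFin \o beta).
  move=> h; apply/lower_semicontinuousP => t; apply: (eq_open _ _ _ (h t)).
  by split => y /=; rewrite lte_fin.
have open_alpha t : open [set y | (t < alpha y)%R].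
  apply: (eq_open _ _ _ ((lower_semicontinuousP (EFin \o alpha)).1 lsa t)).
  by split => y /=; rewrite lte_fin.
case: qr => [->|[r -> r2]].
  move=> e; have an := ae_le_Lnorm_infty la e.
  pose beta y := (Num.min (alpha y) n / n)%R.
  have b0 y : (0 <= beta y)%R by rewrite divr_ge0 ?le_min ?a0 ?ltW.
  have ab : \forall y \ae m, alpha y = (n * beta y)%R.
    by apply: ae_mono an => y h; rewrite /beta min_l// mulrC divfK.
  exists beta; split => //.
    split; last by move=> _ y; rewrite /beta ler_pdivrMr// mul1r ge_min lexx orbT.
    split=> //; apply: lscP => t; have [t1|t1] := ltrP t 1.
      apply: (eq_open _ _ _ (open_alpha (t * n)%R)); split => y /=;
        by rewrite /beta ltr_pdivlMr// lt_min [X in _ && X](_ : _ = true) ?andbT//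
          -ltr_pdivlMr// divff.
    rewrite (_ : [set _ | _] = set0); first exact: open0.
    rewrite -subset0 => y /=; rewrite /beta ltNge; apply: contraNP => _.
    by apply: le_trans t1; rewrite ler_pdivrMr// mul1r ge_min lexx orbT.
  apply: cancel; rewrite -{1}e !Lnorm_inftyE//.
  rewrite -ess_sup_pZl//; apply: eq_ess_sup; apply: ae_mono ab => y /= ->.
  by rewrite EFinM.
pose beta y := (alpha y / n)%R.
have b0 y : (0 <= beta y)%R by rewrite divr_ge0 ?a0 ?ltW.
have ab y : alpha y = (n * beta y)%R by rewrite /beta mulrC divfK.
have lb : nonneg_lsc beta.
  split => //; apply: lscP => t; apply: (eq_open _ _ _ (open_alpha (t * n)%R)).
  by split => y /=; rewrite /beta ltr_pdivlMr.
move=> e; exists beta; split; [by split|apply: cancel|exact: aeW].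
have mb := nonneg_lsc_measurable lb.
have r0 : (r != 0)%R by apply/eqP; lra.
have mp : measurable_fun [set: borel E] (fun y => beta y `^ r)%R.
  by apply: (measurableT_comp (measurable_powR r) mb).
rewrite -{1}e !Lnorm_finE//.
under eq_integral do rewrite ab powRM ?(ltW n0)// EFinM.
rewrite ge0_integralZl_EFin ?powR_ge0//; last 2 first.
- by move=> y _; rewrite lee_fin powR_ge0.
- exact/measurable_EFinP.
rewrite poweRM ?lee_fin ?powR_ge0//; last by apply: integral_ge0 => y _;
  rewrite lee_fin powR_ge0.
by rewrite poweR_EFin -powRrM mulfV// powRr1// ltW.
Qed.

End norms.

(** * Integration against couplings *)

Section couplings.
Context {R : realType} d1 d2 (T1 : measurableType d1) (T2 : measurableType d2).
Variables (P : probability T1 R) (Q : probability T2 R) (pi : probability (T1 *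
  T2)%type R).
Hypothesis piPQ : couplings P Q pi.
Local Open Scope ereal_scope.

Lemma coupling_ae_snd (A : T2 -> Prop) : (\forall y \ae Q, A y) -> \forall z \ae pi, A
  z.2.
Proof.
move=> [N [mN QN h]]; exists (snd @^-1` N); split.
- by rewrite -[X in measurable X]setTI; exact: measurable_snd.
- by rewrite -QN; exact: (piPQ.2 N mN).
- by move=> z /= nz; exact: h.
Qed.

Let ge0_fst (f : T1 -> \bar R) : measurable_fun setT f -> (forall x, 0 <= f x) ->
  \int[pi]_z f z.1 = \int[P]_x f x.
Proof.
move=> mf f0.
have := @ge0_integral_pushforward _ _ _ _ R fst measurable_fst pi setT f measurableT mf
  (fun y _ => f0 y).
rewrite preimage_setT => <-.
by apply: eq_measure_integral => A mA _; exact: (piPQ.1 A mA).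
Qed.

Let ge0_snd (f : T2 -> \bar R) : measurable_fun setT f -> (forall x, 0 <= f x) ->
  \int[pi]_z f z.2 = \int[Q]_x f x.
Proof.
move=> mf f0.
have := @ge0_integral_pushforward _ _ _ _ R snd measurable_snd pi setT f measurableT mf
  (fun y _ => f0 y).
rewrite preimage_setT => <-.
by apply: eq_measure_integral => A mA _; exact: (piPQ.2 A mA).
Qed.

Lemma coupling_fst (f : T1 -> R) : P.-integrable setT (EFin \o f) ->
  pi.-integrable setT (EFin \o (f \o fst)) /\ (\int[pi]_z f z.1 = \int[P]_x f x)%R.
Proof.
move=> fi; have mf := measurable_int _ fi; split.
  apply/integrableP; split; first exact: (measurableT_comp mf measurable_fst).
  rewrite (ge0_fst (f := fun x => `|(EFin \o f) x|))//;
    first by have /integrableP[] := fi.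
  exact: measurableT_comp.
congr fine; rewrite integralE [RHS]integralE; congr (_ - _).
  rewrite -ge0_fst//; last exact: measurable_funepos.
  by apply: eq_integral => z _; rewrite !funeposE.
rewrite -ge0_fst//; last exact: measurable_funeneg.
by apply: eq_integral => z _; rewrite !funenegE.
Qed.

Lemma coupling_snd (f : T2 -> R) : Q.-integrable setT (EFin \o f) ->
  pi.-integrable setT (EFin \o (f \o snd)) /\ (\int[pi]_z f z.2 = \int[Q]_x f x)%R.
Proof.
move=> fi; have mf := measurable_int _ fi; split.
  apply/integrableP; split; first exact: (measurableT_comp mf measurable_snd).
  rewrite (ge0_snd (f := fun x => `|(EFin \o f) x|))//;
    first by have /integrableP[] := fi.
  exact: measurableT_comp.
congr fine; rewrite integralE [RHS]integralE; congr (_ - _).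
  rewrite -ge0_snd//; last exact: measurable_funepos.
  by apply: eq_integral => z _; rewrite !funeposE.
rewrite -ge0_snd//; last exact: measurable_funeneg.
by apply: eq_integral => z _; rewrite !funenegE.
Qed.

Lemma coupling_minorant (f : T1 -> R) (g : T2 -> R) (c : T1 * T2 -> R) :
  P.-integrable setT (EFin \o f) -> Q.-integrable setT (EFin \o g) ->
  (\forall z \ae pi, (g z.2 - f z.1 <= c z)%R) ->
  (\int[Q]_y g y - \int[P]_x f x)%:E <= \int[pi]_z (c z)%:E.
Proof.
move=> /coupling_fst[fi fE] /coupling_snd[gi gE] gfc.
have i : pi.-integrable setT (EFin \o (fun z => g z.2 - f z.1)%R).
  rewrite (_ : _ \o _ = (EFin \o (g \o snd)) \- (EFin \o (f \o fst)))//.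
  exact: integrableB.
rewrite (_ : _%:E = \int[pi]_z (g z.2 - f z.1)%:E).
  apply: ae_integral_ge; first exact: measurable_int i.
  by apply: ae_mono gfc => z; rewrite lee_fin.
by rewrite -gE -fE -RintegralB// fineK// integrable_fin_num.
Qed.

End couplings.

(** * Weighted costs and infimal convolutions *)

Section transport.
Context {R : realType} {E : ptopologicalType}.
Hypothesis hE : polish R E.
Variables (d : E -> E -> R).
Hypotheses (d0 : forall x y, 0 <= d x y)
  (dlsc : lower_semicontinuous (fun z : E * E => (d z.1 z.2)%:E)).
Implicit Types (P Q : probability (borel E) R) (alpha : E -> R).

(** Duality for the zero cost: if g(y) <= f(x) for all x and y, averaging in y and then in x gives
    the dual bound 0. *)
Lemma coupling_exists P Q : exists pi, couplings P Q pi.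
Proof.
have [||f g bf bg h|pi piPQ _] := @kantorovich_duality R E hE P Q (fun=> 0) 0.
- by [].
- by move=> x a /= a0; exists setT => //; exact: filterT.
- have iQ := bounded_continuous_integrable Q bg.
  have iP := bounded_continuous_integrable P bf.
  have H x : \int[Q]_y g y <= f x.
    rewrite -(mean_cst Q (f x)); apply: le_Rintegral => //.
      exact: (@bounded_integrable _ _ _ Q (fun=> f x) `|f x|).
    by move=> y _; have := h x y; lra.
  suff : \int[Q]_y g y <= \int[P]_x f x by lra.
  rewrite -(mean_cst P (\int[Q]_y g y)); apply: le_Rintegral => //.
  exact: (@bounded_integrable _ _ _ P (fun=> \int[Q]_y g y) `|\int[Q]_y g y|).
- by exists pi.
Qed.

Lemma weighted_cost_lsc alpha : nonneg_lsc alpha ->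
  lower_semicontinuous (EFin \o (fun z : E * E => alpha z.2 * d z.1 z.2)).
Proof.
move=> [a0 la] z t /=; rewrite lte_fin => tc.
have [t0|t0] := ltrP t 0.
  by exists setT; [exact: filterT|move=> y _;
    rewrite lte_fin (lt_le_trans t0)// mulr_ge0].
have ap : 0 < alpha z.2 by rewrite lt_neqAle a0 andbT; apply/eqP => e; move: tc;
  rewrite -e mul0r; lra.
have dp : 0 < d z.1 z.2 by rewrite lt_neqAle d0 andbT; apply/eqP => e; move: tc;
  rewrite -e mulr0; lra.
(* [t = (t / b) b] with [t / alpha < b < d], hence [t / b < alpha]. *)
pose b := (t / alpha z.2 + d z.1 z.2) / 2.
have h1 : t / alpha z.2 < d z.1 z.2 by rewrite ltr_pdivrMr// mulrC.
have h0 : 0 <= t / alpha z.2 by rewrite divr_ge0// ltW.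
have b0 : 0 < b by rewrite /b; lra.
have bd : b < d z.1 z.2 by rewrite /b; lra.
have tb : t / b < alpha z.2.
  by rewrite ltr_pdivrMr// mulrC -ltr_pdivrMr// /b; lra.
have [U zU hU] := la z.2 (t / b) ltac:(by rewrite lte_fin).
have [W zW hW] := dlsc (x := z) (a := b) ltac:(by rewrite lte_fin).
exists (snd @^-1` U `&` W).
  by apply: filterI => //; exact: cvg_snd.
move=> y [/= /hU + /hW]; rewrite !lte_fin => h2 h3.
have -> : t = t / b * b by rewrite divfK// gt_eqF.
apply: (@lt_le_trans _ _ (alpha y.2 * b)); first by rewrite ltr_pM2r.
by rewrite ler_wpM2l// ltW.
Qed.

Lemma inf_conv_le alpha (f : E -> R) M x y : (forall y, 0 <= alpha y) ->
  (forall x, `|f x| <= M) -> inf_conv alpha d f y <= alpha y * d x y + f x.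
Proof.
move=> a0 fM; apply: ge_inf; last by exists x.
exists (- M) => _ [t _ <-]; have := fM t; rewrite ler_norml => /andP[h _].
by apply: (le_trans h); rewrite lerDr mulr_ge0.
Qed.

Lemma inf_conv_lt alpha (f : E -> R) M y t : (forall y, 0 <= alpha y) ->
  (forall x, `|f x| <= M) ->
  (inf_conv alpha d f y < t <-> exists x, alpha y * d x y + f x < t).
Proof.
move=> a0 fM; split => [h|[x]]; last by apply: le_lt_trans; exact: inf_conv_le a0 fM.
have hi : has_inf [set (alpha y * d x y + f x)%R | x in [set: E]].
  split; first by exists (alpha y * d point y + f point), point.
  exists (- M) => _ [u _ <-]; have := fM u; rewrite ler_norml => /andP[h' _].
  by apply: (le_trans h'); rewrite lerDr mulr_ge0.
have [_ [x _ <-] hx] := inf_adherent (ltac:(lra) : 0 < t - inf_conv alpha d f y) hi.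
by exists x; apply: (lt_le_trans hx); rewrite /inf_conv; lra.
Qed.

Lemma le_inf_conv alpha (f : E -> R) y a :
  (forall x, a <= alpha y * d x y + f x) -> a <= inf_conv alpha d f y.
Proof.
move=> h; apply: lb_le_inf; last by move=> _ [x _ <-].
by exists (alpha y * d point y + f point), point.
Qed.

Lemma inf_conv_bound alpha (f : E -> R) M y : (forall y, 0 <= alpha y) ->
  (forall x, d x x = 0) -> (forall x, `|f x| <= M) -> - M <= inf_conv alpha d f y <= M.
Proof.
move=> a0 dxx fM; apply/andP; split.
  apply: le_inf_conv => x; have := fM x; rewrite ler_norml => /andP[h _].
  by apply: (le_trans h); rewrite lerDr mulr_ge0.
have := inf_conv_le y y a0 fM; rewrite dxx mulr0 add0r => /le_trans; apply.
by have := fM y; rewrite ler_norml => /andP[].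
Qed.

Lemma measurable_weighted_cost alpha : nonneg_lsc alpha ->
  measurable_fun [set: (borel E * borel E)%type] (fun z => (alpha z.2 * d z.1 z.2)%:E).
Proof.
move=> /weighted_cost_lsc h.
have [rho [x [rm rE _ xd]]] := polish_dense_sequence hE.
exact: (lsc_prod_measurable rm rE xd h).
Qed.

Lemma weighted_cost_eq0 P Q pi alpha : nonneg_lsc alpha -> couplings P Q pi ->
  (\forall y \ae Q, alpha y = 0) -> (\int[pi]_z (alpha z.2 * d z.1 z.2)%:E = 0)%E.
Proof.
move=> la piPQ a0; have mc := measurable_weighted_cost la.
have ae0 := coupling_ae_snd piPQ a0.
apply/eqP; rewrite eq_le; apply/andP; split; last first.
  by apply: integral_ge0 => z _; rewrite lee_fin mulr_ge0//; case: la.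
rewrite -[leRHS](@integral0 _ _ _ pi setT); apply: ae_integral_le => //.
by apply: ae_mono ae0 => z ->; rewrite mul0r.
Qed.

(** For positive [n] this unfolds the supremum and the infimum. For [n = 0] the quotient carries no
    bound, but then [alpha] vanishes Q-almost everywhere and every coupling has zero cost. *)
Lemma transport_cost_le q P Q alpha n v a : nonneg_lsc alpha -> 0 <= n -> 0 <= v ->
    ('N[Q]_q[EFin \o alpha] = n%:E)%E -> (n = 0 -> \forall y \ae Q, alpha y = 0) ->
    (weak_transport q d P Q <= v%:E)%E ->
    (forall pi, couplings P Q pi -> (a%:E <= \int[pi]_z (alpha z.2 * d z.1 z.2)%:E)%E)
      ->
  a <= n * v.
Proof.
move=> la n0 v0 Nn an0 W H.
have [n00|nN0] := eqVneq n 0.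
  have [pi piPQ] := coupling_exists P Q.
  have := H _ piPQ; rewrite (weighted_cost_eq0 la piPQ (an0 n00)) lee_fin.
  by rewrite n00 mul0r.
have np : 0 < n by rewrite lt_neqAle eq_sym nN0.
rewrite -ler_pdivrMl// -lee_fin; apply: le_trans W.
apply: (@le_trans _ _ (ereal_inf [set ((\int[pi]_z (alpha z.2 * d z.1 z.2)%:E) /
         'N[Q]_q[EFin \o alpha])%E | pi in couplings P Q])); last first.
  by apply: ereal_sup_ubound; exists alpha.
apply/ereal_infP => _ [pi piPQ <-].
have := H _ piPQ; rewrite Nn /inve (negbTE nN0) => h.
by rewrite mulrC EFinM lee_wpmul2r// lee_fin invr_ge0.
Qed.

End transport.

(** * The four implications *)

Section duality_formulas.
Import HBNNSimple.

(** A simple function has finitely many values; with [phi = ln] this bounds the exponent of the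
    tilted law. *)
Lemma nnsfun_comp_bounded d (T : measurableType d) {R : realType} (h : {nnsfun T >-> R})
    (phi : R -> R) : exists M, forall y, `|phi (h y)| <= M.
Proof.
have /finite_seqP[s hs] := fimfunP h.
exists (\sum_(v <- s) `|phi v|) => y.
have ys : h y \in s by have : [set` s] (h y) by rewrite -hs; exists y.
by rewrite (big_rem (h y))//= lerDl sumr_ge0.
Qed.

Lemma integrable_affine d (T : measurableType d) {R : realType} (m : probability T R)
    (u v : T -> R) a b c :
  m.-integrable setT (EFin \o u) -> m.-integrable setT (EFin \o v) ->
  m.-integrable setT (EFin \o (fun y => a * u y + b * v y + c)) /\
  \int[m]_y (a * u y + b * v y + c) = a * \int[m]_y u y + b * \int[m]_y v y + c.
Proof.
move=> iu iv.
have iau : m.-integrable setT (EFin \o (fun y => a * u y)).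
  rewrite (_ : _ \o _ = fun y => (a%:E * (EFin \o u) y)%E)//; exact: integrableZl.
have ibv : m.-integrable setT (EFin \o (fun y => b * v y)).
  rewrite (_ : _ \o _ = fun y => (b%:E * (EFin \o v) y)%E)//; exact: integrableZl.
have iuv : m.-integrable setT (EFin \o (fun y => a * u y + b * v y)).
  rewrite (_ : _ \o _ = ((EFin \o (fun y => a * u y)%R) \+ (EFin \o (fun y => b * v
    y)%R))%E)//.
  exact: integrableD.
have ic : m.-integrable setT (EFin \o (fun=> c)).
  exact: (@bounded_integrable _ _ _ m (fun=> c) `|c|).
split; last by rewrite RintegralD// RintegralD// !RintegralZl// mean_cst.
rewrite (_ : _ \o _ = ((EFin \o (fun y => a * u y + b * v y)%R) \+ (EFin \o (fun=>
  c)))%E)//.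
exact: integrableD.
Qed.

Section duality.
Context {R : realType} {E : ptopologicalType}.
Hypothesis hE : polish R E.
Variables (d : E -> E -> R).
Hypotheses (d0 : forall x y, 0 <= d x y) (dxx : forall x, d x x = 0)
  (dlsc : lower_semicontinuous (fun z : E * E => (d z.1 z.2)%:E)).
Variables (q : \bar R) (C : R).
Hypotheses (qr : q = +oo%E \/ exists2 r, q = r%:E & 2 <= r) (C0 : 0 < C).
Implicit Types (P Q : probability (borel E) R) (alpha : E -> R).

(** The lower envelope of the sandwich replaces the infimal convolution by an integrable function
    with the same mean, still below it everywhere. *)
Lemma mean_inf_conv P alpha f : nonneg_lsc alpha -> bounded_continuous f ->
  exists g, [/\ P.-integrable setT (EFin \o g), forall y, g y <= inf_conv alpha d f y
    & (\int[P]_y (inf_conv alpha d f y)%:E = (\int[P]_y g y)%:E)%E].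
Proof.
move=> la /bounded_continuousP[cf [M fM]]; have [a0 _] := la.
have [rho [x [rm rE rc xd]]] := polish_dense_sequence hE.
have lh : lower_semicontinuous (EFin \o (fun z : E * E => alpha z.2 * d z.1 z.2 + f
  z.1)).
  move=> z t /=; rewrite lte_fin => ht.
  pose e := (alpha z.2 * d z.1 z.2 + f z.1 - t) / 2.
  have e0 : 0 < e by rewrite /e; lra.
  have [U zU hU] := weighted_cost_lsc d0 dlsc la (x := z) (a := alpha z.2 * d z.1 z.2 -
    e)
    ltac:(by rewrite lte_fin; lra).
  exists (U `&` (fst @^-1` (f @^-1` [set u | f z.1 - e < u]))).
    apply: filterI => //; apply: cvg_fst; apply: cf; apply: open_nbhs_nbhs.
    by split; [exact: open_gt|rewrite /=; lra].
  by move=> y [/hU]; rewrite !lte_fin /e /=; lra.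
have Fb y : - M <= inf_conv alpha d f y <= M by exact: inf_conv_bound.
have [g1 [g2 [mg1 mg2 b1 b2 g12]]] := infimum_sandwich rm rE rc xd P lh
  (fun y t => inf_conv_lt d0 y t a0 fM) Fb.
have ig : P.-integrable setT (EFin \o g1).
  apply: (bounded_integrable P (M := M) mg1) => y; rewrite ler_norml.
  by have := b1 y; have := Fb y; lra.
exists g1; split => //; first by move=> y; have /andP[] := b1 y.
have e1 : (\int[P]_y (g1 y)%:E = (\int[P]_y g1 y)%:E)%E by rewrite fineK//
  integrable_fin_num.
apply/eqP; rewrite eq_le -e1; apply/andP; split; last first.
  by apply: integral_mono => y; rewrite lee_fin; have /andP[] := b1 y.
apply: ae_integral_le; first exact/measurable_EFinP.
by apply: ae_mono g12 => y ->; rewrite lee_fin; have /andP[] := b2 y.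
Qed.

Let exponent_pointwise l F a alpha (y : E) :
  expeR (l%:E * (F%:E - a%:E) - (C * l ^+ 2)%:E * bracket q (fun r => (alpha y `^
    r)%:E))%E =
  (expR (l * (F - a) - C * l ^+ 2 * penalty q (alpha y)))%:E.
Proof.
rewrite bracketE//; case: qr => [-> //|[r -> r2] _ [<-]].
by rewrite gt_eqF//; lra.
Qed.

Let entropy_sqrt k : sqrte ((2 * C)%:E * k%:E)%E = (Num.sqrt (2 * C * k))%:E.
Proof. by []. Qed.

Let penalty1 : penalty q 1 = 2^-1 :> R.
Proof. by case: qr => [-> //|[r -> r2]]; rewrite /penalty powR1 subrr mul0r add0r. Qed.

(* If the exponential moment exceeded 1, so would the mean of some simple [s]
   below the exponential, even cut off to [alpha <= n] (which makes the norm of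
   [alpha] finite); the inequality fails for the probability [s P / P[s]]. *)
Lemma dual_of_weak_transport_ineq P l alpha f : weak_transport_ineq q d C P ->
  0 < l -> dual_weights q alpha -> bounded_continuous f ->
  (\int[P]_y expeR (l%:E * ((inf_conv alpha d f y)%:E - \int[P]_x (f x)%:E)
     - (C * l ^+ 2)%:E * bracket q (fun r => (alpha y `^ r)%:E)) <= 1)%E.
Proof.
move=> TP l0 wa bf; have [la _] := wa; have [a0 _] := la.
have ma := nonneg_lsc_measurable la.
rewrite -(EFin_mean P bf); under eq_integral do rewrite exponent_pointwise.
set pf := \int[P]_y f y; set Phi := fun y => l * (inf_conv alpha d f y - pf) -
  C * l ^+ 2 * penalty q (alpha y).
rewrite leNgt; apply/negP; rewrite ge0_integralTE; last by move=> y;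
  rewrite lee_fin expR_ge0.
move=> /ereal_sup_gt[_ [h /= hPhi <-]]; rewrite -integralT_nnsfun => h1.
pose A n := [set y : borel E | alpha y <= n%:R].
have mA n : measurable (A n).
  rewrite (_ : A n = alpha @^-1` `]-oo, n%:R]%classic); last first.
    by apply/seteqP; split => y /=; rewrite in_itv.
  by rewrite -[X in measurable X]setTI; exact: ma.
pose s n y := h y * \1_(A n) y.
have ms n : measurable_fun [set: borel E] (s n) by apply: measurable_funM.
have s0 n y : 0 <= s n y by rewrite mulr_ge0// indicE.
have sh n y : s n y <= h y by rewrite ler_piMr// indicE; case: (_ \in _).
have [Mh hM] := nnsfun_comp_bounded h id.
have ih : P.-integrable setT (EFin \o h) by exact: (bounded_integrable P _ hM).
have [n sn1] : exists n, (1 < \int[P]_y (s n y)%:E)%E.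
  apply: contrapT => /forallNP H; move: h1; apply/negP; rewrite -leNgt.
  have cv : (\int[P]_y (s n y)%:E)%E @[n --> \oo] --> (\int[P]_y (h y)%:E)%E.
    apply: (@dominated_cvg _ _ _ P setT measurableT (fun n y => (s n y)%:E) _ (EFin \o
      h)) => //.
    - by move=> n; apply/measurable_EFinP.
    - move=> y _; apply: cvg_near_cst; exists (Num.truncn (alpha y)).+1 => // n /= hn.
      rewrite /s indicE mem_set ?mulr1//= /A/=.
      by rewrite (le_trans (ltW (truncnS_gt _)))// ler_nat.
    - by move=> n y _; rewrite /= lee_fin ger0_norm.
  rewrite -(cvg_lim _ cv)//; apply: lime_le; first by apply/cvg_ex; eexists; exact: cv.
  by apply: nearW => n; have /negP := H n; rewrite -leNgt.
(* Since [ln 0 = 0], the exponent stays bounded where [s n] vanishes. *)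
pose psi y := ln (s n y).
have [M lnM] := nnsfun_comp_bounded h (@ln R).
have psiM y : `|psi y| <= M.
  rewrite /psi /s indicE; case: (_ \in _); rewrite ?mulr1//.
  by rewrite mulr0 ln0// normr0 (le_trans _ (lnM y)).
have mpsi : measurable_fun [set: borel E] psi.
  by apply: (measurableT_comp (measurable_ln (R := R))).
have spsi y : 0 < s n y -> s n y = expR (psi y) by move=> ?; rewrite lnK.
set Z := \int[P]_y s n y.
have Z1 : 1 < Z.
  rewrite -lte_fin (EFin_Rintegral P (ms n) (M := Mh))// => y.
  by rewrite ger0_norm// (le_trans (sh n y))// (le_trans (ler_norm _)).
have [Q [QP Qs KQ]] := tilted_probability (ms n) (s0 n) mpsi psiM spsi (lt_trans ltr01
  Z1).
have KQ0 := relative_entropy_ge0 P Q.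
have [k kE] : exists k, relative_entropy Q P = k%:E.
  exists (fine (relative_entropy Q P)); rewrite fineK// ge0_fin_numE//.
  exact: le_lt_trans KQ (ltry _).
have k0 : 0 <= k by rewrite -lee_fin -kE.
have kZ : k <= \int[Q]_y psi y - ln Z by rewrite -lee_fin -kE.
have an : \forall y \ae Q, alpha y <= n%:R.
  apply: ae_mono Qs => y; rewrite /s indicE; case: (boolP (_ \in _));
    last by rewrite mulr0 ltxx.
  by rewrite inE.
have [nn [nn0 nnE]] : exists nn, 0 <= nn /\ ('N[Q]_q[EFin \o alpha] = nn%:E)%E.
  exists (fine ('N[Q]_q[EFin \o alpha])%E); rewrite fine_ge0 ?Lnorm_ge0//; split => //.
  by rewrite fineK// ge0_fin_numE ?Lnorm_ge0//; exact: Lnorm_ae_bound qr la an.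
have [ipen penE _] := penalty_mean qr la nn0 nnE.
have ipsi := bounded_integrable Q mpsi psiM.
(* This is [psi <= Phi] solved for [inf_conv]: the affine function lies below the convolution where
   s > 0, so with [f] it forms an admissible pair for the cost. *)
have [ig gE] := integrable_affine l^-1 (C * l) pf ipsi ipen.
have ifP := bounded_continuous_integrable P bf.
have TQ : (weak_transport q d P Q <= (Num.sqrt (2 * C * k))%:E)%E.
  by apply: le_trans (TP Q) _; rewrite kE entropy_sqrt.
have /bounded_continuousP[_ [Mf fM]] := bf.
have := transport_cost_le hE d0 dlsc la nn0 (sqrtr_ge0 _) nnE
  (a := l^-1 * \int[Q]_y psi y + C * l * penalty q nn) _ TQ.
move=> /(_ (fun e => ae_eq0_of_Lnorm qr la (etrans nnE (congr1 EFin e)))) H.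
have {}H := H _.
have : l^-1 * \int[Q]_y psi y + C * l * penalty q nn <= nn * Num.sqrt (2 * C * k).
  apply: H => pi piPQ.
  have := coupling_minorant piPQ ifP ig; rewrite /= gE penE addrK; apply.
  apply: ae_mono (coupling_ae_snd piPQ Qs) => z sz.
  have : psi z.2 <= Phi z.2.
    rewrite -(expRK (Phi z.2)) ler_ln ?posrE ?expR_gt0//.
    by apply: (le_trans (sh _ _)); rewrite -lee_fin.
  have := inf_conv_le d0 z.1 z.2 a0 fM.
  rewrite /Phi => h2 h3; suff : l^-1 * psi z.2 <= inf_conv alpha d f z.2 - pf - C * l *
    penalty q (alpha z.2) by lra.
  by rewrite ler_pdivrMl//; apply: (le_trans h3); rewrite le_eqVlt; apply/orP; left;
    apply/eqP; ring.
(* The transport bound yields Q[psi] <= k, whereas k <= Q[psi] - ln Z with ln Z > 0. *)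
move=> h2; have := le_trans h2 (mul_sqrt_le nn C0 k0 l0).
have := penalty_dual_weight qr wa nn0 nnE => h3.
have h4 : l * C * (nn ^+ 2 / 2) <= l * C * penalty q nn by rewrite ler_wpM2l// ltW//
  mulr_gt0.
have Zl : 0 < ln Z by rewrite ln_gt0.
move=> h5; have : l^-1 * \int[Q]_y psi y <= l^-1 * k by lra.
by rewrite ler_pM2l ?invr_gt0//; lra.
Qed.

Let exponent_mean l m a (M : R) :
  expeR (l%:E * (m%:E - a%:E) - (C * l ^+ 2)%:E * M%:E)%E = (expR (l * (m - a) - C * l
    ^+ 2 * M))%:E.
Proof. by []. Qed.

(** Here the exponent depends on y only through the bounded [f], so tilting by exp(- l f) works
    directly: its normaliser [Z], times a constant, is the integral to be bounded. *)
Lemma dual_of_inverted_weak_transport_ineq P l alpha f :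
  inverted_weak_transport_ineq q d C P ->
  0 < l -> dual_weights q alpha -> bounded_continuous f ->
  (\int[P]_y expeR (l%:E * (\int[P]_x (inf_conv alpha d f x)%:E - (f y)%:E)
     - (C * l ^+ 2)%:E * bracket q (fun r => \int[P]_x (alpha x `^ r)%:E)) <= 1)%E.
Proof.
move=> TP l0 wa bf; have [la a1] := wa; have [a0 _] := la.
have ma := nonneg_lsc_measurable la.
have [g [ig gF ->]] := mean_inf_conv P la bf; set m := \int[P]_y g y.
have Cl : 0 < C * l ^+ 2 by rewrite mulr_gt0// exprn_gt0.
(* An infinite norm occurs for finite [q] only. It makes the bracket +oo, and the integrand is then
   exp(-oo) = 0. *)
have [Noo|Nfin] := eqVneq ('N[P]_q[EFin \o alpha])%E +oo%E.
  have -> : bracket q (fun r => \int[P]_x (alpha x `^ r)%:E)%E = +oo%E.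
    case: qr Noo => [qE|[r -> r2]].
      rewrite qE Lnorm_inftyE// => e; have : (ess_sup P (EFin \o alpha) <= 1)%E.
        by apply/ess_supP; apply: aeW => y; rewrite lee_fin a1.
      by rewrite e.
    rewrite Lnorm_finE//; have : (0 <= \int[P]_y (alpha y `^ r)%:E)%E.
      by apply: integral_ge0 => y _; rewrite lee_fin powR_ge0.
    case Ei : (\int[P]_y (alpha y `^ r)%:E)%E => [i| |]// _ _.
    rewrite /bracket/= Ei /inve (_ : (r == 0) = false); last by apply/negbTE/eqP; lra.
    by rewrite (_ : (+oo - 1)%E = +oo%E)// gt0_mulye// lte_fin invr_gt0; lra.
  rewrite gt0_muley ?lte_fin//; under eq_integral do rewrite addeNy /=.
  by rewrite integral0 lee01.
have [nn [nn0 nnE]] : exists nn, 0 <= nn /\ ('N[P]_q[EFin \o alpha] = nn%:E)%E.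
  exists (fine ('N[P]_q[EFin \o alpha])%E); rewrite fine_ge0 ?Lnorm_ge0//; split => //.
  by rewrite fineK// ge0_fin_numE ?Lnorm_ge0// ltey.
have [_ _ ->] := penalty_mean qr la nn0 nnE.
under eq_integral do rewrite exponent_mean.
have /bounded_continuousP[cf [Mf fM]] := bf.
have mf := continuous_borel_measurable cf.
pose psi y := - l * f y; pose s y := expR (psi y).
have mpsi : measurable_fun [set: borel E] psi.
  by apply: measurable_funM => //; exact: measurable_cst.
have ms : measurable_fun [set: borel E] s by exact: measurableT_comp.
have psiM y : `|psi y| <= l * Mf.
  by rewrite /psi normrM normrN (gtr0_norm l0) ler_wpM2l// ltW.
have sM y : `|s y| <= expR (l * Mf).
  rewrite ger0_norm ?expR_ge0// ler_expR; have := psiM y.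
  by rewrite ler_norml => /andP[].
have is_ := bounded_integrable P ms sM.
set Z := \int[P]_y s y.
have Z0 : 0 < Z.
  apply: (@lt_le_trans _ _ (expR (- (l * Mf)))); first exact: expR_gt0.
  rewrite -(mean_cst P (expR _)); apply: le_Rintegral => //.
    exact: (@bounded_integrable _ _ _ P (fun=> expR (- (l * Mf))) `|expR (- (l * Mf))|).
  by move=> y _; rewrite ler_expR; have := psiM y; rewrite ler_norml => /andP[].
have [Q [QP _ KQ]] := tilted_probability ms (fun y => expR_ge0 (psi y)) mpsi psiM (fun
  y _ => erefl) Z0.
have KQ0 := relative_entropy_ge0 P Q.
have [k kE] : exists k, relative_entropy Q P = k%:E.
  exists (fine (relative_entropy Q P)); rewrite fineK// ge0_fin_numE//.
  exact: le_lt_trans KQ (ltry _).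
have k0 : 0 <= k by rewrite -lee_fin -kE.
have kZ : k <= \int[Q]_y psi y - ln Z by rewrite -lee_fin -kE.
have ifQ := bounded_continuous_integrable Q bf.
have TQ : (weak_transport q d Q P <= (Num.sqrt (2 * C * k))%:E)%E.
  by apply: le_trans (TP Q) _; rewrite kE entropy_sqrt.
have := transport_cost_le hE d0 dlsc la nn0 (sqrtr_ge0 _) nnE
  (fun e => ae_eq0_of_Lnorm qr la (etrans nnE (congr1 EFin e))) TQ
  (a := m - \int[Q]_y f y) => H.
have {}H : m - \int[Q]_y f y <= nn * Num.sqrt (2 * C * k).
  apply: H => pi piQP.
  apply: (coupling_minorant piQP ifQ ig); apply: aeW => z.
  have := inf_conv_le d0 z.1 z.2 a0 fM; have := gF z.2; lra.
have := le_trans H (mul_sqrt_le nn C0 k0 l0).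
have h3 := penalty_dual_weight qr wa nn0 nnE.
have h4 : l * C * (nn ^+ 2 / 2) <= l * C * penalty q nn by rewrite ler_wpM2l// ltW//
  mulr_gt0.
have psiE : \int[Q]_y psi y = - l * \int[Q]_y f y by rewrite RintegralZl.
move=> h5; have h6 : l * (m - \int[Q]_y f y) <= k + l * (l * C * penalty q nn).
  have : l * (m - \int[Q]_y f y) <= l * (k / l + l * C * penalty q nn) by rewrite
    ler_pM2l//; lra.
  by rewrite [X in _ <= X]mulrDr [l * (k / l)]mulrC divfK// gt_eqF.
have h7 : ln Z + (l * m - C * l ^+ 2 * penalty q nn) <= 0.
  have -> : C * l ^+ 2 * penalty q nn = l * (l * C * penalty q nn) by ring.
  by move: kZ; rewrite psiE; lra.
under eq_integral => y _.
  rewrite (_ : l * (m - f y) - C * l ^+ 2 * penalty q nn =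
    (l * m - C * l ^+ 2 * penalty q nn) + psi y); last by rewrite /psi; ring.
  rewrite expRD EFinM -/(s y); over.
rewrite ge0_integralZl_EFin ?expR_ge0//; last 2 first.
- by move=> y _; rewrite lee_fin expR_ge0.
- exact/measurable_EFinP.
rewrite -(EFin_Rintegral P ms sM) -/Z -EFinM lee_fin -[Z]lnK ?posrE// -expRD.
by rewrite -[leRHS]expR0 ler_expR addrC.
Qed.

(** The quotient is invariant under scaling of [alpha], so the weights are reduced to norm 1, where
    duality gives a coupling of cost at most [v]. *)
Lemma weak_transport_le P Q v : 0 <= v ->
  (forall beta f g, dual_weights q beta -> ('N[Q]_q[EFin \o beta] = 1)%E ->
    bounded_continuous f -> bounded_continuous g ->
    (forall x y, g y - f x <= beta y * d x y) -> \int[Q]_y g y - \int[P]_x f x <= v) ->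
  (weak_transport q d P Q <= v%:E)%E.
Proof.
move=> v0 H; apply/ereal_supP => _ [alpha la <-]; have [a0 _] := la.
have inf_le pi : couplings P Q pi ->
    ((\int[pi]_z (alpha z.2 * d z.1 z.2)%:E) / 'N[Q]_q[EFin \o alpha] <= v%:E)%E ->
    (ereal_inf [set ((\int[pi]_z (alpha z.2 * d z.1 z.2)%:E) / 'N[Q]_q[EFin \o alpha])%E
      | pi in couplings P Q] <= v%:E)%E.
  by move=> piPQ; apply: le_trans; apply: ereal_inf_lbound; exists pi.
(* The inverse of +oo is 0, so the quotient vanishes even when the cost is infinite. *)
have [Noo|Nfin] := eqVneq ('N[Q]_q[EFin \o alpha])%E +oo%E.
  have [pi piPQ] := coupling_exists hE P Q.
  by apply: (inf_le pi) => //; rewrite Noo /inve mule0 lee_fin.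
have [n [n0 nE]] : exists n, 0 <= n /\ ('N[Q]_q[EFin \o alpha] = n%:E)%E.
  exists (fine ('N[Q]_q[EFin \o alpha])%E); rewrite fine_ge0 ?Lnorm_ge0//; split => //.
  by rewrite fineK// ge0_fin_numE ?Lnorm_ge0// ltey.
have [n00|nN0] := eqVneq n 0.
  have [pi piPQ] := coupling_exists hE P Q; apply: (inf_le pi) => //.
  have az : \forall y \ae Q, alpha y = 0 by apply: (ae_eq0_of_Lnorm qr la);
    rewrite nE n00.
  by rewrite (weighted_cost_eq0 hE d0 dlsc la piPQ az) mul0e lee_fin.
have np : 0 < n by rewrite lt_neqAle eq_sym nN0.
have [beta [wb Nb ab]] := Lnorm_scale np la qr nE.
have [lb _] := wb; have [b0 _] := lb.
have [||f g bf bg fg|pi piPQ cv] := @kantorovich_duality R E hE P Q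
  (fun z => beta z.2 * d z.1 z.2) v.
- by move=> z; rewrite mulr_ge0.
- exact: weighted_cost_lsc.
- exact: (H beta).
apply: (inf_le pi) => //.
rewrite nE /inve (negbTE nN0).
have mb := measurable_weighted_cost hE d0 dlsc lb.
have -> : (\int[pi]_z (alpha z.2 * d z.1 z.2)%:E = n%:E * \int[pi]_z (beta z.2 * d z.1
  z.2)%:E)%E.
  rewrite -ge0_integralZl_EFin//; last first.
    by move=> z _; rewrite lee_fin mulr_ge0.
  have abz := coupling_ae_snd piPQ ab.
  have e z : alpha z.2 = n * beta z.2 ->
    ((alpha z.2 * d z.1 z.2)%:E = n%:E * (beta z.2 * d z.1 z.2)%:E)%E.
    by move=> ->; rewrite -EFinM mulrA.
  apply/eqP; rewrite eq_le; apply/andP; split.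
    apply: ae_integral_le; first exact: measurable_funeM.
    by apply: ae_mono abz => z /e ->.
  apply: ae_integral_ge; first exact: measurable_funeM.
  by apply: ae_mono abz => z /e ->.
rewrite -muleA muleC -muleA -EFinM mulVf// mule1; exact: cv.
Qed.

Let weak_transport_entropy_le P1 P2 K :
    (0 <= K)%E ->
    (forall k, K = k%:E -> (weak_transport q d P1 P2 <= (Num.sqrt (2 * C * k))%:E)%E) ->
  (weak_transport q d P1 P2 <= sqrte ((2 * C)%:E * K))%E.
Proof.
case: K => [k _ /(_ k erefl)//|_ _|//].
by rewrite gt0_muley ?lte_fin ?mulr_gt0// leey.
Qed.

(** Replacing the convolution by the continuous [g] below it gives an exponent integrable under Q,
    to which Gibbs applies. A weight of norm 1 has mean penalty 1/2, which leaves l (Q[g] - P[f]) <=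
    k + C l^2/2. *)
Lemma weak_transport_ineq_of_dual P :
  (forall l alpha f, 0 < l -> dual_weights q alpha -> bounded_continuous f ->
    (\int[P]_y expeR (l%:E * ((inf_conv alpha d f y)%:E - \int[P]_x (f x)%:E)
      - (C * l ^+ 2)%:E * bracket q (fun r => (alpha y `^ r)%:E)) <= 1)%E) ->
  weak_transport_ineq q d C P.
Proof.
move=> H Q; apply: weak_transport_entropy_le; first exact: relative_entropy_ge0.
move=> k kE; have QP : Q `<< P.
  by move: kE; rewrite /relative_entropy; case: pselect.
apply: weak_transport_le; first exact: sqrtr_ge0.
move=> beta f g wb Nb bf bg fg; apply: le_sqrt_of_quadratic => // l l0.
have [lb _] := wb.
have [ipen penE _] := penalty_mean qr lb ler01 Nb.
have ig := bounded_continuous_integrable Q bg.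
set pf := \int[P]_x f x.
have [iphi phiE] := integrable_affine l (- (C * l ^+ 2)) (- (l * pf)) ig ipen.
have phi1 : (\int[P]_y (expR (l * g y + - (C * l ^+ 2) * (penalty q \o beta) y +
    - (l * pf)))%:E <= 1)%E.
  apply: le_trans (H _ _ _ l0 wb bf); rewrite -(EFin_mean P bf) -/pf.
  under [leRHS]eq_integral do rewrite exponent_pointwise.
  apply: integral_mono => y; rewrite lee_fin ler_expR.
  have : g y <= inf_conv beta d f y by apply: le_inf_conv => x; have := fg x y; lra.
  by rewrite -(ler_pM2l l0) /=; lra.
have := gibbs_le_relative_entropy QP iphi phi1; rewrite kE.
have -> : (\int[Q]_y (l * g y + - (C * l ^+ 2) * (penalty q \o beta) y + - (l * pf))%:E
  =
   (\int[Q]_y (l * g y + - (C * l ^+ 2) * (penalty q \o beta) y + - (l * pf)))%:E)%E.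
  by rewrite fineK// integrable_fin_num.
rewrite phiE lee_fin penE penalty1; lra.
Qed.

(** The weight and [g] are now integrated under P, so the exponent passed to Gibbs is affine in [f];
    replacing the mean of the convolution by the smaller mean of [g] lowers it. *)
Lemma inverted_weak_transport_ineq_of_dual P :
  (forall l alpha f, 0 < l -> dual_weights q alpha -> bounded_continuous f ->
    (\int[P]_y expeR (l%:E * (\int[P]_x (inf_conv alpha d f x)%:E - (f y)%:E)
     - (C * l ^+ 2)%:E * bracket q (fun r => \int[P]_x (alpha x `^ r)%:E)) <= 1)%E) ->
  inverted_weak_transport_ineq q d C P.
Proof.
move=> H Q; apply: weak_transport_entropy_le; first exact: relative_entropy_ge0.
move=> k kE; have QP : Q `<< P.
  by move: kE; rewrite /relative_entropy; case: pselect.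
apply: weak_transport_le; first exact: sqrtr_ge0.
move=> beta f g wb Nb bf bg fg; apply: le_sqrt_of_quadratic => // l l0.
have [lb _] := wb.
have [_ _ brE] := penalty_mean qr lb ler01 Nb.
have ifQ := bounded_continuous_integrable Q bf.
have [h [ih hF mE]] := mean_inf_conv P lb bf.
set m := \int[P]_y h y in mE; set mg := \int[P]_y g y.
have mgm : mg <= m.
  rewrite -lee_fin -mE /mg (EFin_mean P bg); apply: integral_mono => y.
  by rewrite lee_fin; apply: le_inf_conv => x; have := fg x y; lra.
(* The term with coefficient 0 only fits the exponent to the shape of [integrable_affine]. *)
have [iphi phiE] := integrable_affine (- l) 0 (l * mg - C * l ^+ 2 / 2) ifQ ifQ.
have phi1 : (\int[P]_y (expR (- l * f y + 0 * f y + (l * mg - C * l ^+ 2 / 2)))%:E <=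
  1)%E.
  apply: le_trans (H _ _ _ l0 wb bf); rewrite mE brE.
  under [leRHS]eq_integral do rewrite exponent_mean.
  apply: integral_mono => y; rewrite lee_fin ler_expR penalty1.
  by move: mgm; rewrite -(ler_pM2l l0) /=; lra.
have := gibbs_le_relative_entropy QP iphi phi1; rewrite kE.
have -> : (\int[Q]_y (- l * f y + 0 * f y + (l * mg - C * l ^+ 2 / 2))%:E =
   (\int[Q]_y (- l * f y + 0 * f y + (l * mg - C * l ^+ 2 / 2)))%:E)%E.
  by rewrite fineK// integrable_fin_num.
rewrite phiE lee_fin; lra.
Qed.

End duality.

End duality_formulas.

Local Open Scope ereal_scope.

Theorem theorem3p1 (R : realType) (E : ptopologicalType)
    (hE : polish R E)
    (d : E -> E -> R) (hd : is_metric d)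
    (hdlsc : lower_semicontinuous (fun z : E * E => (d z.1 z.2)%:E))
    (p : R) (q : \bar R) (hp : (1 <= p <= 2)%R) (hpq : p%:E^-1 + q^-1 = 1)
    (C : R) (hC : (0 < C)%R) (P : probability (borel E) R) :
  (weak_transport_ineq q d C P <->
    ereal_sup [set ereal_sup [set ereal_sup [set
        \int[P]_y expeR
          (lambda%:E * ((inf_conv alpha d f y)%:E - \int[P]_x (f x)%:E)
           - (C * lambda ^+ 2)%:E * bracket q (fun r => (alpha y `^ r)%:E))
      | f in @bounded_continuous R E]
      | alpha in @dual_weights R E q]
      | lambda in [set l : R | (0 < l)%R]] <= 1)
  /\
  (inverted_weak_transport_ineq q d C P <->
    ereal_sup [set ereal_sup [set ereal_sup [set
        \int[P]_y expeR
          (lambda%:E * (\int[P]_x (inf_conv alpha d f x)%:E - (f y)%:E)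
           - (C * lambda ^+ 2)%:E
             * bracket q (fun r => \int[P]_x (alpha x `^ r)%:E))
      | f in @bounded_continuous R E]
      | alpha in @dual_weights R E q]
      | lambda in [set l : R | (0 < l)%R]] <= 1).
Proof.
have qr := conjugate_ge2 hp hpq.
have [d0 dP _ _] := hd.
have dxx x : d x x = 0%R by exact/dP.
have bound3 (F : R -> (E -> R) -> (E -> R) -> \bar R) :
  ereal_sup [set ereal_sup [set ereal_sup [set F lambda alpha f
      | f in @bounded_continuous R E] | alpha in @dual_weights R E q]
      | lambda in [set l : R | (0 < l)%R]] <= 1 <->
  forall l alpha f, (0 < l)%R -> dual_weights q alpha -> bounded_continuous f ->
    F l alpha f <= 1.
  split=> [/ereal_supP H l alpha f l0 wa bf|H].
    have /ereal_supP H1 := H _ (ex_intro2 _ _ l l0 erefl).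
    have /ereal_supP H2 := H1 _ (ex_intro2 _ _ alpha wa erefl).
    exact: H2 _ (ex_intro2 _ _ f bf erefl).
  apply/ereal_supP => _ [l l0 <-]; apply/ereal_supP => _ [alpha wa <-].
  by apply/ereal_supP => _ [f bf <-]; exact: H.
split; (split=> [H|/bound3 H]; [apply/bound3 => l alpha f l0 wa bf|]).
- exact: dual_of_weak_transport_ineq.
- exact: weak_transport_ineq_of_dual.
- exact: dual_of_inverted_weak_transport_ineq.
- exact: inverted_weak_transport_ineq_of_dual.
Qed.
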